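(* Let $r,s\ge1$ be integers, let $\widehat Q=\sum_{i=1}^sA_iw^{-i}$ be a $(\dot\varphi,r)$-Galois-closed irregular type with irregular class $\widehat\Theta$, let $g'\in W$ generate its $(\dot\varphi,r)$-Galois-orbit, and set $\mathbf g=\dot\varphi g'\in GL(\mathfrak t)$. Let $\Gamma_{\dot\varphi,r}(\widehat Q)=\pi_1(\mathbf B_{\dot\varphi,r}(\widehat Q),\widehat Q)$ and $\overline\Gamma_{\dot\varphi,r}(\widehat\Theta)=\pi_1(\mathbf B_{\dot\varphi,r}(\widehat\Theta),\widehat\Theta)$. Then: (1) there is a direct-product decomposition $\Gamma_{\dot\varphi,r}(\widehat Q)=\prod_{i=1}^s\Gamma_{\dot\varphi,r}(\widehat Q,i)$, with $\Gamma_{\dot\varphi,r}(\widehat Q,i)=\pi_1(\mathbf B_{\dot\varphi,r}(\widehat Q,i),A_i)$, where $$\mathbf B_{\dot\varphi,r}(\widehat Q,i)=\mathfrak t_{\phi_i}(\mathbf g_{\phi_i},\zeta_r^i)\setminus\bigcup_{\alpha\in\phi_{i+1}\setminus\phi_i}\bigl(\ker(\alpha)\cap\mathfrak t_{\phi_i}(\mathbf g_{\phi_i},\zeta_r^i)\bigr)\subset\mathfrak t_{\phi_i};$$ (2) there is a short exact group sequence $$1\to\Gamma_{\dot\varphi,r}(\widehat Q)\to\overline\Gamma_{\dot\varphi,r}(\widehat\Theta)\to Z_{W,\boldsymbol\phi}(\dot\varphi,\mathbf g)\to1.$$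
   Context: $G$ is a connected complex reductive algebraic group with maximal torus $T$, Lie algebras $\mathfrak t\subset\mathfrak g$, root system $\Phi$, Weyl group $W$; $\mathfrak g'=[\mathfrak g,\mathfrak g]$, $\mathfrak t'=\mathfrak t\cap\mathfrak g'$, so that $\mathfrak t=\mathfrak Z(\mathfrak g)\oplus\mathfrak t'$, and $\Phi'$ is the root system of $(\mathfrak g',\mathfrak t')$, with the same Weyl group $W$. $\zeta_r=e^{2\pi\sqrt{-1}/r}$; $V(g,\zeta)=\ker(g-\zeta\,\mathrm{Id}_V)$. Fix an outer automorphism $\dot\varphi=(f,\dot\varphi')\in\mathrm{Out}(\mathfrak g)\simeq GL(\mathfrak Z(\mathfrak g))\times\mathrm{Out}(\Phi')$, with $f$ of finite order, where $\mathrm{Out}(\Phi')=\mathrm{Aut}(\Phi')/W$ is identified with the subgroup of $\mathrm{Aut}(\Phi')$ preserving a chosen base of simple roots; $\dot\varphi$ is viewed as a linear automorphism of $\mathfrak t$. An irregular type is $\widehat Q=\sum_{i=1}^sA_iw^{-i}$, $A_i\in\mathfrak t$, identified with $(A_1,\dots,A_s)\in\mathfrak t^s$; its irregular class is its orbit for the diagonal $W$-action. An element $g'\in W$ generates its $(\dot\varphi,r)$-Galois-orbit if $\dot\varphi g'(A_i)=\zeta_r^iA_i$ for all $i$; $\widehat Q$ (and its class) is $(\dot\varphi,r)$-Galois-closed if such $g'$ exists. Let $d_\alpha(\widehat Q)$ be the pole order in $w$ of $\sum_i\alpha(A_i)w^{-i}$ ($0$ if this vanishes), $\alpha\in\Phi$.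 $\widehat Q\sim_{\dot\varphi,r}\widehat Q'$ means that some $g'\in W$ generates both $(\dot\varphi,r)$-Galois-orbits and $d_\alpha(\widehat Q)=d_\alpha(\widehat Q')$ for all $\alpha$; two $(\dot\varphi,r)$-Galois-closed classes are mutual $(\dot\varphi,r)$-admissible deformations if they are classes of irregular types $\widehat Q\sim_{\dot\varphi,r}\widehat Q'$. $\mathbf B_{\dot\varphi,r}(\widehat Q)\subset\mathfrak t^s$ and $\mathbf B_{\dot\varphi,r}(\widehat\Theta)\subset\mathfrak t^s/W$ are the spaces of $(\dot\varphi,r)$-admissible deformations (of irregularity at most $s$). $\phi_i=\{\alpha\in\Phi:\alpha(A_i)=\dots=\alpha(A_s)=0\}$ for $1\le i\le s$, $\phi_{s+1}=\Phi$; $\mathfrak t_\phi=\bigcap_{\alpha\in\phi}\ker\alpha$; $N_W(\mathfrak t_\phi)$, $W_{\mathfrak t_\phi}$ are the setwise/pointwise stabilizers in $W$; $W(\phi)=N_W(\mathfrak t_\phi)/W_{\mathfrak t_\phi}$; $p_\phi:N_W(\mathfrak t_\phi)\to W(\phi)$ is the projection. $\mathbf g$ preserves $\mathfrak t_{\phi_i}$, with restriction $\mathbf g_{\phi_i}$ (the eigenspaces $\mathfrak t_{\phi_i}(\mathbf g_{\phi_i},\zeta_r^i)$ do not depend on the choice of $g'$); $Z_{W,\phi_i}(\mathbf g)=\{x\in W(\phi_i):x\mathbf g_{\phi_i}=\mathbf g_{\phi_i}x\in GL(\mathfrak t_{\phi_i})\}$ and $Z_{W,\boldsymbol\phi}(\dot\varphi,\mathbf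 g)=\bigl(\bigcap_{i=1}^sp_{\phi_i}^{-1}(Z_{W,\phi_i}(\mathbf g))\bigr)/W_{\mathfrak t_{\phi_1}}$. *)

(* Defs.v *)
(* The complex numbers are R[i], for R : realType. *)
From HB Require Import structures.
From mathcomp Require Import all_boot all_order all_algebra.
From mathcomp Require Import generic_quotient complex ring lra.
From mathcomp Require Import all_classical all_reals topology normedtype trigo.
Set Implicit Arguments.
Unset Strict Implicit.
Unset Printing Implicit Defensive.
Import Order.TTheory GRing.Theory Num.Theory.
Import numFieldNormedType.Exports.
Local Open Scope classical_set_scope.
Local Open Scope ring_scope.

Lemma within_comp (S T U : topologicalType) (A : set S) (B : set T)
    (f : S -> T) (g : T -> U) :
  {within A, continuous f} -> (forall x, A x -> B (f x)) ->
  {within B, continuous g} -> {within A, continuous (g \o f)}.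
Proof.
move=> /subspace_continuousP cf AB /subspace_continuousP cg.
apply/subspace_continuousP => x Ax W /= nW.
have /= nB := cg _ (AB _ Ax) _ nW; have := cf x Ax _ nB.
rewrite /within /nbhs /=.
by apply: filterS => y /= Hy Ay; apply: Hy => //; exact: AB.
Qed.

Section FundamentalGroup.
Context {R : realType}.
Local Notation I := (`[0%R, 1%R]%classic : set R).

(* Only the restriction of a loop to [0, 1] matters: two loops with the same
   restriction are homotopic, hence equal in pi1. *)
Record loop (X : topologicalType) (x : X) := Loop {
  loop_fun :> R -> X;
  loop_cont : {within I, continuous loop_fun};
  loop0 : loop_fun 0 = x;
  loop1 : loop_fun 1 = x }.

Arguments loop_cont {X x} l.
Arguments loop0 {X x} l.
Arguments loop1 {X x} l.

Section Loops.
Context {X : topologicalType} {x : X}.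
Implicit Types f g h : loop x.

HB.instance Definition _ := gen_eqMixin (loop x).
HB.instance Definition _ := gen_choiceMixin (loop x).

(* H (t, u): t runs along the loops, u along the homotopy. *)
Definition homotopic (f g : loop x) : Prop :=
  exists H : R * R -> X, [/\ {within I `*` I, continuous H},
    forall t, I t -> H (t, 0) = f t,
    forall t, I t -> H (t, 1) = g t &
    forall u, I u -> H (0, u) = x /\ H (1, u) = x].

Let I0 : I 0. Proof. by rewrite /= in_itv /= lexx ler01. Qed.
Let I1 : I 1. Proof. by rewrite /= in_itv /= lexx ler01. Qed.

Let h2 : 2 * 2^-1 = 1 :> R. Proof. lra. Qed.

Lemma pair_cont (T : topologicalType) (a b : T -> R) :
  continuous a -> continuous b -> continuous (fun p => (a p, b p)).
Proof. by move=> ca cb p; exact: cvg_pair (ca p) (cb p). Qed.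

Lemma paste (T : topologicalType) (A : set T) (c : T -> R) (f g : T -> X) :
  closed A -> continuous c ->
  {within A `&` [set p | c p <= 2^-1], continuous f} ->
  {within A `&` [set p | 2^-1 <= c p], continuous g} ->
  (forall p, A p -> c p = 2^-1 -> f p = g p) ->
  {within A, continuous (fun p => if c p <= 2^-1 then f p else g p)}.
Proof.
move=> cA cc cf cg fg.
have -> : A = (A `&` [set p | c p <= 2^-1]) `|` (A `&` [set p | 2^-1 <= c p]).
  rewrite -setIUr; apply/seteqP; split => [p Ap|p []//]; split => //.
  by case/orP: (le_total (c p) 2^-1) => ?; [left|right].
apply: withinU_continuous.
- apply: closedI => //.
  exact: (continuous_closedP c).1 cc _ (@closed_le R 2^-1).
- apply: closedI => //.
  exact: (continuous_closedP c).1 cc _ (@closed_ge R 2^-1).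
- apply: (subspace_eq_continuous _ cf) => p; rewrite inE /= => -[_ cp].
  by rewrite /from_subspace /= ifT.
- apply: (subspace_eq_continuous _ cg) => p; rewrite inE /= => -[Ap cp].
  rewrite /from_subspace; case: ifPn => // cp2; apply/esym/fg => //; apply/eqP.
  by rewrite eq_le cp cp2.
Qed.

Lemma closedII : closed (I `*` I).
Proof.
have -> : I `*` I = (fst @^-1` I) `&` (snd @^-1` I) :> set (R * R).
  by apply/seteqP; split => -[].
apply: closedI.
- by apply: (continuous_closedP _).1 (@itv_closed _ R 0 1) => p; exact: cvg_fst.
- by apply: (continuous_closedP _).1 (@itv_closed _ R 0 1) => p; exact: cvg_snd.
Qed.

Lemma homotopic_reparam (F : R -> X) (p q : R -> R) (f g : loop x) :
  {within I, continuous F} -> continuous p -> continuous q ->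
  (forall t, I t -> I (p t)) -> (forall t, I t -> I (q t)) ->
  p 0 = q 0 -> p 1 = q 1 ->
  (forall t, I t -> f t = F (p t)) -> (forall t, I t -> g t = F (q t)) ->
  homotopic f g.
Proof.
move=> cF cp cq Ip Iq pq0 pq1 fF gF.
exists (F \o (fun tu => (1 - tu.2) * p tu.1 + tu.2 * q tu.1)); split.
- apply: within_comp cF.
    apply: continuous_subspaceT => z.
    apply: cvgD; apply: cvgM.
    + by apply: cvgB; [exact: cvg_cst|exact: cvg_snd].
    + by apply: (@cvg_comp _ _ _ fst p); [exact: cvg_fst|exact: cp].
    + exact: cvg_snd.
    + by apply: (@cvg_comp _ _ _ fst q); [exact: cvg_fst|exact: cq].
  move=> [t u] /= [It Iu]; move: (Ip _ It) (Iq _ It) Iu.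
  rewrite /= !in_itv /= => /andP[p0 p1] /andP[q0 q1] /andP[u0 u1].
  by apply/andP; split; nra.
- by move=> t It /=; rewrite fF//; congr F; ring.
- by move=> t It /=; rewrite gF//; congr F; ring.
- move=> u Iu /=; rewrite -[RHS](loop0 f) -[X in _ /\ _ = X](loop1 f) !fF//.
  by rewrite -pq0 -pq1; split; congr F; ring.
Qed.

Lemma homotopic_refl f : homotopic f f.
Proof.
apply: (@homotopic_reparam f id id) => //; first exact: loop_cont.
- by move=> z; exact: cvg_id.
- by move=> z; exact: cvg_id.
Qed.

Lemma homotopic_sym f g : homotopic f g -> homotopic g f.
Proof.
move=> [H [cH H0 H1 Hx]]; exists (H \o (fun p => (p.1, 1 - p.2))).
have IV u : I u -> I (1 - u).
  by rewrite /= !in_itv /= => /andP[u0 u1]; apply/andP; split; lra.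
split.
- apply: within_comp cH.
    apply: continuous_subspaceT; apply: pair_cont => z; first exact: cvg_fst.
    by apply: cvgB; [exact: cvg_cst|exact: cvg_snd].
  by move=> [t u] /= [It Iu]; split => //; exact: IV.
- by move=> t It /=; rewrite subr0 H1.
- by move=> t It /=; rewrite subrr H0.
- by move=> u /IV /Hx.
Qed.

Lemma homotopic_trans f g h :
  homotopic f g -> homotopic g h -> homotopic f h.
Proof.
move=> [H [cH H0 H1 Hx]] [K [cK K0 K1 Kx]].
exists (fun p => if p.2 <= 2^-1 then H (p.1, 2 * p.2) else K (p.1, 2 * p.2 - 1)).
have c2 : continuous (fun p : R * R => 2 * p.2).
  by move=> z; apply: cvgM; [exact: cvg_cst|exact: cvg_snd].
split.
- apply: paste.
  + exact: closedII.
  + by move=> z; exact: cvg_snd.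
  + apply: (@within_comp _ _ _ _ _ (fun p : R * R => (p.1, 2 * p.2)) H _ _ cH).
      apply: continuous_subspaceT; apply: pair_cont => // z; exact: cvg_fst.
    move=> [t u] /= [[It +] u2]; rewrite !in_itv /= => /andP[u0 u1].
    by split => //; apply/andP; split; lra.
  + apply: (@within_comp _ _ _ _ _ (fun p : R * R => (p.1, 2 * p.2 - 1)) K _ _ cK).
      apply: continuous_subspaceT; apply: pair_cont => z; first exact: cvg_fst.
      by apply: cvgB; [exact: c2|exact: cvg_cst].
    move=> [t u] /= [[It +] u2]; rewrite !in_itv /= => /andP[u0 u1].
    by split => //; apply/andP; split; lra.
  + move=> [t u] /= [It _] ->; rewrite h2 subrr.
    by rewrite H1// K0.
- by move=> t It /=; rewrite invr_ge0 ler0n mulr0 H0.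
- move=> t It /=; rewrite ifN; last by rewrite -ltNge; lra.
  by rewrite -K1//; congr K; congr pair; ring.
- move=> u Iu /=; have := Iu; rewrite /= in_itv/= => /andP[u0 u1].
  have [u2|u2] := leP u 2^-1.
    by apply: Hx; rewrite /= in_itv /=; apply/andP; split; lra.
  by apply: Kx; rewrite /= in_itv /=; apply/andP; split; lra.
Qed.

Let hrel f g : bool := `[< homotopic f g >].

Let hrel_refl : reflexive hrel.
Proof. by move=> f; apply/asboolP; exact: homotopic_refl. Qed.

Let hrel_sym : symmetric hrel.
Proof. by move=> f g; apply/asboolP/asboolP => /homotopic_sym. Qed.

Let hrel_trans : transitive hrel.
Proof.
by move=> g f h /asboolP fg /asboolP gh; apply/asboolP; exact: homotopic_trans gh.
Qed.

Definition homotopy_rel := EquivRel _ hrel_refl hrel_sym hrel_trans.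

Definition loop_const : loop x :=
  @Loop X x (cst x) (continuous_subspaceT (fun=> cvg_cst _)) erefl erefl.

Definition rev_fun (f : R -> X) (t : R) := f (1 - t).

Lemma rev_cont (f : loop x) : {within I, continuous (rev_fun f)}.
Proof.
rewrite (_ : rev_fun f = f \o (fun t => 1 - t))//.
apply: within_comp (loop_cont f).
  apply: continuous_subspaceT => z.
  by apply: cvgB; [exact: cvg_cst|exact: cvg_id].
by move=> t; rewrite /= !in_itv /= => /andP[t0 t1]; apply/andP; split; lra.
Qed.

Definition loop_rev (f : loop x) : loop x :=
  @Loop X x (rev_fun f) (@rev_cont f)
    (etrans (congr1 f (subr0 1)) (loop1 f)) (etrans (congr1 f (subrr 1)) (loop0 f)).

Definition cat_fun (f g : R -> X) (t : R) :=
  if t <= 2^-1 then f (2 * t) else g (2 * t - 1).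

Let c2 : continuous (fun t : R => 2 * t).
Proof. by move=> z; apply: cvgM; [exact: cvg_cst|exact: cvg_id]. Qed.

Let c21 : continuous (fun t : R => 2 * t - 1).
Proof. by move=> z; apply: cvgB; [exact: c2|exact: cvg_cst]. Qed.

Lemma cat_cont (f g : loop x) : {within I, continuous (cat_fun f g)}.
Proof.
apply: (paste (c := id)).
- exact: itv_closed.
- by move=> z; exact: cvg_id.
- apply: (@within_comp _ _ _ _ _ (fun t : R => 2 * t) f _ _ (loop_cont f)).
    exact: continuous_subspaceT.
  by move=> t; rewrite /= !in_itv /= => -[/andP[? ?] ?]; apply/andP; split; lra.
- apply: (@within_comp _ _ _ _ _ (fun t : R => 2 * t - 1) g _ _ (loop_cont g)).
    exact: continuous_subspaceT.
  by move=> t; rewrite /= !in_itv /= => -[/andP[? ?] ?]; apply/andP; split; lra.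
- by move=> t _ ->; rewrite h2 subrr loop0 loop1.
Qed.

Lemma cat0 (f g : loop x) : cat_fun f g 0 = x.
Proof. by rewrite /cat_fun invr_ge0 ler0n mulr0 loop0. Qed.

Lemma cat1 (f g : loop x) : cat_fun f g 1 = x.
Proof.
rewrite /cat_fun ifN; last by rewrite -ltNge; lra.
by rewrite (_ : 2 * 1 - 1 = 1) ?loop1//; ring.
Qed.

Definition loop_cat (f g : loop x) : loop x :=
  @Loop X x (cat_fun f g) (@cat_cont f g) (cat0 f g) (cat1 f g).

Lemma homotopic_rev f g : homotopic f g -> homotopic (loop_rev f) (loop_rev g).
Proof.
move=> [H [cH H0 H1 Hx]]; exists (H \o (fun p => (1 - p.1, p.2))).
have IV u : I u -> I (1 - u).
  by rewrite /= !in_itv /= => /andP[u0 u1]; apply/andP; split; lra.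
split.
- apply: within_comp cH.
    apply: continuous_subspaceT; apply: pair_cont => z; last exact: cvg_snd.
    by apply: cvgB; [exact: cvg_cst|exact: cvg_fst].
  by move=> [t u] /= [It Iu]; split => //; exact: IV.
- by move=> t /IV It /=; rewrite H0.
- by move=> t /IV It /=; rewrite H1.
- by move=> u /Hx[Hu0 Hu1] /=; rewrite subr0 subrr.
Qed.

Lemma homotopic_cat f f' g g' : homotopic f f' -> homotopic g g' ->
  homotopic (loop_cat f g) (loop_cat f' g').
Proof.
move=> [H [cH H0 H1 Hx]] [K [cK K0 K1 Kx]].
exists (fun p => if p.1 <= 2^-1 then H (2 * p.1, p.2) else K (2 * p.1 - 1, p.2)).
have c2' : continuous (fun p : R * R => 2 * p.1).
  by move=> z; apply: cvgM; [exact: cvg_cst|exact: cvg_fst].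
split.
- apply: paste.
  + exact: closedII.
  + by move=> z; exact: cvg_fst.
  + apply: (@within_comp _ _ _ _ _ (fun p : R * R => (2 * p.1, p.2)) H _ _ cH).
      apply: continuous_subspaceT; apply: pair_cont => // z; exact: cvg_snd.
    move=> [t u] /= [[+ Iu] u2]; rewrite !in_itv /= => /andP[u0 u1].
    by split => //; apply/andP; split; lra.
  + apply: (@within_comp _ _ _ _ _ (fun p : R * R => (2 * p.1 - 1, p.2)) K _ _ cK).
      apply: continuous_subspaceT; apply: pair_cont => z; last exact: cvg_snd.
      by apply: cvgB; [exact: c2'|exact: cvg_cst].
    move=> [t u] /= [[+ Iu] u2]; rewrite !in_itv /= => /andP[u0 u1].
    by split => //; apply/andP; split; lra.
  + move=> [t u] /= [_ Iu] ->; rewrite h2 subrr.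
    by have [_ ->] := Hx _ Iu; have [-> _] := Kx _ Iu.
- move=> t /=; rewrite in_itv/= /cat_fun => /andP[? ?].
  have [?|?] := leP t 2^-1.
    by rewrite H0//= in_itv/=; apply/andP; split; lra.
  by rewrite K0//= in_itv/=; apply/andP; split; lra.
- move=> t /=; rewrite in_itv/= /cat_fun => /andP[? ?].
  have [?|?] := leP t 2^-1.
    by rewrite H1//= in_itv/=; apply/andP; split; lra.
  by rewrite K1//= in_itv/=; apply/andP; split; lra.
- move=> u Iu /=; rewrite invr_ge0 ler0n mulr0 (Hx _ Iu).1.
  rewrite ifN; last by rewrite -ltNge; lra.
  by rewrite (_ : 2 * 1 - 1 = 1) ?(Kx _ Iu).2//; ring.
Qed.

Let cid_ : continuous (fun t : R => t). Proof. by move=> z; exact: cvg_id. Qed.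

Lemma loop_catA f g h :
  homotopic (loop_cat f (loop_cat g h)) (loop_cat (loop_cat f g) h).
Proof.
apply: homotopic_sym.
pose p (t : R) := Num.min (2 * t) (Num.min (t + 4^-1) (2^-1 * (t + 1))).
apply: (@homotopic_reparam (loop_cat f (loop_cat g h)) p id) => //.
- exact: loop_cont.
- move=> z; apply: continuous_min; first exact: c2.
  apply: continuous_min.
    by apply: cvgD; [exact: cvg_id|exact: cvg_cst].
  apply: cvgM; first exact: cvg_cst.
  by apply: cvgD; [exact: cvg_id|exact: cvg_cst].
- move=> t; rewrite /= !in_itv /= /p => /andP[t0 t1].
  rewrite !(le_min,ge_min); apply/andP; split.
    by apply/and3P; split; lra.
  by apply/or3P; apply: Or33; lra.
- rewrite /p; have [] := leP (0 + 4^-1 : R) (2^-1 * (0 + 1)) => ?;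
    case: leP; lra.
- rewrite /p; have [] := leP (1 + 4^-1 : R) (2^-1 * (1 + 1)) => ?;
    case: leP; lra.
- move=> t; rewrite /= in_itv /= => /andP[t0 t1]; rewrite /cat_fun.
  have [t2|t2] := leP t 2^-1; last first.
    have -> : p t = 2^-1 * (t + 1).
      by rewrite /p; case: (leP (t + 4^-1)) => ?; case: leP => ?; lra.
    rewrite ifN; last by rewrite -ltNge; lra.
    rewrite ifN; last by rewrite -ltNge; lra.
    congr (h _); lra.
  have [t4|t4] := leP (2 * t) 2^-1.
    have -> : p t = 2 * t.
      by rewrite /p; case: (leP (t + 4^-1)) => ?; case: leP => ?; lra.
    by rewrite t4.
  have -> : p t = t + 4^-1.
    by rewrite /p; case: (leP (t + 4^-1)) => ?; case: leP => ?; lra.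
  rewrite [RHS]ifN; last by rewrite -ltNge; lra.
  rewrite [RHS]ifT; last by lra.
  congr (g _); lra.
Qed.

Lemma loop_cat1l f : homotopic (loop_cat loop_const f) f.
Proof.
apply: (@homotopic_reparam f (fun t => Num.max 0 (2 * t - 1)) id) => //.
- exact: loop_cont.
- move=> z; apply: (@continuous_max _ R (cst 0) (fun t => 2 * t - 1)).
    exact: cvg_cst.
  exact: c21.
- move=> t; rewrite /= !in_itv /= => /andP[t0 t1].
  by have [?|?] := leP (0 : R) (2 * t - 1); apply/andP; split; lra.
- by rewrite /=; case: leP => ?; lra.
- by rewrite /=; case: leP => ?; lra.
- move=> t It /=; rewrite /cat_fun; have [?|?] := leP t 2^-1.
    by rewrite max_l ?loop0//; lra.
  by rewrite max_r//; lra.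
Qed.

Lemma loop_cat1r f : homotopic (loop_cat f loop_const) f.
Proof.
apply: (@homotopic_reparam f (fun t => Num.min (2 * t) 1) id) => //.
- exact: loop_cont.
- move=> z; apply: (@continuous_min _ R (fun t => 2 * t) (cst 1)).
    exact: c2.
  exact: cvg_cst.
- move=> t; rewrite /= !in_itv /= => /andP[t0 t1].
  by have [?|?] := leP (2 * t) 1; apply/andP; split; lra.
- by rewrite /=; case: leP => ?; lra.
- by rewrite /=; case: leP => ?; lra.
- move=> t It /=; rewrite /cat_fun; have [?|?] := leP t 2^-1.
    by rewrite min_l//; lra.
  by rewrite min_r ?loop1//; lra.
Qed.

Lemma loop_catVr f : homotopic (loop_cat f (loop_rev f)) loop_const.
Proof.
apply: (@homotopic_reparam f (fun t => Num.min (2 * t) (2 - 2 * t)) (cst 0)) => //.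
- exact: loop_cont.
- move=> z; apply: (@continuous_min _ R (fun t => 2 * t) (fun t => 2 - 2 * t)).
    exact: c2.
  by apply: cvgB; [exact: cvg_cst|exact: c2].
- by move=> z; exact: cvg_cst.
- move=> t; rewrite /= !in_itv /= => /andP[t0 t1].
  by have [?|?] := leP (2 * t) (2 - 2 * t); apply/andP; split; lra.
- by rewrite /=; case: leP => ?; lra.
- by rewrite /=; case: leP => ?; lra.
- move=> t It /=; rewrite /cat_fun; have [?|?] := leP t 2^-1.
    by rewrite min_l//; lra.
  by rewrite min_r; [congr (f _); ring|lra].
- by move=> t _ /=; rewrite loop0.
Qed.

Lemma loop_catVl f : homotopic (loop_cat (loop_rev f) f) loop_const.
Proof.
apply: (@homotopic_reparam f
  (fun t => Num.max (1 - 2 * t) (2 * t - 1)) (cst 1)) => //.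
- exact: loop_cont.
- move=> z; apply: (@continuous_max _ R (fun t => 1 - 2 * t) (fun t => 2 * t - 1));
    last exact: c21.
  by apply: cvgB; [exact: cvg_cst|exact: c2].
- by move=> z; exact: cvg_cst.
- move=> t; rewrite /= !in_itv /= => /andP[t0 t1].
  by have [?|?] := leP (1 - 2 * t) (2 * t - 1); apply/andP; split; lra.
- by rewrite /=; case: leP => ?; lra.
- by rewrite /=; case: leP => ?; lra.
- move=> t It /=; rewrite /cat_fun /rev_fun; have [?|?] := leP t 2^-1.
    by rewrite max_l//; lra.
  by rewrite max_r//; lra.
- by move=> t _ /=; rewrite loop1.
Qed.

End Loops.

Local Open Scope quotient_scope.

Definition pi1 {X : topologicalType} (x : X) := {eq_quot (@homotopy_rel X x)}.

Section Pi1Group.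
Context {X : topologicalType} {x : X}.
Local Notation P := (pi1 x).

HB.instance Definition _ := Choice.copy P {eq_quot (@homotopy_rel X x)}.
HB.instance Definition _ := EqQuotient.copy P {eq_quot (@homotopy_rel X x)}.

Definition pi1_class (f : loop x) : P := \pi_P f.

Lemma pi1_classE (f g : loop x) :
  pi1_class f = pi1_class g <-> homotopic f g.
Proof.
split; first by move/eqmodP/asboolP.
by move=> fg; apply/eqmodP/asboolP.
Qed.

Definition pi1_one : P := pi1_class loop_const.
Definition pi1_mul (a b : P) : P := pi1_class (loop_cat (repr a) (repr b)).
Definition pi1_inv (a : P) : P := pi1_class (loop_rev (repr a)).

Lemma pi1_reprE (f : loop x) : homotopic (repr (pi1_class f)) f.
Proof. by apply/pi1_classE; rewrite /pi1_class reprK. Qed.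

Lemma pi1_ind (Q : P -> Prop) : (forall f, Q (pi1_class f)) -> forall a, Q a.
Proof. by move=> Qf a; rewrite -[a]reprK; exact: Qf. Qed.

Lemma pi1_mulE (f g : loop x) :
  pi1_mul (pi1_class f) (pi1_class g) = pi1_class (loop_cat f g).
Proof. by apply/pi1_classE/homotopic_cat; exact: pi1_reprE. Qed.

Lemma pi1_invE (f : loop x) : pi1_inv (pi1_class f) = pi1_class (loop_rev f).
Proof. by apply/pi1_classE/homotopic_rev; exact: pi1_reprE. Qed.

Lemma pi1_mulA : associative pi1_mul.
Proof.
elim/pi1_ind => f; elim/pi1_ind => g; elim/pi1_ind => h.
by rewrite !pi1_mulE; apply/pi1_classE; exact: loop_catA.
Qed.

Lemma pi1_mul1l : left_id pi1_one pi1_mul.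
Proof.
by elim/pi1_ind => f; rewrite pi1_mulE; apply/pi1_classE; exact: loop_cat1l.
Qed.

Lemma pi1_mul1r : right_id pi1_one pi1_mul.
Proof.
by elim/pi1_ind => f; rewrite pi1_mulE; apply/pi1_classE; exact: loop_cat1r.
Qed.

Lemma pi1_mulVl : left_inverse pi1_one pi1_inv pi1_mul.
Proof.
elim/pi1_ind => f; rewrite pi1_invE pi1_mulE; apply/pi1_classE.
exact: loop_catVl.
Qed.

Lemma pi1_mulVr : right_inverse pi1_one pi1_inv pi1_mul.
Proof.
elim/pi1_ind => f; rewrite pi1_invE pi1_mulE; apply/pi1_classE.
exact: loop_catVr.
Qed.

HB.instance Definition _ :=
  isGroup.Build P pi1_mulA pi1_mul1l pi1_mul1r pi1_mulVl pi1_mulVr.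

End Pi1Group.

Section Pi1Map.
Context {X Y : topologicalType} (F : X -> Y) (cF : continuous F).
Context {x : X} {y : Y} (Fx : F x = y).

Lemma loop_map_cont (f : loop x) : {within I, continuous (F \o f)}.
Proof.
apply: (@within_comp _ _ _ I setT) => //; first exact: loop_cont.
exact: continuous_subspaceT.
Qed.

Definition loop_map (f : loop x) : loop y :=
  @Loop Y y (F \o f) (@loop_map_cont f)
    (etrans (congr1 F (loop0 f)) Fx) (etrans (congr1 F (loop1 f)) Fx).

(* The morphism induced on fundamental groups by F, where F x = y. *)
Definition pi1_map (a : pi1 x) : pi1 y := pi1_class (loop_map (repr a)).

Lemma homotopic_map (f g : loop x) :
  homotopic f g -> homotopic (loop_map f) (loop_map g).
Proof.
move=> [H [cH H0 H1 Hx]]; exists (F \o H); split.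
- apply: (@within_comp _ _ _ (I `*` I) setT) => //.
  exact: continuous_subspaceT.
- by move=> t It /=; rewrite H0.
- by move=> t It /=; rewrite H1.
- by move=> u Iu /=; have [-> ->] := Hx _ Iu.
Qed.

Lemma pi1_mapE (f : loop x) : pi1_map (pi1_class f) = pi1_class (loop_map f).
Proof. by apply/pi1_classE/homotopic_map/pi1_reprE. Qed.

Lemma pi1_mapM : {morph pi1_map : a b / (a * b)%g}.
Proof.
elim/(@pi1_ind X x) => f; elim/(@pi1_ind X x) => g.
have -> : pi1_map (pi1_class f * pi1_class g)%g =
    pi1_class (loop_map (loop_cat f g)).
  by rewrite -pi1_mapE; congr pi1_map; exact: pi1_mulE.
rewrite !pi1_mapE; rewrite [RHS]pi1_mulE; apply/pi1_classE.
apply: (@homotopic_reparam _ _ (loop_map (loop_cat f g)) id id) => //.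
- exact: loop_cont.
- by move=> z; exact: cvg_id.
- by move=> z; exact: cvg_id.
- by move=> t _ /=; rewrite /cat_fun; case: ifP.
Qed.

End Pi1Map.
End FundamentalGroup.
Arguments pi1 R {X} x.

(* The general linear group of V as a groupType; a * b is a \o b. *)
Record GL {K : fieldType} (V : vectType K) := MkGL {
  GL_val :> 'End(V);
  GL_inj : lker GL_val == 0%VS }.
Arguments MkGL {K V}.

Section GLGroup.
Context {K : fieldType} {V : vectType K}.
Implicit Types a b : GL V.

HB.instance Definition _ := [isSub for @GL_val K V].
HB.instance Definition _ := [Choice of GL V by <:].

Lemma GL_one_inj : lker (\1%VF : 'End(V)) == 0%VS.
Proof. by apply/lker0P => x y; rewrite !id_lfunE. Qed.

Definition GL_one : GL V := MkGL \1%VF GL_one_inj.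

Lemma GL_mul_inj a b : lker (a \o b)%VF == 0%VS.
Proof.
apply/lker0P => x y; rewrite !comp_lfunE.
by move=> /(lker0P (GL_inj a)) /(lker0P (GL_inj b)).
Qed.

Definition GL_mul a b : GL V := MkGL (a \o b)%VF (GL_mul_inj a b).

Lemma GL_inv_inj a : lker (a^-1)%VF == 0%VS.
Proof.
apply/lker0P => x y xy.
by rewrite -(lker0_lfunVK (GL_inj a) x) -(lker0_lfunVK (GL_inj a) y) xy.
Qed.

Definition GL_inv a : GL V := MkGL (a^-1)%VF (GL_inv_inj a).

Lemma GL_mulA : associative GL_mul.
Proof. by move=> a b c; apply/val_inj; rewrite /= comp_lfunA. Qed.

Lemma GL_mul1l : left_id GL_one GL_mul.
Proof. by move=> a; apply/val_inj; rewrite /= comp_lfun1l. Qed.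

Lemma GL_mul1r : right_id GL_one GL_mul.
Proof. by move=> a; apply/val_inj; rewrite /= comp_lfun1r. Qed.

Lemma GL_mulVl : left_inverse GL_one GL_inv GL_mul.
Proof. by move=> a; apply/val_inj; rewrite /= lker0_compVf ?GL_inj. Qed.

Lemma GL_mulVr : right_inverse GL_one GL_inv GL_mul.
Proof. by move=> a; apply/val_inj; rewrite /= lker0_compfV ?GL_inj. Qed.

HB.instance Definition _ :=
  isGroup.Build (GL V) GL_mulA GL_mul1l GL_mul1r GL_mulVl GL_mulVr.

Lemma GL1E x : (1%g : GL V) x = x.
Proof. by rewrite /= id_lfunE. Qed.

Lemma GLME a b x : (a * b)%g x = a (b x).
Proof. by rewrite /= comp_lfunE. Qed.

Lemma GLK a x : (a^-1)%g (a x) = x.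
Proof. by rewrite -GLME mulVg GL1E. Qed.

Lemma GLKV a x : a ((a^-1)%g x) = x.
Proof. by rewrite -GLME mulgV GL1E. Qed.

End GLGroup.

Section Groups.
Local Open Scope group_scope.

Record is_subgroup (G : groupType) (H : set G) : Prop := IsSubgroup {
  subgroup1 : H 1;
  subgroupM : forall x y, H x -> H y -> H (x * y);
  subgroupV : forall x, H x -> H x^-1 }.

Definition gen_subgroup (G : groupType) (S : set G) : set G :=
  [set x | forall H, is_subgroup H -> S `<=` H -> H x].

Lemma gen_subgroup_sub (G : groupType) (S : set G) :
  is_subgroup (gen_subgroup S).
Proof.
split=> [H [//]|x y Sx Sy H sH SH|x Sx H sH SH].
- by apply: subgroupM => //; [exact: Sx|exact: Sy].
- by apply: subgroupV => //; exact: Sx.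
Qed.

Definition left_coset (G : groupType) (x : G) (H : set G) : set G :=
  [set (x * h)%g | h in H].

(* The group { xD | x in N } of left cosets of D by elements of N, for subgroups
   N, D with N normalising D, under setwise product; it is N / D if D <= N. *)
Record subquotient (G : groupType) := Subquotient {
  sq_num : set G;
  sq_den : set G;
  sq_num_sub : is_subgroup sq_num;
  sq_den_sub : is_subgroup sq_den;
  sq_norm : forall x h, sq_num x -> sq_den h -> sq_den (x * h * x^-1) }.

Definition sq_sort (G : groupType) (q : subquotient G) : Type :=
  [set left_coset x (sq_den q) | x in sq_num q].
Coercion sq_sort : subquotient >-> Sortclass.

Section SubquotientGroup.
Context {G : groupType} (q : subquotient G).
Local Notation N := (sq_num q).
Local Notation H := (sq_den q).
Let sN := sq_num_sub q.
Let sH := sq_den_sub q.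

HB.instance Definition _ := Choice.on (sq_sort q).

Definition sq_pack (A : set G) (HA : [set left_coset x H | x in N] A) : q :=
  exist (fun A => A \in [set left_coset x H | x in N]) A (mem_set HA).

Definition sq_coset (x : G) (Nx : N x) : q :=
  sq_pack (ex_intro2 _ _ x Nx erefl).

Lemma sq_cosetP (A : q) : exists x (Nx : N x), A = sq_coset Nx.
Proof.
case: A => A HA; have [x Nx xA] := set_mem HA.
by exists x, Nx; apply: val_inj.
Qed.

Lemma sq_mul_proof (A B : q) :
  [set left_coset x H | x in N] [set a * b | a in val A & b in val B].
Proof.
have [x [Nx ->]] := sq_cosetP A; have [y [Ny ->]] := sq_cosetP B.
exists (x * y); first exact: subgroupM.
apply/seteqP; split => [_ [h Hh <-]|_ [_ [h Hh <-]] [_ [k Hk <-] <-]] /=.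
  exists x; first by exists 1; [exact: subgroup1|rewrite mulg1].
  by exists (y * h); [exists h|rewrite mulgA].
exists (y^-1 * h * y * k).
  apply: subgroupM => //; rewrite -[X in _ * X](invgK y).
  by apply: sq_norm => //; exact: subgroupV.
by rewrite !mulgA mulgK.
Qed.

Definition sq_mul (A B : q) : q := sq_pack (sq_mul_proof A B).

Lemma sq_inv_proof (A : q) : [set left_coset x H | x in N] [set a^-1 | a in val A].
Proof.
have [x [Nx ->]] := sq_cosetP A.
exists (x^-1); first exact: subgroupV.
apply/seteqP; split => [_ [h Hh <-]|_ [_ [h Hh <-]] <-] /=.
  exists (h^-1 * x); last by rewrite invgM invgK.
  exists (x^-1 * h^-1 * x); last by rewrite !mulgA mulgV mul1g.
  rewrite -[X in _ * X](invgK x); apply: sq_norm; first exact: subgroupV.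
  exact: subgroupV.
exists (x * h^-1 * x^-1); first by apply: sq_norm => //; exact: subgroupV.
by rewrite !mulgA mulVg mul1g invgM.
Qed.

Definition sq_inv (A : q) : q := sq_pack (sq_inv_proof A).

Definition sq_one : q := sq_coset (subgroup1 sN).

Lemma sq_mulE x y (Nx : N x) (Ny : N y) :
  sq_mul (sq_coset Nx) (sq_coset Ny) = sq_coset (subgroupM sN Nx Ny).
Proof.
apply: val_inj => /=.
apply/seteqP; split => [_ [_ [h Hh <-]] [_ [k Hk <-] <-]|_ [h Hh <-]] /=.
  exists (y^-1 * h * y * k); last by rewrite !mulgA mulgK.
  apply: subgroupM => //; rewrite -[X in _ * X](invgK y).
  by apply: sq_norm => //; exact: subgroupV.
exists x; first by exists 1; [exact: subgroup1|rewrite mulg1].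
by exists (y * h); [exists h|rewrite mulgA].
Qed.

Lemma sq_invE x (Nx : N x) :
  sq_inv (sq_coset Nx) = sq_coset (subgroupV sN Nx).
Proof.
apply: val_inj => /=.
apply/seteqP; split => [_ [_ [h Hh <-]] <-|_ [h Hh <-]] /=.
  exists (x * h^-1 * x^-1); first by apply: sq_norm => //; exact: subgroupV.
  by rewrite !mulgA mulVg mul1g invgM.
exists (h^-1 * x); last by rewrite invgM invgK.
exists (x^-1 * h^-1 * x); last by rewrite !mulgA mulgV mul1g.
rewrite -[X in _ * X](invgK x); apply: sq_norm; first exact: subgroupV.
exact: subgroupV.
Qed.

Lemma sq_coset_congr x y (Nx : N x) (Ny : N y) :
  x = y -> sq_coset Nx = sq_coset Ny.
Proof. by move=> xy; apply: val_inj; rewrite /= xy. Qed.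

Lemma sq_mulA : associative sq_mul.
Proof.
move=> A B C; have [x [Nx ->]] := sq_cosetP A.
have [y [Ny ->]] := sq_cosetP B; have [z [Nz ->]] := sq_cosetP C.
by rewrite !sq_mulE; apply: sq_coset_congr; rewrite mulgA.
Qed.

Lemma sq_mul1l : left_id sq_one sq_mul.
Proof.
move=> A; have [x [Nx ->]] := sq_cosetP A.
by rewrite sq_mulE; apply: sq_coset_congr; rewrite mul1g.
Qed.

Lemma sq_mul1r : right_id sq_one sq_mul.
Proof.
move=> A; have [x [Nx ->]] := sq_cosetP A.
by rewrite sq_mulE; apply: sq_coset_congr; rewrite mulg1.
Qed.

Lemma sq_mulVl : left_inverse sq_one sq_inv sq_mul.
Proof.
move=> A; have [x [Nx ->]] := sq_cosetP A.
by rewrite sq_invE sq_mulE; apply: sq_coset_congr; rewrite mulVg.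
Qed.

Lemma sq_mulVr : right_inverse sq_one sq_inv sq_mul.
Proof.
move=> A; have [x [Nx ->]] := sq_cosetP A.
by rewrite sq_invE sq_mulE; apply: sq_coset_congr; rewrite mulgV.
Qed.

HB.instance Definition _ :=
  isGroup.Build (sq_sort q) sq_mulA sq_mul1l sq_mul1r sq_mulVl sq_mulVr.

End SubquotientGroup.

(* Direct product, with pointwise operations. *)
Definition dprodg (J : Type) (G : J -> groupType) : Type := forall j, G j.

Section DirectProduct.
Context {J : Type} {G : J -> groupType}.
Local Notation P := (dprodg G).

HB.instance Definition _ := gen_eqMixin P.
HB.instance Definition _ := gen_choiceMixin P.

Let one : P := fun j => 1.
Let inv (a : P) : P := fun j => (a j)^-1.
Let mul (a b : P) : P := fun j => a j * b j.

Let mulA : associative mul.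
Proof. by move=> a b c; apply: functional_extensionality_dep => j; exact: mulgA. Qed.
Let mul1l : left_id one mul.
Proof. by move=> a; apply: functional_extensionality_dep => j; exact: mul1g. Qed.
Let mul1r : right_id one mul.
Proof. by move=> a; apply: functional_extensionality_dep => j; exact: mulg1. Qed.
Let mulVl : left_inverse one inv mul.
Proof. by move=> a; apply: functional_extensionality_dep => j; exact: mulVg. Qed.
Let mulVr : right_inverse one inv mul.
Proof. by move=> a; apply: functional_extensionality_dep => j; exact: mulgV. Qed.

HB.instance Definition _ := isGroup.Build P mulA mul1l mul1r mulVl mulVr.

End DirectProduct.

Definition group_iso (G1 G2 : groupType) (i : G1 -> G2) : Prop :=
  {morph i : x y / x * y} /\ bijective i.

Definition short_exact (G1 G2 G3 : groupType)
    (i : G1 -> G2) (p : G2 -> G3) : Prop :=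
  [/\ {morph i : x y / x * y}, {morph p : x y / x * y},
      injective i, forall x, p x = 1 <-> range i x & range p = setT].

End Groups.

HB.mixin Record isLieAlgebra (K : fieldType) (L : Type) & Vector K L := {
  bracket : L -> L -> L;
  bracketPl : forall x y z (a : K),
    bracket (a *: x + y) z = a *: bracket x z + bracket y z;
  bracketPr : forall x y z (a : K),
    bracket z (a *: x + y) = a *: bracket z x + bracket z y;
  bracketxx : forall x, bracket x x = 0;
  jacobi : forall x y z,
    bracket x (bracket y z) + bracket y (bracket z x)
      + bracket z (bracket x y) = 0 }.

#[short(type="lieAlgebraType")]
HB.structure Definition LieAlgebra (K : fieldType) :=
  {L of Vector K L & isLieAlgebra K L}.

Section LieAlgebras.
Context {K : fieldType} {L : lieAlgebraType K}.
Implicit Types (x y z : L) (U t I J : {vspace L}).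

HB.instance Definition _ x :=
  GRing.isLinear.Build K L L *:%R (bracket x) (fun a y z => bracketPr y z x a).

Definition ad x : 'End(L) := linfun (bracket x).

Lemma ad_is_linear : linear ad.
Proof.
by move=> a x y; apply/lfunP => z; rewrite !lfunE /= !lfunE /= bracketPl !lfunE.
Qed.

HB.instance Definition _ := GRing.isLinear.Build K L 'End(L) *:%R ad ad_is_linear.

Definition lie_center : {vspace L} := lker (linfun ad).

Lemma lie_centerP z : reflect (forall x, bracket z x = 0) (z \in lie_center).
Proof.
rewrite memv_ker lfunE /=; apply: (iffP eqP) => [/lfunP zx x|zx].
  by have := zx x; rewrite !lfunE.
by apply/lfunP => x; rewrite !lfunE /= zx.
Qed.

Definition lie_derived : {vspace L} :=
  <<[seq bracket x y | x <- vbasis {:L}, y <- vbasis {:L}]>>%VS.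

Lemma bracketC x y : bracket x y = - bracket y x.
Proof.
have := bracketxx (1 *: x + y).
rewrite bracketPl !linearD /= !scale1r !bracketxx add0r addr0.
by move/eqP; rewrite addr_eq0 => /eqP.
Qed.

Lemma mem_lie_derived x y : bracket x y \in lie_derived.
Proof.
rewrite (coord_vbasis (memvf y)) linear_sum; apply: memv_suml => j _ /=.
rewrite linearZ; apply: memvZ; rewrite /= bracketC rpredN.
rewrite (coord_vbasis (memvf x)) linear_sum; apply: memv_suml => i _ /=.
rewrite linearZ; apply: memvZ; rewrite /=.
by apply/memv_span/allpairs_f; apply: mem_nth; rewrite size_tuple.
Qed.

Definition lie_ideal I : Prop := forall x y, x \in I -> bracket x y \in I.

(* The adjoint representation is completely reducible. *)
Definition reductive_lie : Prop := forall I, lie_ideal I ->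
  exists2 J, lie_ideal J & (I + J = fullv)%VS /\ (I :&: J = 0)%VS.

(* In a complex reductive Lie algebra these are the Lie algebras of the maximal
   tori of any connected reductive group with that Lie algebra. *)
Record cartan_subalgebra t : Prop := CartanSubalgebra {
  cartan_abelian : forall x y, x \in t -> y \in t -> bracket x y = 0;
  cartan_maximal : forall x, (forall y, y \in t -> bracket x y = 0) -> x \in t;
  cartan_semisimple : forall x, x \in t -> exists2 b : seq L,
    basis_of fullv b & {in b, forall y, exists a : K, bracket x y = a *: y} }.

Definition linform t := 'Hom(subvs_of t, K^o).

Definition root_space U t (a : linform t) : set L :=
  [set x | x \in U /\ forall h, bracket (vsval h) x = (a h : K) *: x].

(* The root system of (U, t), for a subalgebra U containing t. *)
Definition lie_roots U t : set (linform t) :=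
  [set a | a != 0 /\ exists2 x, root_space U a x & x != 0].

Arguments lie_roots U t _ : clear implicits.

(* Completion of a root to an sl2-triple (e, h, f); h is the coroot. *)
Definition coroot t (a : linform t) (h : subvs_of t) : Prop :=
  exists e f, [/\ root_space fullv a e, root_space fullv (- a) f,
    vsval h = bracket e f & a h = 2%:R].

Definition is_reflection t (a : linform t) (w : GL (subvs_of t)) : Prop :=
  exists2 h, coroot a h & forall v : subvs_of t, w v = v - (a v : K) *: h.

Definition weyl t : set (GL (subvs_of t)) :=
  gen_subgroup
    [set w | exists2 a : linform t, lie_roots fullv t a & is_reflection a w].

Definition root_base t (Phi : set (linform t)) (D : seq (linform t)) : Prop :=
  [/\ free D, {in D, forall a, Phi a} &
    forall a, Phi a -> exists c : 'I_(size D) -> nat,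
      a = \sum_(i < size D) D`_i *+ c i \/ a = - \sum_(i < size D) D`_i *+ c i].

(* Aut(Phi) is taken as acting on t; on the dual it acts by transposition, so
   that the stabilisers of Phi and of a base correspond. *)
Definition root_aut t (Phi : set (linform t)) (f : GL (subvs_of t)) : Prop :=
  forall a, Phi (a \o f)%VF <-> Phi a.

Definition base_aut t (D : seq (linform t)) (f : GL (subvs_of t)) : Prop :=
  forall a, ((a \o f)%VF \in D) = (a \in D).

(* f = f1 (+) f2 on t = U1 (+) U2. *)
Definition is_dsum U1 U2 t (f1 : GL (subvs_of U1)) (f2 : GL (subvs_of U2))
    (f : GL (subvs_of t)) : Prop :=
  forall v1 v2 v, vsval v = vsval v1 + vsval v2 ->
    vsval (f v) = vsval (f1 v1) + vsval (f2 v2).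

End LieAlgebras.
Arguments lie_roots {K L} U t _.
Arguments weyl {K L} t.
Arguments lie_center {K} L.
Arguments reductive_lie {K} L.

Section Stabilizers.
Local Open Scope group_scope.
Context {K : fieldType} {L : lieAlgebraType K} {t : {vspace L}}.
Local Notation T := (subvs_of t).
Implicit Types (Phi : set (linform t)) (w g : GL T).

(* The subspace t_Phi. *)
Definition root_kernel Phi : set T := [set x | forall a, Phi a -> a x = 0%R].

Definition setwise_stab Phi : set (GL T) :=
  [set w | weyl t w /\ w @` root_kernel Phi = root_kernel Phi].

Definition pointwise_stab Phi : set (GL T) :=
  [set w | weyl t w /\ forall x, root_kernel Phi x -> w x = x].

(* The projection p_Phi from the setwise stabiliser of t_Phi onto the relative
   Weyl group W(Phi), whose elements are realised as left cosets. *)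
Definition stab_proj Phi w : set (GL T) := left_coset w (pointwise_stab Phi).

Definition rel_weyl Phi : set (set (GL T)) := stab_proj Phi @` setwise_stab Phi.

(* Elements of W(Phi) commuting with g on t_Phi; an element of W(Phi) acts on
   t_Phi through any of its representatives. *)
Definition rel_centralizer Phi g : set (set (GL T)) :=
  [set c | rel_weyl Phi c /\
    exists2 w, c w & forall x, root_kernel Phi x -> w (g x) = g (w x)].

Definition pre_centralizer Phi g : set (GL T) :=
  [set w | setwise_stab Phi w /\ rel_centralizer Phi g (stab_proj Phi w)].

Let W_sub : is_subgroup (weyl t). Proof. exact: gen_subgroup_sub. Qed.

Lemma setwise_stabP Phi w x :
  setwise_stab Phi w -> root_kernel Phi x -> root_kernel Phi (w x).
Proof. by move=> [_ wE] fx; rewrite -wE; exists x. Qed.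

Lemma setwise_stab_sub Phi : is_subgroup (setwise_stab Phi).
Proof.
split=> [|x y [Wx xE] [Wy yE]|x [Wx xE]].
- split; first exact: (subgroup1 W_sub).
  apply/seteqP; split => [_ [x fx <-]|x fx]; first by rewrite GL1E.
  by exists x => //; rewrite GL1E.
- split; first by apply: (subgroupM W_sub).
  have -> : (x * y : GL T) = x \o y :> (T -> T).
    by apply/funext => z; exact: GLME.
  by rewrite -image_comp yE xE.
- split; first by apply: (subgroupV W_sub).
  rewrite -{1}xE image_comp; apply/seteqP; split=> [_ [z fz <-]|z fz].
    by rewrite /= lker0_lfunK // GL_inj.
  by exists z => //; rewrite /= lker0_lfunK // GL_inj.
Qed.

Lemma pointwise_stab_sub Phi : is_subgroup (pointwise_stab Phi).
Proof.
split=> [|x y [Wx xE] [Wy yE]|x [Wx xE]].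
- by split; [exact: (subgroup1 W_sub)|move=> x _; rewrite GL1E].
- by split; [apply: (subgroupM W_sub)|move=> z fz; rewrite GLME yE // xE].
- by split; [apply: (subgroupV W_sub)|move=> z fz; rewrite -{1}[z]xE // GLK].
Qed.

Lemma pointwise_setwise Phi : pointwise_stab Phi `<=` setwise_stab Phi.
Proof.
move=> w [Ww wE]; split => //; apply/seteqP; split => [_ [x fx <-]|x fx].
  by rewrite wE.
by exists x => //; rewrite wE.
Qed.

Lemma pointwise_stab_norm Phi w h :
  setwise_stab Phi w -> pointwise_stab Phi h -> pointwise_stab Phi (w * h * w^-1).
Proof.
move=> Nw [Wh hE]; have sN := setwise_stab_sub Phi.
split.
  apply: (subgroupM W_sub); last by apply: (subgroupV W_sub); case: Nw.
  by apply: (subgroupM W_sub) => //; case: Nw.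
move=> x fx; rewrite !GLME hE ?GLKV //.
by apply: setwise_stabP => //; exact: (subgroupV sN).
Qed.

Lemma pre_centralizer_sub Phi g : is_subgroup (pre_centralizer Phi g).
Proof.
have sN := setwise_stab_sub Phi; have sH := pointwise_stab_sub Phi.
have NH := @pointwise_setwise Phi.
split=> [|x y [Nx [_ [_ [h Hh <-] xC]]] [Ny [_ [_ [k Hk <-] yC]]]|
         x [Nx [_ [_ [h Hh <-] xC]]]].
- have N1 := subgroup1 sN; split => //; split; first by exists 1.
  exists 1; last by move=> x _; rewrite !GL1E.
  by exists 1; [exact: (subgroup1 sH)|rewrite mulg1].
- have Nxy := subgroupM sN Nx Ny; split => //; split; first by exists (x * y).
  exists (x * h * (y * k)).
    exists (y^-1 * h * y^-1^-1 * k).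
      apply: (subgroupM sH) => //; apply: pointwise_stab_norm => //.
      exact: (subgroupV sN).
    by rewrite invgK !mulgA mulgK.
  move=> v fv; rewrite (GLME (x * h)) (GLME (x * h)) yC // xC //.
  by apply: setwise_stabP => //; apply: (subgroupM sN) => //; exact: NH.
- have NV := subgroupV sN Nx; split => //; split; first by exists x^-1.
  exists (x * h)^-1.
    exists (x * h^-1 * x^-1); last by rewrite !mulgA mulVg mul1g invgM.
    by apply: pointwise_stab_norm => //; exact: (subgroupV sH).
  move=> v fv; pose u := (x * h)^-1 v.
  have vE : v = (x * h) u by rewrite /u GLKV.
  rewrite vE -xC ?GLK //; apply: setwise_stabP => //; apply: (subgroupV sN).
  by apply: (subgroupM sN) => //; exact: NH.
Qed.

End Stabilizers.

(* V with its topology of finite-dimensional vector space, transported from K^n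
   by coordinates; on irrtype t s = t^s it is the product topology. *)
Definition vtop {K : numFieldType} (V : vectType K) : Type := V.

HB.instance Definition _ (K : numFieldType) (V : vectType K) :=
  Topological.copy (vtop V)
    (initial_topology (VectorInternalTheory.v2r : V -> 'rV[K]_(dim V))).

Section Deformations.
Local Open Scope quotient_scope.
Context {R : realType} {L : lieAlgebraType R[i]} {t : {vspace L}}.
Local Notation T := (subvs_of t).

Definition zeta (r : nat) : R[i] :=
  Complex (cos (2 * pi / r%:R)) (sin (2 * pi / r%:R)).

(* For i : 'I_s, Q i is the coefficient of w^-(i+1): indices are shifted by one
   throughout, A_(i+1) = Q i. *)
Definition irrtype (s : nat) := {ffun 'I_s -> T}.

Context (phi : GL T) (r : nat) {s : nat}.
Implicit Types (Q : irrtype s) (g w : GL T) (i : 'I_s).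

(* phi is the outer automorphism, viewed in GL(t). *)
Definition galois_generates g Q : Prop :=
  weyl t g /\ forall i, (phi * g)%g (Q i) = zeta r ^+ i.+1 *: Q i.

Definition pole_order (a : linform t) Q : nat :=
  \max_(i < s | a (Q i) != 0) i.+1.

Definition adm_equiv Q Q' : Prop :=
  (exists2 g, galois_generates g Q & galois_generates g Q') /\
  forall a : linform t, lie_roots fullv t a -> pole_order a Q = pole_order a Q'.

Definition adm_space Q : set (vtop (irrtype s)) := [set Q' | adm_equiv Q Q'].

Definition weyl_act w Q : irrtype s := [ffun i => w (Q i)].

Definition same_orbit Q Q' : bool :=
  `[< exists2 w, weyl t w & Q' = weyl_act w Q >].

Let W_sub : is_subgroup (weyl t). Proof. exact: gen_subgroup_sub. Qed.

Lemma same_orbit_refl : reflexive same_orbit.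
Proof.
move=> Q; apply/asboolP; exists 1%g; first exact: (subgroup1 W_sub).
by apply/ffunP => i; rewrite ffunE GL1E.
Qed.

Lemma same_orbit_sym : symmetric same_orbit.
Proof.
suff sym Q Q' : same_orbit Q Q' -> same_orbit Q' Q.
  by move=> Q Q'; apply/idP/idP; exact: sym.
move=> /asboolP[w Ww ->]; apply/asboolP; exists (w^-1)%g.
  exact: (subgroupV W_sub).
by apply/ffunP => i; rewrite !ffunE GLK.
Qed.

Lemma same_orbit_trans : transitive same_orbit.
Proof.
move=> Q' Q Q'' /asboolP[w Ww ->] /asboolP[w' Ww' ->]; apply/asboolP.
exists (w' * w)%g; first exact: (subgroupM W_sub).
by apply/ffunP => i; rewrite !ffunE GLME.
Qed.

Definition orbit_rel : equiv_rel (vtop (irrtype s)) :=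
  EquivRel same_orbit same_orbit_refl same_orbit_sym same_orbit_trans.

(* The topological quotient t^s / W. *)
Definition irrclass := quotient_topology {eq_quot orbit_rel}.

Definition irrclass_of Q : irrclass :=
  \pi_({eq_quot orbit_rel}) (Q : vtop (irrtype s)).

(* Both classes are then Galois-closed, by definition of adm_equiv. *)
Definition adm_class_space (Theta : irrclass) : set irrclass :=
  [set Theta' | exists Q Q',
    [/\ irrclass_of Q = Theta, irrclass_of Q' = Theta' & adm_equiv Q Q']].

Definition adm_class_map Q (q : adm_space Q) : adm_class_space (irrclass_of Q) :=
  exist _ (irrclass_of (val q)) (mem_set (ex_intro _ Q (ex_intro _ (val q)
    (And3 erefl erefl (set_mem (valP q)))))).

Lemma adm_class_map_continuous Q : continuous (@adm_class_map Q).
Proof.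
apply: continuous_comp_initial => q.
apply: (@continuous_comp (adm_space Q) (vtop (irrtype s)) irrclass
  set_val irrclass_of).
  exact: initial_continuous.
exact: pi_continuous.
Qed.

(* levi Q k is phi_(k+1); in particular levi Q s is the whole root system. *)
Definition levi Q (k : nat) : set (linform t) :=
  [set a | lie_roots fullv t a /\ forall i, (k <= i)%N -> a (Q i) = 0].

Definition eigen_root_kernel (Phi : set (linform t)) g (z : R[i]) :
    set (vtop T) :=
  [set v | root_kernel Phi v /\ g v = z *: v].

(* Here g is the twisted element phi * g' of GL(t). *)
Definition adm_space_at Q g i : set (vtop T) :=
  let E := eigen_root_kernel (levi Q i) g (zeta r ^+ i.+1) in
  E `\` \bigcup_(a in levi Q i.+1 `\` levi Q i) ([set v | a v = 0] `&` E).

Section Basepoints.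
Context {g : GL T} {Q} (gQ : galois_generates g Q).

Lemma adm_space_base_proof : adm_space Q Q.
Proof. by split => //; exists g. Qed.

Definition adm_space_base : adm_space Q :=
  exist _ (Q : vtop (irrtype s)) (mem_set adm_space_base_proof).

Definition adm_class_space_base : adm_class_space (irrclass_of Q) :=
  adm_class_map adm_space_base.

Lemma adm_space_at_base_proof i : adm_space_at Q (phi * g)%g i (Q i).
Proof.
split; first by split; [move=> a [_]; exact|have [_] := gQ; exact].
move=> [a [[Ra aQ] naQ] [aQi _]]; apply: naQ; split => // j.
by rewrite leq_eqVlt => /predU1P[/val_inj <- //|]; exact: aQ.
Qed.

Definition adm_space_at_base i : adm_space_at Q (phi * g)%g i :=
  exist _ (Q i : vtop T) (mem_set (adm_space_at_base_proof i)).
End Basepoints.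

Lemma multi_centralizer_sub Q g : is_subgroup
  [set w | forall i, pre_centralizer (levi Q i) g w].
Proof.
have sZ i := pre_centralizer_sub (levi Q i) g; split => [i|x y Zx Zy i|x Zx i].
- exact: (subgroup1 (sZ i)).
- by apply: (subgroupM (sZ i)).
- by apply: (subgroupV (sZ i)).
Qed.

Lemma multi_centralizer_norm (s_gt0 : (0 < s)%N) Q g x h :
  (forall i, pre_centralizer (levi Q i) g x) ->
  pointwise_stab (levi Q 0) h -> pointwise_stab (levi Q 0) (x * h * x^-1)%g.
Proof.
by move=> /(_ (Ordinal s_gt0))[Nx _]; exact: pointwise_stab_norm.
Qed.

Definition multi_centralizer (s_gt0 : (0 < s)%N) Q g : subquotient (GL T) :=
  Subquotient (multi_centralizer_sub Q g)
    (pointwise_stab_sub (levi Q 0))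
    (@multi_centralizer_norm s_gt0 Q g).

End Deformations.

Arguments irrtype {R L} t s.

(* Main.v *)
(* By Steinberg's theorem an element of W fixing the coefficients of an irregular
   type is a product of reflections in the roots vanishing on all of them. Hence
   the generator of the Galois orbit may be kept fixed in a deformation, and the
   space B of deformations of Q is the product of the B(Q, i), which is (1).
   The elements of W mapping some point of B into B then map B onto B, and form
   the subgroup N of those w preserving every t_phi_i and commuting there with
   phi g'; each of them fixing a point of B is trivial on t_phi_1. So the quotient
   of N by the pointwise stabiliser of t_phi_1 acts freely on B, and (2) is the
   exact sequence of the covering of the space of classes by B. That map is open
   because pole orders can only grow near a given point whereas their sum over
   the roots is W-invariant, and B is path connected because any two points can
   be joined inside a complex affine line, of which only finitely many points
   are removed. *)
Require Import Defs.
From HB Require Import structures.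
From mathcomp Require Import all_boot all_order all_algebra complex.
From mathcomp Require Import generic_quotient ring lra zify.
From mathcomp Require Import all_classical all_reals topology normedtype.
Set Implicit Arguments.
Unset Strict Implicit.
Unset Printing Implicit Defensive.
Import Order.TTheory GRing.Theory Num.Theory.
Import numFieldNormedType.Exports.
Local Open Scope classical_set_scope.
Local Open Scope ring_scope.

(** * Weights and roots *)

(** Nothing about root systems is given: reductivity is complete reducibility of the adjoint
    representation, and W is generated by reflections coming from sl2-triples. Existence and
    uniqueness of coroots and finiteness of W are therefore extracted from the bracket. Uniqueness
    matters because [phi] acts on [t] alone and not on [L]: it is what makes [phi] normalise W. For
    w in W and G = phi g', the commutator of w and G is then again in W, so Steinberg's theorem,
    which concerns W only, decides commutation with G on t_phi_1. A commutator of this kind also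
    controls openness: a translate u = w q satisfies the Galois condition exactly when the element
    fixes u, and u being near p forces it to fix p. Steinberg's theorem itself is proved with simple
    reflections and inversions, for a positivity defined on complex-valued forms. *)

Section EigenSep.
Context {K : fieldType} {V : lmodType K} {H : Type} (op : H -> {linear V -> V}).
Context (E : V -> Prop).
Hypothesis E_lin : forall (c : K) x y, E x -> E y -> E (c *: x + y).
Hypothesis E_op : forall h x, E x -> E (op h x).
Context {I : eqType} (w : I -> H -> K).

(** To isolate [v i], apply [op h - w j h] to the sum, with [h] separating [i] from the head [j]:
    the head disappears and [v i] gets a nonzero factor. As a predicate, [E] can be the zero
    subspace or an eigenspace of a commuting operator. *)
Lemma eigen_sep (s : seq I) (v : I -> V) : E 0 -> uniq s ->
  {in s &, injective w} -> (forall i h, i \in s -> op h (v i) = w i h *: v i) ->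
  E (\sum_(i <- s) v i) -> forall i, i \in s -> E (v i).
Proof.
move=> E0; have EZ c x : E x -> E (c *: x).
  by move=> Ex; rewrite -[_ *: _]addr0; exact: E_lin.
elim: s v => [//|j s IHs] v /= /andP[js us] winj wv Ev.
have tl i : i \in s -> E (v i).
  move=> si; have [h wh] : exists h, w i h != w j h.
    apply: contrapT => /forallNP nh; move: js.
    rewrite -(winj i j) ?si ?inE ?eqxx ?si ?orbT //.
    by apply/funext => h; apply/eqP/negPn/negP; exact: nh.
  have : E (\sum_(k <- s) (w k h - w j h) *: v k).
    have -> : \sum_(k <- s) (w k h - w j h) *: v k =
      (- w j h) *: (\sum_(k <- j :: s) v k) + op h (\sum_(k <- j :: s) v k).
      rewrite !big_cons (linearD (op h)) (wv j) ?mem_head // scalerDr scaleNr addrACA addNr add0r.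
      rewrite (linear_sum (op h)) scaler_sumr -big_split /= !big_seq; apply: eq_bigr => k sk.
      by rewrite wv ?inE ?sk ?orbT // scalerBl scaleNr addrC.
    by apply: E_lin => //; exact: E_op.
  move/IHs => /(_ us) /(_ _ _ i si) IH.
  rewrite -[v i]scale1r -(@mulVf _ (w i h - w j h)) ?subr_eq0 //.
  rewrite -scalerA; apply: EZ; apply: IH.
    by move=> a b sa sb; apply: winj; rewrite inE ?sa ?sb orbT.
  move=> k h' sk; rewrite linearZ /= wv ?inE ?sk ?orbT //.
  by rewrite !scalerA mulrC.
move=> i; rewrite inE => /predU1P[->|]; last exact: tl.
have -> : v j = (-1) *: (\sum_(k <- s) v k) + \sum_(k <- j :: s) v k.
  by rewrite big_cons scaleN1r addrCA addNr addr0.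
apply: E_lin => //; rewrite big_seq; elim/big_rec: _ => // k x sk Ex.
by rewrite -[v k]scale1r; apply: E_lin => //; exact: tl.
Qed.

End EigenSep.

(** A subspace of maximal dimension inside [P] is all of [P], since any further vector of [P] could
    be adjoined. *)
Lemma vspace_of_pred (K : fieldType) (V : vectType K) (P : V -> Prop) :
  P 0 -> (forall (c : K) x y, P x -> P y -> P (c *: x + y)) ->
  exists U : {vspace V}, forall x, x \in U <-> P x.
Proof.
move=> P0 Plin.
pose Q n := `[< exists U : {vspace V}, \dim U = n /\ forall x, x \in U -> P x >].
have Q0 : exists n, Q n.
  exists 0; apply/asboolP; exists 0%VS; split; first by rewrite dimv0.
  by move=> x; rewrite memv0 => /eqP ->.
have Qb n : Q n -> (n <= \dim {:V})%N.
  by move=> /asboolP[U [<- _]]; rewrite dimvS ?subvf.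
case: (ex_maxnP Q0 Qb) => n /asboolP[U [dU UP]] nmax.
exists U => x; split; first exact: UP.
move=> Px; apply: contraT => xU.
have : Q (\dim (U + <[x]>)%VS).
  apply/asboolP; exists (U + <[x]>)%VS; split => // y /memv_addP[u uU [z]].
  by move=> /vlineP[c ->] ->; rewrite addrC; apply: Plin => //; exact: UP.
move/nmax; rewrite -dU => le; suff : (<[x]> <= U)%VS by rewrite -memvE (negPf xU).
have e : (U == U + <[x]>)%VS by rewrite eqEdim addvSl le.
by rewrite (eqP e) addvSr.
Qed.

Section LieBasics.
Context {K : fieldType} {L : lieAlgebraType K}.
Implicit Types x y z : L.

Lemma bracketDl x y z : bracket (x + y) z = bracket x z + bracket y z.
Proof. by have := bracketPl x y z 1; rewrite !scale1r. Qed.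

Lemma bracketZl c x z : bracket (c *: x) z = c *: bracket x z.
Proof.
have b0 : bracket 0 z = 0.
  by apply: (addrI (bracket 0 z)); rewrite -bracketDl !addr0.
by have := bracketPl x 0 z c; rewrite b0 !addr0.
Qed.

Lemma bracket0l z : bracket 0 z = 0.
Proof. by rewrite -[X in bracket X](scale0r (0 : L)) bracketZl scale0r. Qed.

Lemma bracket_suml (I : Type) (s : seq I) (F : I -> L) z :
  bracket (\sum_(i <- s) F i) z = \sum_(i <- s) bracket (F i) z.
Proof.
by elim/big_rec2: _ => [|i y x _ <-]; [exact: bracket0l|rewrite bracketDl].
Qed.

Lemma bracket_der x y z :
  bracket x (bracket y z) = bracket (bracket x y) z + bracket y (bracket x z).
Proof.
have := jacobi x y z; rewrite (bracketC z x) (bracketC z (bracket x y)).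
rewrite linearN /= => /eqP; rewrite -addrA -opprD addr_eq0 opprK => /eqP ->.
by rewrite addrC.
Qed.

Lemma center_bracket z x : z \in lie_center L -> bracket z x = 0.
Proof. by move/lie_centerP; apply. Qed.

Lemma lie_derived_ideal : @lie_ideal K L lie_derived.
Proof. by move=> x y _; exact: mem_lie_derived. Qed.

Lemma lie_center_ideal : lie_ideal (lie_center L).
Proof. by move=> x y /center_bracket ->; rewrite mem0v. Qed.

Lemma ideal_disjoint (I J : {vspace L}) x y : lie_ideal I -> lie_ideal J ->
  (I :&: J = 0)%VS -> x \in I -> y \in J -> bracket x y = 0.
Proof.
move=> iI iJ IJ xI yJ; apply/eqP; rewrite -memv0 -IJ memv_cap iI //.
by rewrite bracketC memvN iJ.
Qed.

Hypothesis L_red : reductive_lie L.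

(** An ideal complementary to the centre absorbs every bracket, the central part of a factor
    contributing zero; it therefore contains the derived algebra. *)
Lemma center_derived z : z \in lie_center L -> z \in @lie_derived K L -> z = 0.
Proof.
move=> zZ zD; have [J iJ [ZJ dZJ]] := L_red lie_center_ideal.
suff DJ : (@lie_derived K L <= J)%VS.
  by apply/eqP; rewrite -memv0 -dZJ memv_cap zZ (subvP DJ).
apply/span_subvP => _ /allpairsP[[x y] [_ _ ->]] /=.
have : x \in (lie_center L + J)%VS by rewrite ZJ memvf.
by move=> /memv_addP[u uZ [v vJ ->]]; rewrite bracketDl center_bracket // add0r iJ.
Qed.

(** An ideal complementary to the derived algebra is central: its brackets lie in both ideals. *)
Lemma center_derived_decomp x : exists z y,
  [/\ z \in lie_center L, y \in @lie_derived K L & x = z + y].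
Proof.
have [J iJ [DJ dDJ]] := L_red lie_derived_ideal.
have : x \in (@lie_derived K L + J)%VS by rewrite DJ memvf.
move=> /memv_addP[y yD [z zJ ->]]; exists z, y; split => //; last exact: addrC.
apply/lie_centerP => u; apply/eqP.
by rewrite -memv0 -dDJ memv_cap mem_lie_derived iJ.
Qed.

End LieBasics.

Lemma big_pred1_uniq (V : nmodType) (I : eqType) (s : seq I) (i : I) (F : I -> V) :
  uniq s -> i \in s -> \sum_(j <- s | i == j) F j = F i.
Proof.
move=> us si; rewrite big_mkcond (bigD1_seq i) //= eqxx big1 ?addr0 // => j.
by rewrite eq_sym => /negPf ->.
Qed.

Section Weights.
Context {K : numFieldType} {L : lieAlgebraType K} {t : {vspace L}}.
Local Notation T := (subvs_of t).
Implicit Types (a b : linform t) (x y z v : L) (h : T).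

Definition weight a x := forall h : T, bracket (vsval h) x = (a h : K) *: x.

Lemma root_spaceP a x : root_space fullv a x <-> weight a x.
Proof. by split=> [[]//|wx]; split => //; exact: memvf. Qed.

Lemma weight_lin a (c : K) x y : weight a x -> weight a y -> weight a (c *: x + y).
Proof.
by move=> wx wy h; rewrite linearD linearZ /= wx wy scalerDr !scalerA mulrC.
Qed.

Lemma weight0 a : weight a 0.
Proof. by move=> h; rewrite linear0 scaler0. Qed.

Lemma weightZ a (c : K) x : weight a x -> weight a (c *: x).
Proof. by move=> wx; rewrite -[_ *: _]addr0; apply: weight_lin => //; exact: weight0. Qed.

Lemma weightD a x y : weight a x -> weight a y -> weight a (x + y).
Proof. by move=> wx wy; rewrite -[x]scale1r; exact: weight_lin. Qed.

Lemma weight_sum a (I : Type) (s : seq I) (P : pred I) (F : I -> L) :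
  (forall i, P i -> weight a (F i)) -> weight a (\sum_(i <- s | P i) F i).
Proof.
move=> wF; elim/big_rec: _ => [|i x Pi]; first exact: weight0.
by apply: weightD; exact: wF.
Qed.

Lemma weight_bracket a b x y : weight a x -> weight b y ->
  weight (a + b) (bracket x y).
Proof.
move=> wx wy h; rewrite bracket_der wx wy linearZ /= bracketZl -scalerDl.
by rewrite add_lfunE.
Qed.

Lemma lie_rootsP a : lie_roots fullv t a <-> a != 0 /\ exists2 x, weight a x & x != 0.
Proof.
by split=> -[a0 [x wx x0]]; split => //; exists x => //; exact/root_spaceP.
Qed.

Hypothesis tc : cartan_subalgebra t.

Definition simultaneous (s : seq T) x :=
  forall h, h \in s -> exists c : K, bracket (vsval h) x = c *: x.

(** Simultaneous diagonalisation, one operator at a time. The components of [x] for a new [h] are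
    still eigenvectors for the earlier ones because [t] is abelian: [eigen_sep] applies with [E] an
    eigenspace of an earlier [h']. *)
Lemma sim_decomp (s : seq T) v :
  exists l : seq L, (forall x, x \in l -> simultaneous s x) /\ v = \sum_(x <- l) x.
Proof.
elim: s v => [|h s IHs] v.
  by exists [:: v]; split => [x _ h|]; rewrite ?big_seq1.
have [l [sl ->]] := IHs v; elim: l sl => [|x l IHl] sl.
  by exists [::]; rewrite big_nil.
have [y ly|l' [sl' lE]] := IHl; first by apply: sl; rewrite inE ly orbT.
suff [l1 [sl1 xE]] : exists l1 : seq L,
    (forall y, y \in l1 -> simultaneous (h :: s) y) /\ x = \sum_(y <- l1) y.
  exists (l1 ++ l'); split; last by rewrite big_cat big_cons lE {1}xE.
  by move=> y; rewrite mem_cat => /orP[]; [exact: sl1|exact: sl'].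
have {sl}sx : simultaneous s x by apply: sl; exact: mem_head.
have [b bb bev] := cartan_semisimple tc (subvsP h).
pose X := in_tuple b; have bX : basis_of fullv X by [].
pose ev y : K := if pselect (exists c : K, bracket (vsval h) y = c *: y) is left e
  then sval (cid e) else 0.
have evP y : y \in b -> bracket (vsval h) y = ev y *: y.
  by move=> /bev e; rewrite /ev; case: pselect => // e'; case: (cid e').
pose cs := undup [seq ev y | y <- b].
pose comp c := \sum_(i < size b | ev X`_i == c) coord X i x *: X`_i.
have xE : x = \sum_(c <- cs) comp c.
  rewrite /comp (exchange_big_dep xpredT) //= {1}(coord_basis bX (memvf x)).
  apply: eq_bigr => i _; rewrite big_pred1_uniq ?undup_uniq //.
  by rewrite mem_undup; apply: map_f; exact: mem_nth.
have cev c : bracket (vsval h) (comp c) = c *: comp c.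
  rewrite linear_sum scaler_sumr; apply: eq_bigr => i /eqP <-.
  by rewrite linearZ /= evP ?mem_nth // !scalerA mulrC.
have scomp c : c \in cs -> simultaneous s (comp c).
  move=> ccs h' h's; have [d xd] := sx h' h's; exists d.
  pose E y := bracket (vsval h') y = d *: y.
  apply: (@eigen_sep K L unit (fun _ => bracket (vsval h)) E _ _ K (fun c _ => c)
    cs comp) ccs => //; rewrite /E.
  - by move=> e y z Ey Ez; rewrite linearD linearZ /= Ey Ez scalerDr !scalerA mulrC.
  - move=> _ y Ey; rewrite /= bracket_der Ey linearZ /=.
    have -> : bracket (vsval h') (vsval h) = 0.
      by apply: (cartan_abelian tc); exact: subvsP.
    by rewrite bracket0l add0r.
  - by rewrite linear0 scaler0.
  - by rewrite undup_uniq.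
  - by move=> e1 e2 _ _ /(congr1 (fun f => f tt)).
  - by move=> i _ _; exact: cev.
  - by rewrite -xE.
exists [seq comp c | c <- cs]; split; last by rewrite big_map.
move=> _ /mapP[c ccs ->] h'; rewrite inE => /predU1P[->|]; last exact: scomp.
by exists c.
Qed.

(** Eigenvalues are chosen on a basis of [t] and extended linearly, so that linearity is built in
    and [x = 0], where the choices are arbitrary, needs no separate treatment. *)
Lemma sim_weight x : simultaneous (in_tuple (vbasis {:T})) x -> exists a, weight a x.
Proof.
move=> sx; pose B := vbasis {:T}.
have ex i : exists c : K, bracket (vsval B`_i) x = c *: x.
  have [ib|ib] := ltnP i (size B); first by apply: sx; exact: mem_nth.
  by exists 0; rewrite nth_default // linear0 bracket0l scale0r.
pose f h : K^o := \sum_(i < \dim {:T}) coord B i h * sval (cid (ex i)).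
have f_lin : linear f.
  move=> c h h'; rewrite /f scaler_sumr -big_split /=; apply: eq_bigr => i _.
  by rewrite linearP /= mulrDl -mulrA.
pose fL := GRing.isLinear.Build _ _ _ _ f f_lin.
pose F : {linear T -> K^o} := HB.pack f fL.
exists (linfun F) => h; rewrite lfunE /= /f.
rewrite {1}(coord_vbasis (memvf h)) linear_sum bracket_suml scaler_suml.
apply: eq_bigr => i _; rewrite linearZ bracketZl /=.
by case: cid => c /= ->; rewrite scalerA.
Qed.

Lemma weight_decomp v : exists (s : seq (linform t)) (c : linform t -> L),
  [/\ uniq s, forall a, weight a (c a) & v = \sum_(a <- s) c a].
Proof.
have [l [sl ->]] := sim_decomp (in_tuple (vbasis {:T})) v.
have ex x : exists a, x \in l -> weight a x.
  have [xl|] := boolP (x \in l); last by exists 0.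
  by have [a wa] := sim_weight (sl _ xl); exists a.
pose w x := sval (cid (ex x)).
have wP x : x \in l -> weight (w x) x by rewrite /w; case: cid.
exists (undup (map w l)), (fun a => \sum_(x <- l | w x == a) x); split.
- exact: undup_uniq.
- move=> a; rewrite big_seq_cond; apply: weight_sum => x /andP[xl /eqP <-].
  exact: wP.
- rewrite (exchange_big_dep xpredT) //= big_seq [RHS]big_seq; apply: eq_bigr => x xl.
  by rewrite big_pred1_uniq ?undup_uniq // mem_undup map_f.
Qed.

Lemma weight_list : exists2 ws : seq (linform t), uniq ws &
  forall v, exists2 c : linform t -> L, (forall a, weight a (c a)) &
    v = \sum_(a <- ws) c a.
Proof.
pose B := vbasis {:L}.
pose sc i := cid (weight_decomp B`_i); pose s i := sval (sc i).
pose c i := sval (cid (svalP (sc i))).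
have sP i : [/\ uniq (s i), forall a, weight a (c i a) & B`_i = \sum_(a <- s i) c i a].
  by rewrite /c; case: cid.
pose ws := undup (flatten [seq s i | i <- iota 0 (\dim {:L})]).
exists ws; first exact: undup_uniq.
move=> v; exists (fun a => \sum_(i < \dim {:L} | a \in s i) coord B i v *: c i a).
  move=> a; apply: weight_sum => i _; apply: weightZ; by have [] := sP i.
rewrite (exchange_big_dep xpredT) //= {1}(coord_vbasis (memvf v)).
apply: eq_bigr => i _; have [us _ {1}->] := sP i; rewrite -scaler_sumr; congr (_ *: _).
rewrite -[RHS]big_filter; apply: perm_big; apply: uniq_perm => //.
  by rewrite filter_uniq ?undup_uniq.
move=> a; rewrite mem_filter; case: (boolP (a \in s i)) => //= as_.
rewrite mem_undup; apply/esym/flattenP; exists (s i) => //.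
by apply: map_f; rewrite mem_iota /= add0n.
Qed.

Lemma weight_sep (E : L -> Prop) (s : seq (linform t)) (c : linform t -> L) :
  E 0 -> (forall (k : K) x y, E x -> E y -> E (k *: x + y)) ->
  (forall h x, E x -> E (bracket (vsval h) x)) ->
  uniq s -> (forall a, weight a (c a)) -> E (\sum_(a <- s) c a) ->
  forall a, a \in s -> E (c a).
Proof.
move=> E0 Elin Est us wc.
apply: (@eigen_sep K L T (fun h => bracket (vsval h)) E Elin Est _
  (fun a h => a h : K)) => //.
- by move=> a b _ _ ab; apply/lfunP => h; exact: (congr1 (fun f => f h) ab).
- by move=> a h _; exact: wc.
Qed.

Lemma weight_indep (s : seq (linform t)) (c : linform t -> L) :
  uniq s -> (forall a, weight a (c a)) -> \sum_(a <- s) c a = 0 ->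
  forall a, a \in s -> c a = 0.
Proof.
move=> us wc c0; apply: (@weight_sep (fun x => x = 0)) => // [k x y -> ->|h x ->].
  by rewrite scaler0 addr0.
exact: linear0.
Qed.

Definition is_weight a := exists2 x, weight a x & x != 0.

Lemma weight_finite : exists ws : seq (linform t), forall a, is_weight a -> a \in ws.
Proof.
have [ws us dec] := weight_list; exists ws => a [x wx x0].
apply: contraT => aws; have [c wc xE] := dec x; move: x0.
rewrite -oppr_eq0; pose c' b := if b == a then - x else c b.
have -> : - x = c' a by rewrite /c' eqxx.
suff -> : c' a = 0 by rewrite eqxx.
apply: (@weight_indep (a :: ws) c'); rewrite ?mem_head //=.
- by rewrite aws.
- move=> b; rewrite /c'; case: eqVneq => // ->.
  by rewrite -scaleN1r; exact: weightZ.
- rewrite big_cons /c' eqxx {1}xE big_seq [X in _ + X]big_seq -sumrN -big_split.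
  rewrite big1 // => b bws; case: eqVneq => [ba|_]; last exact: addNr.
  by rewrite -ba bws in aws.
Qed.

(** The form in which finiteness is used: it stops root strings and, later, the orbit of a
    transvection. *)
Lemma weight_no_line (F : nat -> linform t) :
  injective F -> (forall n, is_weight (F n)) -> False.
Proof.
have [ws wsP] := weight_finite; move=> Finj Fw.
have /uniq_leq_size : uniq [seq F n | n <- iota 0 (size ws).+1].
  by rewrite map_inj_uniq // iota_uniq.
move=> /(_ ws); rewrite size_map size_iota ltnn; suff sub : {subset [seq F n | n <- iota 0 (size ws).+1] <= ws}.
  by move=> /(_ sub).
by move=> _ /mapP[n _ ->]; exact/wsP/Fw.
Qed.

Lemma weight_iter a b e x n : weight b e -> weight a x ->
  weight (a + b *+ n) (iter n (bracket e) x).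
Proof.
move=> we wx; elim: n => [|n IHn]; first by rewrite mulr0n addr0.
by rewrite mulrSr addrA addrC /=; exact: weight_bracket.
Qed.

Lemma muln_lfunE' a n h : (a *+ n) h = (a h : K) *+ n.
Proof. by elim: n => [|n IHn]; rewrite ?lfunE // !mulrSr add_lfunE IHn. Qed.

Lemma linform_neq0 a : a != 0 -> exists h, (a h : K) != 0.
Proof. by move=> /lfunPn[h]; rewrite zero_lfunE; exists h. Qed.

Lemma iter_nilpotent a b e x : weight b e -> b != 0 -> weight a x ->
  exists n, iter n (bracket e) x = 0.
Proof.
move=> we b0 wx; apply: contrapT => /forallNP ni.
have /linform_neq0[h bh] := b0.
apply: (@weight_no_line (fun n => a + b *+ n)).
  move=> m n /addrI /(congr1 (fun f : linform t => f h)).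
  rewrite !muln_lfunE' => /eqP; rewrite -subr_eq0 -mulr_natl -[X in _ - X]mulr_natl.
  by rewrite -mulrBl mulf_eq0 (negPf bh) orbF subr_eq0 eqr_nat => /eqP.
move=> n; exists (iter n (bracket e) x); first exact: weight_iter.
by apply/eqP; exact: ni.
Qed.

Lemma iter_top a b e x : weight b e -> b != 0 -> weight a x -> x != 0 ->
  exists n, iter n (bracket e) x != 0 /\ iter n.+1 (bracket e) x = 0.
Proof.
move=> we b0 wx x0; have [n0 nil] := iter_nilpotent we b0 wx.
have ex : exists n, iter n (bracket e) x == 0 by exists n0; exact/eqP.
case: (ex_minnP ex) => -[|n] /eqP /= ni nmin; first by rewrite ni eqxx in x0.
exists n; split => //=; apply/negP => /nmin; by rewrite ltnn.
Qed.

(** Climb by [e] to the top of the string, in [p] steps, then descend by [f], in [n] steps. The sl2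
    relation is kept without normalising [b h] to 2, since the case [b h = 0] must be covered in
    order to be excluded in [bracket_coroot]. *)
Lemma string_exists a b e f h x :
  weight b e -> weight (- b) f -> vsval h = bracket e f -> b != 0 ->
  weight a x -> x != 0 -> exists p n : nat,
    2 * (a h + p%:R * b h : K) = n%:R * b h /\
    forall j, (j <= n)%N -> is_weight (a + b *+ p - b *+ j).
Proof.
move=> we wf hE b0 wx x0; have [p [y0 ey]] := iter_top we b0 wx x0.
set y := iter p (bracket e) x in y0 ey; have {}ey : bracket e y = 0 by [].
have wy : weight (a + b *+ p) y by exact: weight_iter.
have nb0 : - b != 0 by rewrite oppr_eq0.
have [n [z0 fz]] := iter_top wf nb0 wy y0.
pose z j := iter j (bracket f) y; rewrite -/(z n) in z0; rewrite -/(z n.+1) in fz.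
have wz j : weight (a + b *+ p - b *+ j) (z j).
  by rewrite -mulNrn; exact: weight_iter.
pose m : K := a h + p%:R * b h.
have mj j : (a + b *+ p - b *+ j) h = m - j%:R * b h :> K.
  by rewrite !add_lfunE opp_lfunE !muln_lfunE' /m !mulr_natl.
exists p, n; split; last first.
  move=> j jn; exists (z j) => //; apply: contraNneq z0 => zj.
  rewrite -(subnK jn) /z iterD -/(z j) zj.
  by elim: (n - j)%N => //= k /eqP ->; rewrite linear0.
(* Doubling keeps halves out of the induction; for [j = n] the left side vanishes and leaves
   [2 m = n b(h)]. *)
have key j : 2 *: bracket e (z j.+1) = (j.+1%:R * (2 * m - j%:R * b h)) *: z j.
  elim: j => [|j IHj].
    rewrite /z /= bracket_der -hE (wy h) ey linear0 addr0 scalerA; congr (_ *: _).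
    have := mj 0%N; rewrite mulr0n subr0 => ->; ring.
  rewrite [z j.+2]/(bracket f (z j.+1)) bracket_der -hE (wz j.+1 h) mj scalerDr.
  have -> : 2 *: bracket f (bracket e (z j.+1)) = bracket f (2 *: bracket e (z j.+1)).
    by rewrite linearZ.
  have -> : bracket f (2 *: bracket e (z j.+1)) =
      (j.+1%:R * (2 * m - j%:R * b h)) *: z j.+1 by rewrite IHj linearZ.
  rewrite scalerA -scalerDl; congr (_ *: _).
  rewrite -!natr1; ring.
have := key n; rewrite fz linear0 scaler0 => /esym/eqP.
rewrite scaler_eq0 (negPf z0) orbF mulf_eq0 pnatr_eq0 /= subr_eq0 => /eqP //.
Qed.

Let half_solve (u p n c : K) : 2 * (u + p * c) = n * c -> u = (n / 2 - p) * c.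
Proof.
move=> E; have -> : u = (2 * (u + p * c)) / 2 - p * c by field.
by rewrite E; field.
Qed.

Lemma weight_rational a b e f h : weight b e -> weight (- b) f ->
  vsval h = bracket e f -> b != 0 -> is_weight a ->
  exists2 q : K, q \is Num.real & a h = q * b h :> K.
Proof.
move=> we wf hE b0 [x wx x0].
have [p [n [E _]]] := string_exists we wf hE b0 wx x0.
exists (n%:R / 2 - p%:R).
  by rewrite rpredB ?rpred_div ?realn.
exact: half_solve E.
Qed.

(** The string is run for both triples [(e, h, f)] and [(f, -h, e)]; the sign of [a(h)] decides
    which of the two covers the segment from [a] to its reflection [a - a(h) b]. *)
Lemma weight_string a b e f h : weight b e -> weight (- b) f ->
  vsval h = bracket e f -> b h = 2%:R :> K -> is_weight a -> exists n : nat,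
  (a h = n%:R :> K /\ forall k, (k <= n)%N -> is_weight (a - b *+ k)) \/
  (a h = - n%:R :> K /\ forall k, (k <= n)%N -> is_weight (a + b *+ k)).
Proof.
move=> we wf hE bh [x wx x0].
have b0 : b != 0.
  by apply: contraTneq isT => b0; have := bh; rewrite b0 zero_lfunE => /eqP; rewrite eq_sym pnatr_eq0.
have [p [n [E W]]] := string_exists we wf hE b0 wx x0.
have wee : weight (- - b) e by rewrite opprK.
have hE' : vsval (- h) = bracket f e by rewrite linearN /= hE -bracketC.
have nb0 : - b != 0 by rewrite oppr_eq0.
have [p' [n' [E' W']]] := string_exists wf wee hE' nb0 wx x0.
have ah : a h = n%:R - (p * 2)%:R :> K.
  by rewrite (half_solve E) bh natrM; field.
have ah' : - a h = n'%:R - (p' * 2)%:R :> K.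
  move: E'; rewrite !linearN /= opp_lfunE opprK bh => E'.
  by rewrite (half_solve E') natrM; field.
have [pn|np] := leqP (p * 2) n.
  exists (n - p * 2)%N; left; split; first by rewrite natrB.
  move=> k kn; have := W (p + k)%N; rewrite mulrnDr opprD addrA addrK; apply.
  lia.
have e1 : (n + n' = p * 2 + p' * 2)%N.
  apply/eqP; rewrite -(eqr_nat K) !natrD; apply/eqP.
  have := congr1 (fun u => u + - a h) ah; rewrite {2}ah' subrr => /eqP.
  by rewrite eq_sym addrACA -opprD subr_eq0 => /eqP.
exists (p * 2 - n)%N; right; split; first by rewrite natrB ?(ltnW np) // opprB ah.
move=> k kn; have := W' (p' + k)%N; rewrite mulrnDr opprD addrA addrK.
rewrite mulNrn opprK; apply; lia.
Qed.

End Weights.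

(** * Traces and the Killing form *)

Section Trace.
Context {K : fieldType} {V : vectType K}.

Definition tr_on n (X : n.-tuple V) (u : V -> V) : K := \sum_(i < n) coord X i (u X`_i).

(** With two bases allowed, the identity also carries independence of the basis, which
    [killing_eigen] uses to pass to an eigenbasis. *)
Lemma tr_on_mulC n n' (X : n.-tuple V) (Y : n'.-tuple V) (u v : {linear V -> V}) :
  basis_of fullv X -> basis_of fullv Y -> tr_on X (u \o v) = tr_on Y (v \o u).
Proof.
move=> bX bY.
transitivity (\sum_(i < n) \sum_(j < n') coord Y j (v X`_i) * coord X i (u Y`_j)).
  apply: eq_bigr => i _ /=.
  rewrite {1}(coord_basis bY (memvf (v X`_i))) linear_sum linear_sum.
  by apply: eq_bigr => j _; rewrite !linearZ.
rewrite exchange_big /=; apply: eq_bigr => j _ /=.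
rewrite {2}(coord_basis bX (memvf (u Y`_j))) linear_sum linear_sum.
by apply: eq_bigr => i _; rewrite !linearZ /= mulrC.
Qed.

End Trace.

Section Killing.
Context {K : fieldType} {L : lieAlgebraType K}.
Implicit Types x y z : L.

Definition killing x y : K := tr_on (vbasis {:L}) (bracket x \o bracket y).

Lemma killingC x y : killing x y = killing y x.
Proof. by apply: tr_on_mulC; exact: vbasisP. Qed.

Lemma killing_linr x (c : K) y z : killing x (c *: y + z) = c * killing x y + killing x z.
Proof.
rewrite /killing /tr_on mulr_sumr -big_split; apply: eq_bigr => i _ /=.
by rewrite bracketPl !linearD !linearZ.
Qed.

Lemma killing_sumr x (I : Type) (s : seq I) (F : I -> L) :
  killing x (\sum_(i <- s) F i) = \sum_(i <- s) killing x (F i).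
Proof.
elim: s => [|i s IHs]; rewrite ?big_nil ?big_cons.
  by rewrite /killing /tr_on big1 // => i _ /=; rewrite bracket0l !linear0.
by rewrite -[F i]scale1r killing_linr mul1r scale1r IHs.
Qed.

Lemma killingZr x (c : K) y : killing x (c *: y) = c * killing x y.
Proof.
have k0 : killing x 0 = 0.
  by have := killing_sumr x [::] (fun i : nat => 0); rewrite !big_nil.
by rewrite -[c *: y]addr0 killing_linr k0 addr0.
Qed.

Lemma killing_inv x y z : killing (bracket x y) z = killing x (bracket y z).
Proof.
have E n (X : n.-tuple L) (u v w : L -> L) :
    (forall i, u i = v i - w i) -> tr_on X u = tr_on X v - tr_on X w.
  move=> uE; rewrite /tr_on -sumrB; apply: eq_bigr => i _.
  by rewrite uE linearB.
rewrite /killing (E _ _ _ (bracket x \o (bracket y \o bracket z))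
   (bracket y \o (bracket x \o bracket z))); last first.
  by move=> u /=; rewrite [X in X - _]bracket_der addrK.
rewrite (E _ _ (bracket x \o bracket (bracket y z)) (bracket x \o (bracket y \o bracket z))
   ((bracket x \o bracket z) \o bracket y)); last first.
  move=> u /=; rewrite [bracket y (bracket z u)]bracket_der.
  by rewrite linearD /= addrK.
congr (_ - _).
exact: (@tr_on_mulC _ _ _ _ _ _ (bracket y) (bracket x \o bracket z) (vbasisP _) (vbasisP _)).
Qed.

Lemma killing_eigen x (b : seq L) (ev : L -> K) : basis_of fullv b ->
  {in b, forall y, bracket x y = ev y *: y} ->
  killing x x = \sum_(y <- b) ev y ^+ 2.
Proof.
move=> bb bev; rewrite /killing -[LHS]/(tr_on _ (bracket x \o bracket x)).
pose X := in_tuple b; have bX : basis_of fullv X by [].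
rewrite (tr_on_mulC (bracket x) (bracket x) (vbasisP _) bX) /tr_on.
rewrite [RHS](big_nth 0) big_mkord; apply: eq_bigr => i _ /=.
rewrite !(bev _ (mem_nth _ _)) // linearZ /= (bev _ (mem_nth _ _)) // !linearZ /=.
rewrite coord_free ?(basis_free bX) // eqxx mulr1 -expr2.
by [].
Qed.

End Killing.

Lemma finite_faithful (A : eqType) (G : Type) (W : set G) (ws : seq A)
    (P : A -> Prop) (act : A -> G -> A) :
  (forall a, P a -> a \in ws) -> (forall w a, W w -> P a -> P (act a w)) ->
  (forall x y, W x -> W y -> (forall a, P a -> act a x = act a y) -> x = y) ->
  finite_set W.
Proof.
move=> Pws Pact Winj; pose n := size ws.
(* [index] returns [n] for an image outside [ws], whence the codomain ['I_n.+1]; elements of [ws]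
   need not satisfy [P]. *)
pose F (w : G) : {ffun 'I_n -> 'I_n.+1} :=
  [ffun i : 'I_n => inord (index (act (tnth (in_tuple ws) i) w) ws)].
have Finj : {in W &, injective F}.
  move=> x y /set_mem Wx /set_mem Wy Fxy; apply: Winj => // a Pa.
  have ia : (index a ws < n)%N by rewrite index_mem; exact: Pws.
  have := congr1 (fun f : {ffun 'I_n -> 'I_n.+1} => val (f (Ordinal ia))) Fxy.
  rewrite !ffunE (tnth_nth a) /= nth_index ?Pws // !inordK ?ltnS ?index_size // => e.
  by rewrite -(nth_index a (Pws _ (Pact _ _ Wx Pa))) e nth_index // Pws //; exact: Pact.
rewrite -(eq_finite_set (inj_card_eq Finj)); exact: finite_finset.
Qed.

(* Locked: unification would otherwise unfold compositions of linear forms. *)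
HB.lock Definition pull {K : fieldType} {L : lieAlgebraType K} {t : {vspace L}}
  (b : linform t) (w : GL (subvs_of t)) : linform t := (b \o w)%VF.

Section Pull.
Context {K : fieldType} {L : lieAlgebraType K} {t : {vspace L}}.
Implicit Types (b : linform t) (w : GL (subvs_of t)).

Lemma pullE b w v : pull b w v = b (w v).
Proof. by rewrite pull.unlock comp_lfunE. Qed.

Lemma pull1 b : pull b 1%g = b.
Proof. by rewrite pull.unlock comp_lfun1r. Qed.

Lemma pullM b w w' : pull b (w * w')%g = pull (pull b w) w'.
Proof. by rewrite pull.unlock /= comp_lfunA. Qed.

Lemma pull_eq0 b w : (pull b w == 0) = (b == 0).
Proof.
apply/eqP/eqP => [b0|->]; last by apply/lfunP => v; rewrite pullE !zero_lfunE.
by rewrite -[b]pull1 -(mulgV w) pullM b0; apply/lfunP => v; rewrite pullE !zero_lfunE.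
Qed.

Lemma pullN b w : pull (- b) w = - pull b w.
Proof. by apply/lfunP => v; rewrite !(opp_lfunE, pullE). Qed.

End Pull.

(** * Coroots and the Weyl group *)

Section Coroots.
Context {K : numFieldType} {L : lieAlgebraType K} {t : {vspace L}}.
Local Notation T := (subvs_of t).
Implicit Types (a b : linform t) (x y z v : L) (h : T).
Hypothesis tc : cartan_subalgebra t.
Hypothesis L_red : reductive_lie L.

Lemma weight0_mem x : weight (0 : linform t) x -> x \in t.
Proof.
move=> wx; apply: (cartan_maximal tc) => y yt.
by rewrite bracketC (wx (Subvs yt)) zero_lfunE scale0r oppr0.
Qed.

Lemma mem_weight0 x : x \in t -> weight (0 : linform t) x.
Proof.
move=> xt h; rewrite zero_lfunE scale0r; apply: (cartan_abelian tc) => //; exact: subvsP.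
Qed.

Lemma roots0_center h : (forall a, lie_roots fullv t a -> a h = 0) ->
  vsval h \in lie_center L.
Proof.
move=> rh; apply/lie_centerP => x; have [s [c [_ wc ->]]] := weight_decomp tc x.
rewrite linear_sum big1 // => a _; rewrite /= wc.
have [->|a0] := eqVneq a 0; first by rewrite zero_lfunE scale0r.
have [->|c0] := eqVneq (c a) 0; first by rewrite scaler0.
by rewrite rh ?scale0r //; apply/lie_rootsP; split => //; exists (c a).
Qed.

(** A vector killed by all roots is central, and the centre meets the derived algebra in zero. This
    is the test of equality for coroots and for Weyl group elements. *)
Lemma roots0_derived h : (forall a, lie_roots fullv t a -> a h = 0) ->
  vsval h \in @lie_derived K L -> h = 0.
Proof.
by move=> /roots0_center hZ hD; apply/val_inj; exact: (center_derived L_red).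
Qed.

Lemma eigenvalue_weight h z (k : K) : z != 0 -> bracket (vsval h) z = k *: z ->
  exists2 a : linform t, is_weight a & a h = k :> K.
Proof.
move=> z0 hz; have [s [c [us wc zE]]] := weight_decomp tc z.
apply: contrapT => na; case/eqP: z0; rewrite zE big1_seq // => a /andP[_ sa].
have : forall a, a \in s -> (a h - k) *: c a = 0.
  apply: (weight_indep us) => [b|]; first exact: weightZ.
  apply/eqP; have := hz; rewrite {1}zE linear_sum => /eqP.
  rewrite -subr_eq0 {1}zE scaler_sumr -sumrB => /eqP {2}<-; apply/eqP.
  by apply: eq_bigr => b _; rewrite /= wc scalerBl.
move=> /(_ a sa) /eqP; rewrite scaler_eq0 => /orP[|/eqP //].
rewrite subr_eq0 => /eqP ahk; apply: contrapT => /eqP ca0; apply: na.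
by exists a => //; exists (c a).
Qed.

Lemma bracket_coroot a e f h : weight a e -> weight (- a) f ->
  vsval h = bracket e f -> a != 0 -> a h = 0 -> h = 0.
Proof.
move=> we wf hE a0 ah; apply: roots0_derived; last by rewrite hE mem_lie_derived.
move=> b /lie_rootsP[b0 wb].
by have [q _ ->] := weight_rational tc we wf hE a0 wb; rewrite ah mulr0.
Qed.

(** The radical contains the centre, so it cannot be shown to vanish; the aim is that it contains no
    root vector. *)
Let rad x := forall y, killing x y = 0.

Let rad_lin (c : K) x y : rad x -> rad y -> rad (c *: x + y).
Proof.
by move=> rx ry z; rewrite killingC killing_linr !(killingC z) rx ry mulr0 addr0.
Qed.

Let rad0 : rad 0.
Proof. by move=> z; rewrite killingC -(scale0r z) killingZr mul0r. Qed.

Let rad_bracket x y : rad x -> rad (bracket x y).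
Proof. by move=> rx z; rewrite killing_inv rx. Qed.

Lemma killing_weight a b x y : weight a x -> weight b y -> a + b != 0 ->
  killing x y = 0.
Proof.
move=> wx wy /linform_neq0[h]; rewrite add_lfunE => abh.
have : killing (bracket x (vsval h)) y = killing x (bracket (vsval h) y).
  exact: killing_inv.
rewrite bracketC wx wy killingZr killingC -scaleNr killingZr killingC => /eqP.
rewrite mulNr eq_sym -addr_eq0 -mulrDl mulf_eq0 addrC (negPf abh) => /eqP //.
Qed.

(* killing h h is a sum of squares of rational multiples of a(h). *)
Let rad_weight_bracket a x y : rad x -> weight a x -> weight (- a) y -> a != 0 ->
  bracket x y = 0.
Proof.
move=> rx wx wy a0.
have ht : bracket x y \in t.
  by apply: weight0_mem; rewrite -(subrr a); exact: weight_bracket.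
pose h : T := Subvs ht; have hE : vsval h = bracket x y by [].
rewrite -hE; suff -> : h = 0 by [].
apply: (bracket_coroot wx wy hE a0).
have [b bb bev] := cartan_semisimple tc ht.
pose ev z : K := if pselect (exists c : K, bracket (vsval h) z = c *: z) is left e
  then sval (cid e) else 0.
have evP z : z \in b -> bracket (vsval h) z = ev z *: z.
  by move=> /bev e; rewrite /ev; case: pselect => // e'; case: (cid e').
have khh : \sum_(z <- b) ev z ^+ 2 = 0.
  rewrite -(killing_eigen bb evP) hE; exact: rad_bracket.
apply: contrapT => /eqP ah.
have ev_real z : z \in b -> exists2 q : K, q \is Num.real & ev z = q * a h.
  move=> zb; have z0 := free_not0 (basis_free bb) zb.
  have [c wc <-] := eigenvalue_weight z0 (evP z zb).
  exact: (weight_rational tc wx wy hE a0 wc).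
have ev0 z : z \in b -> ev z = 0.
  have pos z' : z' \in b -> 0 <= (ev z' / a h) ^+ 2.
    by move=> /ev_real[q qr ->]; rewrite mulfK // -realEsqr.
  have : \sum_(z' <- b | z' \in b) (ev z' / a h) ^+ 2 = 0.
    transitivity ((\sum_(z' <- b) ev z' ^+ 2) * (a h)^-1 ^+ 2); last first.
      by rewrite khh mul0r.
    rewrite -big_seq mulr_suml.
    by apply: eq_bigr => z' _; rewrite exprMn.
  move=> /eqP; rewrite psumr_eq0 // => /allP k0 zb; have := k0 z zb.
  by rewrite zb /= sqrf_eq0 mulf_eq0 invr_eq0 (negPf ah) orbF => /eqP.
suff hZ : vsval h \in lie_center L.
  have : vsval h = 0 by apply: (center_derived L_red) => //; rewrite hE mem_lie_derived.
  by move=> h0; move: ah; rewrite (_ : h = 0) ?linear0 ?eqxx //; apply: val_inj.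
apply/lie_centerP => z; rewrite (coord_basis (X := in_tuple b) bb (memvf z)).
rewrite linear_sum big1 // => i _; rewrite linearZ /= evP ?mem_nth //.
by rewrite ev0 ?mem_nth // scale0r scaler0.
Qed.

Lemma cartan_ideal_component (I J : {vspace L}) h x y : lie_ideal I -> lie_ideal J ->
  (I :&: J = 0)%VS -> x \in I -> y \in J -> vsval h = x + y -> x \in t.
Proof.
move=> iI iJ IJ xI yJ hE; apply: (cartan_maximal tc) => u ut; apply/eqP.
rewrite -memv0 -IJ memv_cap iI //=.
have -> : bracket x u = - bracket y u.
  apply/eqP; rewrite -addr_eq0 -bracketDl -hE; apply/eqP.
  by apply: (cartan_abelian tc) => //; exact: subvsP.
by rewrite memvN iJ.
Qed.

Lemma ideal_weight_zero (I : {vspace L}) a x : lie_ideal I -> (I :&: t = 0)%VS ->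
  a != 0 -> x \in I -> weight a x -> x = 0.
Proof.
move=> iI It a0 xI wx; have [h ah] := linform_neq0 a0.
have [J iJ [IJ dIJ]] := L_red iI.
have : vsval h \in (I + J)%VS by rewrite IJ memvf.
move=> /memv_addP[u uI [v vJ hE]].
have u0 : u = 0.
  by apply/eqP; rewrite -memv0 -It memv_cap uI (cartan_ideal_component iI iJ dIJ uI vJ hE).
have := wx h; rewrite hE u0 add0r bracketC (ideal_disjoint iI iJ dIJ xI vJ) oppr0.
by move/esym/eqP; rewrite scaler_eq0 (negPf ah) => /eqP.
Qed.

(* The nonzero weight vectors of the radical span an ideal meeting t trivially,
   on which a complementary ideal, hence t, acts by zero. *)
Lemma rad_root a x : rad x -> weight a x -> a != 0 -> x = 0.
Proof.
move=> rx wx a0; have [ws wsP] := weight_finite tc.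
pose s := [seq b <- undup ws | b != 0].
have us : uniq s by rewrite filter_uniq ?undup_uniq.
pose P v := exists2 c : linform t -> L, (forall b, weight b (c b) /\ rad (c b)) &
  v = \sum_(b <- s) c b.
have P0 : P 0.
  exists (fun=> 0); last by rewrite big1.
  by move=> b; split; [exact: weight0|exact: rad0].
have Plin (k : K) u v : P u -> P v -> P (k *: u + v).
  move=> [c wc ->] [d wd ->]; exists (fun b => k *: c b + d b).
    move=> b; have [w1 r1] := wc b; have [w2 r2] := wd b.
    by split; [exact: weight_lin|exact: rad_lin].
  by rewrite scaler_sumr -big_split.
have Psum (J : Type) (l : seq J) (A : pred J) F : (forall j, A j -> P (F j)) ->
    P (\sum_(j <- l | A j) F j).
  move=> PF; elim/big_rec: _ => // j u Aj Pu.
  by rewrite -[F j]scale1r; apply: Plin => //; exact: PF.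
have Pw b u : weight b u -> rad u -> b != 0 -> P u.
  move=> wu ru b0; have [->|u0] := eqVneq u 0; first exact: P0.
  exists (fun d => if b == d then u else 0).
    by move=> d; case: eqP => [<- //|_]; split; [exact: weight0|exact: rad0].
  rewrite -big_mkcond big_pred1_uniq // mem_filter b0 mem_undup; apply: wsP.
  by exists u.
have [I IP] := vspace_of_pred P0 Plin.
have iI : lie_ideal I.
  move=> u v /IP[c wc ->]; apply/IP; have [s' [d [_ wd ->]]] := weight_decomp tc v.
  rewrite bracket_suml big_seq; apply: (Psum) => b.
  rewrite mem_filter => /andP[b0 _]; rewrite linear_sum; apply: (Psum) => b' _ /=.
  have [wcb rcb] := wc b.
  have [bb'|bb'] := eqVneq (b + b') 0; last first.
    by apply: (Pw (b + b')) => //; [exact: weight_bracket|exact: rad_bracket].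
  rewrite (rad_weight_bracket rcb wcb _ b0) //.
  by rewrite -(_ : b' = - b) //; apply/eqP; rewrite -addr_eq0 addrC bb'.
have It : (I :&: t = 0)%VS.
  apply/eqP; rewrite -subv0; apply/subvP => u; rewrite memv_cap => /andP[/IP[c wc uE] ut].
  rewrite memv0 -oppr_eq0; pose c' b := if b == 0 then - u else c b.
  have -> : - u = c' 0 by rewrite /c' eqxx.
  apply/eqP; apply: (@weight_indep _ _ _ (0 :: s) c'); rewrite ?mem_head //=.
  - by rewrite us mem_filter eqxx.
  - move=> b; rewrite /c'; case: eqVneq => [->|_]; last by have [] := wc b.
    by rewrite -scaleN1r; apply: weightZ; exact: mem_weight0.
  - rewrite big_cons /c' eqxx {1}uE -sumrN big_seq [X in _ + X]big_seq -big_split.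
    rewrite big1 // => b; rewrite mem_filter => /andP[/negPf -> _]; exact: addNr.
exact: (ideal_weight_zero iI It a0 (iffRL (IP x) (Pw _ _ wx rx a0)) wx).
Qed.

(** Since [e] is not in the radical, it pairs nontrivially with some vector, hence with the
    component of weight [- a] of that vector, which serves as [f]. If [a] vanished on [h = [e, f]],
    then [h] would be zero, against [killing h' [e, f] = a(h') killing e f]. Rescaling by [2 / a(h)]
    normalises. *)
Lemma coroot_exists a : lie_roots fullv t a -> exists h, coroot a h.
Proof.
move=> /lie_rootsP[a0 [e we e0]].
have nr : ~ rad e by move=> re; move/eqP: e0; apply; exact: rad_root re we a0.
have [y ky] : exists y, killing e y != 0.
  by apply: contrapT => /forallNP ny; apply: nr => y; apply/eqP/negPn/negP; exact: ny.
have [s [c [us wc yE]]] := weight_decomp tc y.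
have [b sb kb] : exists2 b, b \in s & killing e (c b) != 0.
  apply: contrapT => nb; move/eqP: ky; apply; rewrite yE killing_sumr big1_seq //.
  move=> b /andP[_ sb]; apply/eqP/negPn/negP => kb; apply: nb; by exists b.
have ba : b = - a.
  apply/eqP; rewrite -addr_eq0; apply: contraNT kb => ab.
  by rewrite (killing_weight we (wc b)) // addrC.
pose f := c b; have wf : weight (- a) f by rewrite -ba; exact: wc.
have ht : bracket e f \in t.
  by apply: weight0_mem; rewrite -(subrr a); exact: weight_bracket.
pose h : T := Subvs ht; have hE : vsval h = bracket e f by [].
have ah : a h != 0 :> K.
  apply/eqP => ah; have h0 := bracket_coroot we wf hE a0 ah.
  have [h' ah'] := linform_neq0 a0.
  have : killing (bracket (vsval h') e) f = killing (vsval h') (bracket e f).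
    exact: killing_inv.
  rewrite -hE h0 we killingC killingZr killingC => /eqP.
  have -> : killing (vsval h') (vsval (0 : T)) = 0.
    by rewrite linear0 -(scale0r (0 : L)) killingZr mul0r.
  by rewrite mulf_eq0 (negPf ah') (negPf kb).
exists ((2 / a h) *: h), e, ((2 / a h) *: f); split.
- exact/root_spaceP.
- by apply/root_spaceP; exact: weightZ.
- by rewrite [LHS]linearZ [RHS]linearZ.
- by rewrite linearZ /= -[_ *: _]/(_ * _) divfK.
Qed.

Local Notation Phi := (lie_roots fullv t).

Lemma linformP a (c : K) (u v : T) : a (c *: u + v) = c * a u + a v :> K.
Proof. by rewrite linearP. Qed.

Lemma linformZ a (c : K) (u : T) : a (c *: u) = c * a u :> K.
Proof. by rewrite linearZ. Qed.

Lemma coroot2 a h : coroot a h -> a h = 2%:R :> K.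
Proof. by move=> [e [f []]]. Qed.

Lemma coroot_derived a h : coroot a h -> vsval h \in @lie_derived K L.
Proof. by move=> [e [f [_ _ -> _]]]; exact: mem_lie_derived. Qed.

Lemma reflection_ex a h : a h = 2%:R :> K ->
  exists w : GL T, forall v : T, w v = v - (a v : K) *: h.
Proof.
move=> ah; pose g (v : T) : T := v - (a v : K) *: h.
have g_lin : linear g.
  move=> c u v; rewrite /g linformP scalerDl opprD -scalerA scalerBr.
  by rewrite addrACA.
pose gL := GRing.isLinear.Build _ _ _ _ g g_lin.
pose G : {linear T -> T} := HB.pack g gL.
have GE (v : T) : linfun G v = v - (a v : K) *: h by rewrite lfunE.
have inj : lker (linfun G) == 0%VS.
  rewrite -subv0; apply/subvP => v; rewrite memv_ker memv0 GE subr_eq0 => /eqP vE.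
  have av : a v = 0 :> K.
    have /eqP := congr1 (fun u => (a u : K)) vE; rewrite linformZ ah -subr_eq0.
    rewrite -{1}[a v : K]mulr1 -mulrBr mulf_eq0 => /orP[/eqP //|].
    by rewrite (_ : 1 - 2 = -1 :> K) ?oppr_eq0 ?oner_eq0 //; ring.
  by rewrite vE av scale0r.
by exists (MkGL (linfun G) inj).
Qed.

Lemma pull_reflection a h b (w : GL T) : (forall v : T, w v = v - (a v : K) *: h) ->
  pull b w = b - (b h : K) *: a.
Proof.
move=> wE; apply/lfunP => v; rewrite pullE wE linearB linearZ add_lfunE opp_lfunE.
by rewrite scale_lfunE /=; congr (_ - _); exact: mulrC.
Qed.

Lemma reflection_root a h b (w : GL T) : coroot a h ->
  (forall v : T, w v = v - (a v : K) *: h) -> Phi b -> Phi (pull b w).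
Proof.
move=> [e [f [/root_spaceP we /root_spaceP wf hE ah]]] wE /lie_rootsP[b0 wb].
apply/lie_rootsP; split; first by rewrite pull_eq0.
rewrite (pull_reflection b wE).
have [n [[-> nw]|[-> nw]]] := weight_string tc we wf hE ah wb.
  by rewrite scaler_nat; exact: nw.
by rewrite scaleNr opprK scaler_nat; exact: nw.
Qed.

Lemma reflection_invol a h (w : GL T) : a h = 2%:R :> K ->
  (forall v : T, w v = v - (a v : K) *: h) -> (w^-1 = w)%g.
Proof.
move=> ah wE; apply: (mulgI w); rewrite mulgV; apply/val_inj/lfunP => v.
transitivity v; first exact: GL1E.
transitivity (w (w v)); last exact/esym/GLME.
have aw : a (w v) = - a v :> K.
  by rewrite wE addrC -scaleNr linformP ah; ring.
by rewrite (wE (w v)) aw scaleNr opprK wE subrK.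
Qed.

Let W_sub : is_subgroup (weyl t). Proof. exact: gen_subgroup_sub. Qed.

Lemma weyl_root w b : weyl t w -> Phi b -> Phi (pull b w).
Proof.
pose H : set (GL T) := [set w : GL T |
  forall b, Phi b -> Phi (pull b w) /\ Phi (pull b (w^-1)%g)].
move=> Ww Rb; suff : H w by move=> /(_ b Rb)[].
apply: (Ww H) => [|u [a Ra [h ah uE]] c Rc].
  split=> [c Rc|x y Hx Hy c Rc|x Hx c Rc].
  - by rewrite invg1 pull1; split.
  - rewrite invgM !pullM; split.
      by have [Rcx _] := Hx _ Rc; have [] := Hy _ Rcx.
    by have [_ Rcy] := Hy _ Rc; have [] := Hx _ Rcy.
  - by have [? ?] := Hx _ Rc; rewrite invgK; split.
by rewrite (reflection_invol (coroot2 ah) uE); split; exact: reflection_root ah uE Rc.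
Qed.

(** Coroots are brackets, so a reflection moves vectors by elements of the derived algebra. With
    [roots0_derived] this makes the action on roots faithful. *)
Lemma weyl_derived (w : GL T) (v : T) : weyl t w -> vsval (w v - v) \in @lie_derived K L.
Proof.
move=> Ww; pose H : set (GL T) := [set w : GL T | forall v : T, vsval (w v - v) \in @lie_derived K L].
suff : H w by apply.
apply: (Ww H) => [|u [a Ra [h ah uE]] c].
  split=> [c|x y Hx Hy c|x Hx c].
  - by rewrite GL1E subrr mem0v.
  - rewrite GLME -[_ - c](subrKA (y c)) linearD; apply: memvD; [exact: Hx|exact: Hy].
  - rewrite -opprB linearN memvN -{1}[c](GLKV x); exact: Hx.
by rewrite uE addrAC subrr add0r linearN memvN linearZ memvZ // (coroot_derived ah).
Qed.

Lemma weyl_faithful w : weyl t w -> (forall b, Phi b -> pull b w = b) -> w = 1%g.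
Proof.
move=> Ww wb; apply/val_inj/lfunP => v; rewrite [RHS]GL1E; apply/eqP.
rewrite -subr_eq0; apply/eqP; apply: roots0_derived; last exact: weyl_derived.
by move=> b Rb; rewrite linearB /= -pullE (wb b Rb) subrr.
Qed.

Lemma weyl_finite : finite_set (weyl t).
Proof.
have [ws wsP] := weight_finite tc.
apply: (@finite_faithful _ _ _ ws Phi pull).
- by move=> b /lie_rootsP[_]; exact: wsP.
- by move=> w b; exact: weyl_root.
move=> x y Wx Wy xy; have WV := subgroupV W_sub Wx.
suff xy1 : (x^-1 * y)%g = 1%g by rewrite -[y]mul1g -(mulgV x) -mulgA xy1 mulg1.
apply: weyl_faithful; first exact: (subgroupM W_sub WV Wy).
move=> b Rb; rewrite pullM -(xy _ (weyl_root WV Rb)) -pullM mulVg.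
exact: pull1.
Qed.

(* Otherwise the product of the two reflections is a transvection, and its powers
   move some root along an infinite set of roots. *)
Lemma coroot_unique a h k (w : GL T) : coroot a h -> a != 0 -> a k = 2%:R :> K ->
  vsval k \in @lie_derived K L -> (forall v : T, w v = v - (a v : K) *: k) ->
  (forall b, Phi b -> Phi (pull b w)) -> h = k.
Proof.
move=> ah a0 ak kD wE wR; have [s sE] := reflection_ex (coroot2 ah).
apply/esym/eqP; rewrite -subr_eq0; apply/eqP; apply: roots0_derived; last first.
  by rewrite linearB memvB // (coroot_derived ah).
move=> b Rb; apply/eqP/negPn/negP => bkh; rewrite linearB /= in bkh.
pose d : K := (b k : K) - b h.
pose F n : linform t := b + (n%:R * d) *: a.
have FR n : Phi (F n).
  elim: n => [|n IHn]; first by rewrite /F mul0r scale0r addr0.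
  have -> : F n.+1 = pull (pull (F n) w) s.
    rewrite (pull_reflection _ wE) (pull_reflection _ sE) /F.
    rewrite !add_lfunE !opp_lfunE !scale_lfunE ak (coroot2 ah).
    apply/lfunP => v; rewrite !(add_lfunE, opp_lfunE, scale_lfunE).
    rewrite -?[_ *: (_ : K^o)]/((_ : K) * _) /d -natr1.
    ring.
  exact: reflection_root ah sE (wR _ IHn).
apply: (@weight_no_line _ _ _ tc F) => [m n|n]; last by have /lie_rootsP[] := FR n.
move=> /addrI /eqP; rewrite -subr_eq0 -scalerBl scaler_eq0 (negPf a0) orbF.
by rewrite -mulrBl mulf_eq0 (negPf bkh) orbF subr_eq0 eqr_nat => /eqP.
Qed.

Section Normalize.
Context (phi : GL T).
Hypothesis phi_root : forall b, Phi (pull b phi) <-> Phi b.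
Hypothesis phi_derived : forall v : T, vsval v \in @lie_derived K L ->
  vsval (phi v) \in @lie_derived K L.

(** [phi] acts on [t] and not on [L], so it carries no sl2-triple along. The conjugate of a
    reflection sends [v] to [v - a'(v) phi(h)] and preserves the roots; [coroot_unique] then
    identifies [phi h] with the coroot of [a']. *)
Lemma weyl_conj w : weyl t w -> weyl t (phi * w * phi^-1)%g.
Proof.
pose H : set (GL T) := [set w : GL T | weyl t (phi * w * phi^-1)%g].
move=> Ww; apply: (Ww H) => [|u [a Ra [h ah uE]]].
  split=> [|x y Hx Hy|x Hx]; rewrite /H /=.
  - by rewrite mulg1 mulgV; exact: (subgroup1 W_sub).
  - have -> : (phi * (x * y) * phi^-1 = (phi * x * phi^-1) * (phi * y * phi^-1))%g.
      by rewrite !mulgA mulgVK.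
    exact: (subgroupM W_sub).
  - have -> : (phi * x^-1 * phi^-1 = (phi * x * phi^-1)^-1)%g.
      by rewrite !invgM invgK mulgA.
    exact: (subgroupV W_sub).
pose a' := pull a (phi^-1)%g; pose w' := (phi * u * phi^-1)%g.
have a'E : pull a' phi = a by rewrite /a' -pullM mulVg; exact: pull1.
have Ra' : Phi a' by apply/(phi_root a'); rewrite a'E; exact: Ra.
have w'E (v : T) : w' v = v - (a' v : K) *: phi h.
  by rewrite /w' !GLME uE linearB linearZ /= GLKV /a' pullE.
have [h' a'h'] := coroot_exists Ra'.
have h'E : h' = phi h.
  apply: (coroot_unique (w := w') a'h').
  - by case: Ra'.
  - by rewrite /a' pullE GLK (coroot2 ah).
  - by apply: phi_derived; exact: coroot_derived ah.
  - exact: w'E.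
  - move=> b Rb; have -> : pull b w' = pull (pull (pull b phi) u) (phi^-1)%g.
      by rewrite -!pullM mulgA.
    have Rb1 : Phi (pull b phi) by apply/(phi_root b).
    have Rb2 := reflection_root ah uE Rb1.
    apply: (iffLR (phi_root (pull (pull (pull b phi) u) (phi^-1)%g))).
    by rewrite -pullM mulVg pull1; exact: Rb2.
move=> G sG SG; apply: SG; exists a' => //; exists h' => // v.
by rewrite h'E w'E.
Qed.

End Normalize.

End Coroots.

(** * Monodromy of a normal covering *)

(** Real induction: the supremum of the points reached from [a] is itself reached and cannot be
    below [b]. It stands in for subdivision by a Lebesgue number. *)
Lemma interval_ind (R : realType) (P : R -> R -> Prop) (a b : R) :
  a <= b ->
  (forall x y z, x <= y -> y <= z -> P x y -> P y z -> P x z) ->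
  (forall x, a <= x <= b -> exists2 e, 0 < e &
     forall y z, a <= y -> y <= z -> z <= b -> x - e < y -> z < x + e -> P y z) ->
  P a b.
Proof.
move=> ab Ptr Ploc.
pose S : set R := [set x | a <= x <= b /\ P a x].
have Sa : S a.
  split; first by rewrite lexx.
  have [|e e0 He] := Ploc a; first by rewrite lexx.
  by apply: He => //; lra.
have supS : has_sup S.
  by split; [exists a|exists b => x [/andP[]]].
have as_ : a <= sup S by apply: ub_le_sup Sa; exact: supS.2.
have sb : sup S <= b by apply: ge_sup => [|x [/andP[]]//]; exists a.
have [|e e0 He] := Ploc (sup S); first by rewrite as_.
have [x [/andP[ax xb] Pax] xe] := sup_adherent e0 supS.
have xs : x <= sup S.
  by apply: ub_le_sup; [exact: supS.2|split => //; rewrite ax].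
pose z := Num.min b (sup S + e / 2).
have sz : sup S <= z by rewrite le_min sb /=; lra.
have zb : z <= b by rewrite ge_min lexx.
have zs : z < sup S + e by rewrite gt_min; apply/orP; right; lra.
have Paz : P a z by apply: (Ptr _ x) => //; [lra|apply: He => //; lra].
have [bz|bz] := leP b (sup S + e / 2).
  by move: Paz; rewrite /z min_l.
suff : z <= sup S by rewrite /z min_r; lra.
by apply: ub_le_sup; [exact: supS.2|split => //; apply/andP; split; lra].
Qed.

Section Covering.
Context {R : realType} {E X : topologicalType} (q : E -> X).
Hypothesis q_surj : forall x, exists e, q e = x.
Hypothesis q_cont : continuous q.
Hypothesis q_open : forall e U, nbhs e U -> nbhs (q e) (q @` U).
Hypothesis q_inj : forall e : E, exists2 U : set E, nbhs e U & {in U &, injective q}.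
Hypothesis E_haus : hausdorff_space E.
Context (Z : groupType) (act : Z -> E -> E).
Hypothesis act_cont : forall a, continuous (act a).
Hypothesis actM : forall a b e, act (a * b)%g e = act a (act b e).
Hypothesis q_act : forall a e, q (act a e) = q e.
Hypothesis act_trans : forall e e', q e = q e' -> exists a, act a e = e'.
Context (e0 : E).
Hypothesis act_free : forall a b, act a e0 = act b e0 -> a = b.
Hypothesis E_path : forall e, exists f : R -> E,
  [/\ {within `[0%R, 1%R]%classic, continuous f}, f 0 = e0 & f 1 = e].
Local Notation x0 := (q e0).

Lemma local_section (x : X) : exists2 V : set X, nbhs x V & forall e, V (q e) ->
  exists s : X -> E, [/\ {within V, continuous s},
    forall y, V y -> q (s y) = y & s (q e) = e].
Proof.
have [e1 <-] := q_surj x; have [U0 nU0 injU0] := q_inj e1.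
pose U := interior U0.
have nU : nbhs e1 U by apply: nbhs_interior.
have UU0 : U `<=` U0 by exact: interior_subset.
exists (q @` U); first exact: q_open.
move=> e [u Uu /act_trans[d due]].
pose i y := if pselect (exists2 u, U u & q u = y) is left h
  then sval (cid2 h) else e1.
have iP y : (q @` U) y -> U (i y) /\ q (i y) = y.
  by rewrite /i; case: pselect => //= h _; case: (cid2 h).
have iK v : U v -> i (q v) = v.
  move=> Uv; have [|Ui qi] := iP (q v); first by exists v.
  by apply: injU0 => //; rewrite inE; exact: UU0.
exists (act d \o i); split.
- apply/subspace_continuousP => _ [v Uv <-] W /= nW.
  move: nW; rewrite /from_subspace /= iK // => nW; have nW' : nbhs v (act d @^-1` W) := act_cont nW.
  have : nbhs (q v) (q @` (act d @^-1` W `&` U)).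
    apply: q_open; apply: filterI => //.
    by apply: open_nbhs_nbhs; split => //; exact: open_interior.
  rewrite /within /= /nbhs /=.
  by apply: filterS => _ [w [Ww Uw] <-] _ /=; rewrite iK.
- by move=> y /iP[_ iy] /=; rewrite q_act.
- by rewrite /= -due q_act // iK.
Qed.

(** The set of agreement is open by local injectivity of [q] and closed because [E] is Hausdorff. *)
Lemma lift_unique (T : topologicalType) (A : set T) (f g : T -> E) z :
  connected A -> {within A, continuous f} -> {within A, continuous g} ->
  (forall y, A y -> q (f y) = q (g y)) -> A z -> f z = g z ->
  forall y, A y -> f y = g y.
Proof.
move=> /clopen_connectedP cA cf cg fg Az fgz.
suff : [set y | A y /\ f y = g y] = A by move=> AE y; rewrite -{1}AE => -[].
apply: cA => [|y []//|]; last by exists z.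
move/subspace_continuousP: cf => cf; move/subspace_continuousP: cg => cg.
have nS y (W : set T) : A y -> within A (nbhs y) W -> nbhs (y : subspace A) W.
  by move=> Ay; rewrite nbhs_subspace_in.
(* Points outside [A] are isolated in [subspace A]. *)
have nO y (W : set T) : ~ A y -> W y -> nbhs (y : subspace A) W.
  by case: (nbhs_subspaceP A (y : subspace A)) => // _ _ Wy _ ->.
split.
- rewrite openE => y [Ay fgy]; apply: nS => //.
  have [U nU injU] := q_inj (f y).
  have nf := cf _ Ay _ nU; rewrite fgy in nU; have ng := cg _ Ay _ nU.
  move: nf ng; rewrite /within /nbhs /= => nf ng.
  apply: filterS2 nf ng => w fU gU Aw; split => //.
  by apply: injU; rewrite ?inE; [exact: fU|exact: gU|exact: fg].
- rewrite -[X in closed X]setCK; apply: open_closedC; rewrite openE => y.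
  have [Ay /= nfg|nAy _] := pselect (A y); last first.
    by apply: nO => // -[].
  have {}nfg : f y != g y by apply/eqP => e; exact: nfg.
  move: E_haus; rewrite open_hausdorff => /(_ _ _ nfg).
  move=> [[U V] /= [/set_mem Uf /set_mem Vg] [oU oV UV]].
  have nf := cf _ Ay _ (open_nbhs_nbhs (conj oU Uf)).
  have ng := cg _ Ay _ (open_nbhs_nbhs (conj oV Vg)).
  apply: nS => //; move: nf ng; rewrite /within /nbhs /= => nf ng.
  apply: filterS2 nf ng => w fU gV Aw [_ fgw].
  suff : (U `&` V) (f w) by rewrite (eqP UV).
  by split; [exact: fU|rewrite fgw; exact: gV].
Qed.

(** The value may be prescribed at any point of [A], so that in gluing one piece can be continued
    from wherever it meets the other. *)
Definition liftable (T : topologicalType) (H : T -> X) (A : set T) :=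
  forall z e, A z -> q e = H z -> exists K : T -> E,
    [/\ {within A, continuous K}, forall y, A y -> q (K y) = H y & K z = e].

Lemma liftable_glue (T : topologicalType) (H : T -> X) (A B : set T) :
  closed A -> closed B -> A `&` B !=set0 -> connected (A `&` B) ->
  liftable H A -> liftable H B -> liftable H (A `|` B).
Proof.
suff main (A' B' : set T) z e : closed A' -> closed B' -> A' `&` B' !=set0 ->
    connected (A' `&` B') -> liftable H A' -> liftable H B' ->
    A' z -> q e = H z -> exists K : T -> E,
    [/\ {within A' `|` B', continuous K},
      forall y, (A' `|` B') y -> q (K y) = H y & K z = e].
  move=> cA cB AB0 ABc lA lB z e [Az|Bz] qe; first exact: main.
  by rewrite setUC; apply: main => //; rewrite setIC.
move=> cA cB [y0 [Ay0 By0]] ABc lA lB Az qe.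
have [K1 [cK1 qK1 K1z]] := lA z e Az qe.
have [K2 [cK2 qK2 K2y]] := lB y0 (K1 y0) By0 (qK1 _ Ay0).
have K12 y : A' y -> B' y -> K1 y = K2 y.
  move=> Ay By; apply: (@lift_unique T (A' `&` B') K1 K2 y0) => //.
  - by apply: continuous_subspaceW cK1 => w [].
  - by apply: continuous_subspaceW cK2 => w [].
  - by move=> w [Aw Bw]; rewrite qK1 // qK2.
pose K y := if `[< A' y >] then K1 y else K2 y.
have KA y : A' y -> K y = K1 y by move=> Ay; rewrite /K asboolT.
have KB y : B' y -> K y = K2 y.
  by move=> By; rewrite /K; case: asboolP => // Ay; exact: K12.
exists K; split.
- apply: withinU_continuous => //.
  + by apply: (subspace_eq_continuous _ cK1) => y /set_mem /KA; rewrite /from_subspace.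
  + by apply: (subspace_eq_continuous _ cK2) => y /set_mem /KB; rewrite /from_subspace.
- by move=> y [Ay|By]; rewrite ?(KA _ Ay) ?(KB _ By) ?qK1 ?qK2.
- by rewrite KA.
Qed.

Lemma liftable_local (T : topologicalType) (H : T -> X) (A : set T) z :
  {within A, continuous H} -> A z ->
  exists2 W : set T, nbhs z W & forall B, B `<=` A `&` W -> liftable H B.
Proof.
move=> /subspace_continuousP cH Az.
have [V nV sV] := local_section (H z).
have := cH z Az _ nV; rewrite /within /nbhs /= => nW.
exists [set y | A y -> V (H y)] => // B BAW y e By qe.
have HV w : B w -> V (H w) by move=> /BAW[Aw]; apply.
have [|s [cs qs se]] := sV e; first by rewrite qe; exact: HV.
exists (s \o H); split.
- apply: (within_comp (B := V)) cs => //.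
  apply: (@continuous_subspaceW _ _ B A); first by move=> w /BAW[].
  exact/subspace_continuousP.
- by move=> w Bw /=; rewrite qs //; exact: HV.
- by rewrite /= -qe.
Qed.

Definition rect (a b c d : R) : set (R * R) := `[a, b]%classic `*` `[c, d]%classic.

Lemma closed_rect a b c d : closed (rect a b c d).
Proof.
have -> : rect a b c d =
    (fst @^-1` `[a, b]%classic) `&` (snd @^-1` `[c, d]%classic).
  by apply/seteqP; split => -[].
apply: closedI.
- by apply: (continuous_closedP _).1 (@itv_closed _ R a b) => p; exact: cvg_fst.
- by apply: (continuous_closedP _).1 (@itv_closed _ R c d) => p; exact: cvg_snd.
Qed.

Lemma connected_hseg a c d : connected (rect a a c d).
Proof.
have -> : rect a a c d = (fun u => (a, u)) @` `[c, d]%classic.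
  apply/seteqP; split => [[t u] [/= ta ucd]|_ [u ucd <-]].
    by exists u => //; move: ta; rewrite in_itv /= -eq_le => /eqP <-.
  by split => //=; rewrite in_itv /= lexx.
apply: connected_continuous_connected; first exact: segment_connected.
apply: continuous_subspaceT; apply: pair_cont => z; first exact: cvg_cst.
exact: cvg_id.
Qed.

Lemma connected_vseg a b c : connected (rect a b c c).
Proof.
have -> : rect a b c c = (fun t => (t, c)) @` `[a, b]%classic.
  apply/seteqP; split => [[t u] [/= tab uc]|_ [u ucd <-]].
    by exists t => //; move: uc; rewrite in_itv /= -eq_le => /eqP <-.
  by split => //=; rewrite in_itv /= lexx.
apply: connected_continuous_connected; first exact: segment_connected.
apply: continuous_subspaceT; apply: pair_cont => z; last exact: cvg_cst.
exact: cvg_id.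
Qed.

Lemma liftable_hcat H a b c d e : a <= b -> b <= c -> d <= e ->
  liftable H (rect a b d e) -> liftable H (rect b c d e) ->
  liftable H (rect a c d e).
Proof.
move=> ab bc de l1 l2.
have IE : rect a b d e `&` rect b c d e = rect b b d e.
  apply/seteqP; split => [[t u]|[t u]]; rewrite /rect /= !in_itv /=; first lra.
  by move=> [? ?]; split; split; lra.
have -> : rect a c d e = rect a b d e `|` rect b c d e.
  apply/seteqP; split => [[t u]|[t u]]; rewrite /rect /= !in_itv /=; last lra.
  by have [?|?] := leP t b; [left|right]; lra.
apply: liftable_glue => //; try exact: closed_rect.
- by rewrite IE; exists (b, d); split; rewrite /= in_itv /= ?lexx.
- by rewrite IE; exact: connected_hseg.
Qed.

Lemma liftable_vcat H a b c d e : a <= b -> c <= d -> d <= e ->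
  liftable H (rect a b c d) -> liftable H (rect a b d e) ->
  liftable H (rect a b c e).
Proof.
move=> ab cd de l1 l2.
have IE : rect a b c d `&` rect a b d e = rect a b d d.
  apply/seteqP; split => [[t u]|[t u]]; rewrite /rect /= !in_itv /=; first lra.
  by move=> [? ?]; split; split; lra.
have -> : rect a b c e = rect a b c d `|` rect a b d e.
  apply/seteqP; split => [[t u]|[t u]]; rewrite /rect /= !in_itv /=; last lra.
  by have [?|?] := leP u d; [left|right]; lra.
apply: liftable_glue => //; try exact: closed_rect.
- by rewrite IE; exists (a, d); split; rewrite /= in_itv /= ?lexx.
- by rewrite IE; exact: connected_vseg.
Qed.

Lemma liftable_square H : {within rect 0 1 0 1, continuous H} ->
  liftable H (rect 0 1 0 1).
Proof.
move=> cH.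
(* At fixed [t] the induction runs along the height, the width [e] shrinking to a minimum at each
   concatenation; this yields a full column of positive width, and columns are then put side by
   side. *)
pose strip t e c d := forall a b, 0 <= a -> a <= b -> b <= 1 ->
  t - e < a -> b < t + e -> liftable H (rect a b c d).
pose P2 a b := liftable H (rect a b 0 1).
apply: (@interval_ind R P2) => // [x y z xy yz|t /andP[t0 t1]].
  exact: liftable_hcat.
pose P1 c d := exists2 e, 0 < e & strip t e c d.
suff [e ep He] : P1 0 1.
  exists e => // y z y0 yz z1 ye ze; exact: He.
apply: (@interval_ind R P1) => // [c d e cd de [e1 e10 H1] [e2 e20 H2]|u /andP[u0 u1]].
  exists (Num.min e1 e2); first by rewrite lt_min e10.
  move=> a b a0 ab b1 aE bE; apply: (@liftable_vcat _ a b c d e) => //.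
    have : Num.min e1 e2 <= e1 by rewrite ge_min lexx.
    by move=> ?; apply: H1 => //; lra.
  have : Num.min e1 e2 <= e2 by rewrite ge_min lexx orbT.
  by move=> ?; apply: H2 => //; lra.
have [|W nW lW] := @liftable_local _ H (rect 0 1 0 1) (t, u) cH.
  by split; rewrite /= in_itv /= ?t0 ?u0.
have [[W1 W2] /= [nW1 nW2] W12] := nW.
have [e1 /= e10 B1] := (nbhs_ballP _ _).1 nW1.
have [e2 /= e20 B2] := (nbhs_ballP _ _).1 nW2.
exists e2 => // c d c0 cd d1 ce de; exists e1 => // a b a0 ab b1 ae be.
apply: lW => -[x y] [/=]; rewrite !in_itv /= => /andP[ax xb] /andP[cy yd].
split; first by split; rewrite /= in_itv /=; lra.
apply: W12; split => /=.
- by apply: B1; rewrite /ball /= ltr_norml; lra.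
- by apply: B2; rewrite /ball /= ltr_norml; lra.
Qed.

Local Notation I := (`[0%R, 1%R]%classic : set R).

Let I0 : I 0. Proof. by rewrite /= in_itv /= lexx ler01. Qed.
Let I1 : I 1. Proof. by rewrite /= in_itv /= lexx ler01. Qed.

Lemma path_lift (f : R -> X) e : {within I, continuous f} -> q e = f 0 ->
  exists K : R -> E, [/\ {within I, continuous K},
    forall t, I t -> q (K t) = f t & K 0 = e].
Proof.
move=> cf qe.
have [|||K [cK qK Ke]] := @liftable_square (f \o fst) _ (0, 0) e.
- apply: (within_comp (B := I)) cf => [|[t u] []//].
  by apply: continuous_subspaceT => z; exact: cvg_fst.
- by split; exact: I0.
- by rewrite /= qe.
exists (K \o (fun t => (t, 0))); split => //; last first.
  by move=> t It; rewrite /= qK //; split => //; exact: I0.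
apply: (within_comp (B := rect 0 1 0 1)) cK; last by move=> t It; split => //; exact: I0.
by apply: continuous_subspaceT; apply: pair_cont => z; [exact: cvg_id|exact: cvg_cst].
Qed.

Lemma path_lift_unique (K1 K2 : R -> E) :
  {within I, continuous K1} -> {within I, continuous K2} ->
  (forall t, I t -> q (K1 t) = q (K2 t)) -> K1 0 = K2 0 ->
  forall t, I t -> K1 t = K2 t.
Proof.
move=> c1 c2 qK K0; apply: (@lift_unique _ I K1 K2 0) => //; exact: segment_connected.
Qed.

(** The two sides [t = 0] and [t = 1] of the square are mapped to [x], so their lifts are constant
    by uniqueness. *)
Lemma homotopy_lift (H : R * R -> X) (x : X) e :
  {within I `*` I, continuous H} -> (forall u, I u -> H (0, u) = x /\ H (1, u) = x) ->
  q e = x -> exists K : R * R -> E, [/\ {within I `*` I, continuous K},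
    forall z, (I `*` I) z -> q (K z) = H z &
    forall u, I u -> K (0, u) = e /\ K (1, u) = K (1, 0)].
Proof.
move=> cH Hx qe.
have [||K [cK qK Ke]] := @liftable_square H cH (0, 0) e.
- by split; exact: I0.
- by rewrite (Hx _ I0).1.
exists K; split => // u Iu.
have cv a : I a -> {within I, continuous (K \o (fun u => (a, u)))}.
  move=> Ia; apply: (within_comp (B := rect 0 1 0 1)) cK; last by move=> t It; split.
  by apply: continuous_subspaceT; apply: pair_cont => z; [exact: cvg_cst|exact: cvg_id].
split.
- rewrite -Ke; apply: (@path_lift_unique (K \o (fun u => (0, u))) (cst (K (0, 0)))) => //.
  + exact: cv.
  + by apply: continuous_subspaceT => z; exact: cvg_cst.
  + by move=> v Iv /=; rewrite !qK ?(Hx _ Iv).1 ?(Hx _ I0).1.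
- apply: (@path_lift_unique (K \o (fun u => (1, u))) (cst (K (1, 0)))) => //.
  + exact: cv.
  + by apply: continuous_subspaceT => z; exact: cvg_cst.
  + by move=> v Iv /=; rewrite !qK ?(Hx _ Iv).2 ?(Hx _ I0).2.
Qed.

Definition lifts (f : R -> X) e (K : R -> E) := [/\ {within I, continuous K},
  forall t, I t -> q (K t) = f t & K 0 = e].

Lemma lifts_unique (f : R -> X) e K1 K2 : lifts f e K1 -> lifts f e K2 ->
  forall t, I t -> K1 t = K2 t.
Proof.
move=> [c1 q1 K10] [c2 q2 K20]; apply: path_lift_unique => //; last by rewrite K10.
by move=> t It; rewrite q1 // q2.
Qed.

Lemma monodromy_ex (f : loop (R := R) x0) :
  exists a, exists2 K, lifts f e0 K & K 1 = act a e0.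
Proof.
have [K [cK qK K0]] := path_lift (@loop_cont R X x0 f) (esym (loop0 f)).
have [|a ae] := @act_trans e0 (K 1); first by rewrite qK // loop1.
by exists a, K.
Qed.

Definition monodromy (f : loop (R := R) x0) : Z := sval (cid (monodromy_ex f)).

Lemma monodromyE (f : loop (R := R) x0) K a :
  lifts f e0 K -> K 1 = act a e0 -> monodromy f = a.
Proof.
move=> lK K1; rewrite /monodromy; case: cid => b /= [K' lK' K'1].
by apply: act_free; rewrite -K1 -K'1; exact: lifts_unique lK' lK _ I1.
Qed.

Lemma monodromyP (f : loop (R := R) x0) : exists2 K, lifts f e0 K & K 1 = act (monodromy f) e0.
Proof. by rewrite /monodromy; case: cid. Qed.

Let hslice (K : R * R -> E) u : {within I `*` I, continuous K} -> I u ->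
  {within I, continuous (K \o (fun t => (t, u)))}.
Proof.
move=> cK Iu; apply: (within_comp (B := I `*` I)) cK; last by move=> t It; split.
by apply: continuous_subspaceT; apply: pair_cont => z; [exact: cvg_id|exact: cvg_cst].
Qed.

Lemma monodromy_homotopic (f g : loop (R := R) x0) : homotopic f g -> monodromy f = monodromy g.
Proof.
move=> [H [cH H0 H1 Hx]]; have [K [cK qK Ku]] := homotopy_lift cH Hx erefl.
have [Kg lKg Kg1] := monodromyP g.
apply: (@monodromyE _ (K \o (fun t => (t, 0)))).
  split; [exact: hslice| |by rewrite /= (Ku _ I0).1].
  by move=> t It /=; rewrite qK ?H0 //; split.
rewrite -Kg1 /= -(Ku _ I1).2.
have lKg' : lifts g e0 (K \o (fun t => (t, 1))).
  split; [exact: hslice| |by rewrite /= (Ku _ I1).1].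
  by move=> t It /=; rewrite qK ?H1 //; split.
exact: lifts_unique lKg' lKg _ I1.
Qed.

Lemma lifts_act a f e K : lifts f e K -> lifts f (act a e) (act a \o K).
Proof.
move=> [cK qK K0]; split; last by rewrite /= K0.
  apply: (within_comp (B := setT)) cK _ _ => //; exact: continuous_subspaceT.
by move=> t It /=; rewrite q_act qK.
Qed.

(** The second half of the lift covers [g] from [act (monodromy f) e0], hence is the translate of
    the lift of [g] from [e0] and ends at [act (monodromy f) (act (monodromy g) e0)]. This is why
    monodromy is a morphism and not an antimorphism. *)
Lemma monodromy_cat (f g : loop (R := R) x0) : monodromy (loop_cat f g) = (monodromy f * monodromy g)%g.
Proof.
have [K [cK qK K0] K1] := monodromyP (loop_cat f g).
have [Kf lKf Kf1] := monodromyP f; have [Kg lKg Kg1] := monodromyP g.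
have qKE t : I t -> q (K t) = cat_fun f g t by exact: qK.
have lf : lifts f e0 (K \o (fun t => 2^-1 * t)).
  split => /=; last by rewrite mulr0.
    apply: (within_comp (B := I)) cK => [|t].
      apply: continuous_subspaceT => z.
      by apply: cvgM; [exact: cvg_cst|exact: cvg_id].
    by rewrite /= !in_itv /=; lra.
  move=> t; rewrite /= in_itv /= => It; rewrite qKE /cat_fun /=; last first.
    by rewrite in_itv /=; lra.
  by rewrite ifT; [congr (f _)|]; lra.
have Kh : K 2^-1 = act (monodromy f) e0.
  by rewrite -Kf1 -(lifts_unique lf lKf I1) /= mulr1.
have lg : lifts g (act (monodromy f) e0) (K \o (fun t => 2^-1 * t + 2^-1)).
  split => /=; last by rewrite mulr0 add0r.
    apply: (within_comp (B := I)) cK => [|t].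
      apply: continuous_subspaceT => z.
      apply: cvgD; last exact: cvg_cst.
      by apply: cvgM; [exact: cvg_cst|exact: cvg_id].
    by rewrite /= !in_itv /=; lra.
  move=> t; rewrite /= in_itv /= => It; rewrite qKE /cat_fun /=; last first.
    by rewrite in_itv /=; lra.
  (* At [t = 0] the concatenation is still on its first branch, and [f 1 = g 0] is used. *)
  have [t0|t0] := leP t 0.
    have -> : t = 0 by lra.
    rewrite ifT; last lra.
    by rewrite (_ : 2 * _ = 1) ?loop1 ?loop0 //; lra.
  rewrite ifN; last by rewrite -ltNge; lra.
  by congr (g _); lra.
apply: act_free; rewrite -K1 actM -Kg1.
rewrite -[RHS](lifts_unique lg (lifts_act (monodromy f) lKg) I1) /=.
by congr K; lra.
Qed.

Definition pi1_monodromy (c : pi1 R x0) : Z := monodromy (repr c).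

Lemma pi1_monodromyE (f : loop (R := R) x0) : pi1_monodromy (pi1_class f) = monodromy f.
Proof. by apply: monodromy_homotopic; exact: pi1_reprE. Qed.

Lemma monodromy_exact : short_exact
  (pi1_map q_cont (erefl x0) : pi1 R e0 -> pi1 R x0) pi1_monodromy.
Proof.
(* That the unit acts trivially is not among the hypotheses on [act]; at [e0] it follows from
   freeness. *)
have act1 : act 1%g e0 = e0.
  have [a ae] := @act_trans e0 e0 erefl.
  have : act (a * a)%g e0 = act a e0 by rewrite actM ae.
  move/act_free => aa; suff <- : a = 1%g by [].
  by apply: (mulgI a); rewrite mulg1.
have lmap (f : loop (R := R) e0) : lifts (loop_map q_cont (erefl x0) f) e0 f.
  by split; [exact: loop_cont|by []|exact: loop0].
split.
- exact: pi1_mapM.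
- elim/(@pi1_ind R X x0) => f; elim/(@pi1_ind R X x0) => g.
  have -> : (pi1_class f * pi1_class g)%g = pi1_class (loop_cat f g).
    exact: pi1_mulE.
  by rewrite !pi1_monodromyE monodromy_cat.
- elim/(@pi1_ind R E e0) => f; elim/(@pi1_ind R E e0) => g.
  rewrite !pi1_mapE => /pi1_classE [H [cH H0 H1 Hx]]; apply/pi1_classE.
  (* A homotopy between the images lifts to one between the loops themselves, which are the lifts of
     their images. *)
  have [K [cK qK Ku]] := homotopy_lift cH Hx erefl.
  have Kf t : I t -> K (t, 0) = f t.
    move=> It; apply: (lifts_unique (f := q \o f) (e := e0) (K1 := K \o (fun t => (t, 0)))) It => //.
      split; [exact: hslice| |by rewrite /= (Ku _ I0).1].
      by move=> u Iu /=; rewrite qK ?H0 //; split.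
    exact: lmap.
  have Kg t : I t -> K (t, 1) = g t.
    move=> It; apply: (lifts_unique (f := q \o g) (e := e0) (K1 := K \o (fun t => (t, 1)))) It => //.
      split; [exact: hslice| |by rewrite /= (Ku _ I1).1].
      by move=> u Iu /=; rewrite qK ?H1 //; split.
    exact: lmap.
  exists K; split => // u Iu; have [-> ->] := Ku _ Iu.
  by rewrite Kf // loop1.
- elim/(@pi1_ind R X x0) => f; rewrite pi1_monodromyE; split.
    move=> f1; have [K [cK qK K0]] := monodromyP f; rewrite f1 act1 => K1.
    exists (pi1_class (Loop cK K0 K1)) => //; rewrite pi1_mapE.
    apply/pi1_classE; apply: (@homotopic_reparam _ _ _ f id id) => //.
    + exact: loop_cont.
    + by move=> z; exact: cvg_id.
    + by move=> z; exact: cvg_id.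
  move=> [c _]; elim/(@pi1_ind R E e0): c => g; rewrite pi1_mapE => /pi1_classE gf.
  rewrite -(monodromy_homotopic gf); apply: monodromyE (lmap g) _.
  by rewrite loop1 act1.
- apply/seteqP; split => // a _.
  (* A path upstairs from [e0] to [act a e0] projects to a loop with monodromy [a]. *)
  have [f [cf f0 f1]] := E_path (act a e0).
  have qf0 : (q \o f) 0 = x0 by rewrite /= f0.
  have qf1 : (q \o f) 1 = x0 by rewrite /= f1 q_act.
  have cqf : {within I, continuous (q \o f)}.
    apply: (within_comp (B := setT)) cf _ _ => //; exact: continuous_subspaceT.
  exists (pi1_class (Loop cqf qf0 qf1)) => //.
  by rewrite pi1_monodromyE; apply: (@monodromyE _ f).
Qed.

End Covering.

(** * Steinberg's fixed point theorem *)

Section SimpleRoots.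
Context {K : numFieldType} {L : lieAlgebraType K} {t : {vspace L}}.
Local Notation T := (subvs_of t).
Implicit Types (a b c : linform t) (h : T) (w : GL T).
Hypothesis tc : cartan_subalgebra t.
Hypothesis L_red : reductive_lie L.
Local Notation Phi := (lie_roots fullv t).

Let W_sub : is_subgroup (weyl t). Proof. exact: gen_subgroup_sub. Qed.

Definition cor a : T :=
  if pselect (exists h, coroot a h) is left e then sval (cid e) else 0.

Lemma corP a : Phi a -> coroot a (cor a).
Proof.
move=> /(coroot_exists tc L_red) ex; rewrite /cor; case: pselect => // e.
by case: (cid e).
Qed.

Definition refl a : GL T :=
  if pselect (exists w : GL T, forall v : T, w v = v - (a v : K) *: cor a) is left e
  then sval (cid e) else 1%g.

Lemma reflE a (v : T) : Phi a -> refl a v = v - (a v : K) *: cor a.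
Proof.
move=> /corP /coroot2 /reflection_ex ex; rewrite /refl; case: pselect => // e.
by case: (cid e) => /= w wE; exact: wE.
Qed.

Lemma refl_weyl a : Phi a -> weyl t (refl a).
Proof.
move=> Ra H sH SH; apply: SH; exists a => //; exists (cor a); first exact: corP.
by move=> v; exact: reflE.
Qed.

Lemma cor2 a : Phi a -> a (cor a) = 2%:R :> K.
Proof. by move=> /corP /coroot2. Qed.

Lemma root_neq0 a : Phi a -> a != 0. Proof. by case. Qed.

Lemma root_weight a : Phi a -> is_weight a.
Proof. by move/lie_rootsP => []. Qed.

Lemma weight_root a : is_weight a -> a != 0 -> Phi a.
Proof. by move=> wa a0; apply/lie_rootsP; split. Qed.

Lemma scale_linform a (k : K) v : (k *: a) v = k * a v :> K.
Proof. by rewrite scale_lfunE. Qed.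

Lemma pullMn a w n : pull (a *+ n) w = pull a w *+ n.
Proof. by apply/lfunP => v; rewrite pullE !muln_lfunE' pullE. Qed.

Lemma pull_sum (I : Type) (s : seq I) (F : I -> linform t) w :
  pull (\sum_(i <- s) F i) w = \sum_(i <- s) pull (F i) w.
Proof.
apply/lfunP => v; rewrite pullE !sum_lfunE; apply: eq_bigr => i _.
by rewrite pullE.
Qed.

Lemma pull_refl a b : Phi a -> pull b (refl a) = b - (b (cor a) : K) *: a.
Proof. by move=> Ra; apply: pull_reflection => v; exact: reflE. Qed.

Lemma pull_refl_self a : Phi a -> pull a (refl a) = - a.
Proof.
move=> Ra; rewrite pull_refl // cor2 //.
by rewrite scaler_nat mulr2n opprD addrA subrr add0r.
Qed.

Lemma reflV a : Phi a -> ((refl a)^-1 = refl a)%g.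
Proof. by move=> Ra; apply: (reflection_invol (cor2 Ra)) => v; exact: reflE. Qed.

Lemma reflK a : Phi a -> (refl a * refl a = 1)%g.
Proof. by move=> Ra; rewrite -{1}(reflV Ra) mulVg. Qed.

Lemma rootN a : Phi a -> Phi (- a).
Proof.
move=> Ra; rewrite -(pull_refl_self Ra).
exact: (weyl_root tc (refl_weyl Ra) Ra).
Qed.

Lemma cor_unique a k w : Phi a -> a k = 2%:R :> K -> vsval k \in @lie_derived K L ->
  (forall v : T, w v = v - (a v : K) *: k) -> weyl t w -> refl a = w.
Proof.
move=> Ra ak kD wE Ww.
have kE : cor a = k.
  apply: (coroot_unique tc L_red (corP Ra) (root_neq0 Ra) ak kD wE) => b Rb.
  exact: (weyl_root tc Ww Rb).
by apply/val_inj/lfunP => v; rewrite [LHS](reflE v Ra) [RHS]wE kE.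
Qed.

(** Multiples of a root other than its opposite have not been ruled out; they are dealt with through
    their common reflection. *)
Lemma refl_scale a (k : K) : Phi a -> Phi (k *: a) -> refl (k *: a) = refl a.
Proof.
move=> Ra Rka; have k0 : k != 0.
  by apply: contraTneq (root_neq0 Rka) => ->; rewrite scale0r eqxx.
apply: (cor_unique (k := k^-1 *: cor a) Rka).
- by rewrite linformZ scale_linform cor2 // mulKf.
- by rewrite linearZ memvZ // (coroot_derived (corP Ra)).
- move=> v; rewrite reflE // scale_linform scalerA; congr (_ - _ *: _).
  by rewrite mulrAC mulfV // mul1r.
- exact: refl_weyl.
Qed.

Lemma refl_conj b w : Phi b -> weyl t w -> refl (pull b w) = (w^-1 * refl b * w)%g.
Proof.
move=> Rb Ww; have Rbw := weyl_root tc Ww Rb.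
apply: (cor_unique (k := (w^-1)%g (cor b)) Rbw).
- by rewrite pullE GLKV cor2.
- rewrite -[X in vsval X](subrK (cor b)) linearD memvD //; last exact: coroot_derived (corP Rb).
  by apply: weyl_derived; exact: (subgroupV W_sub).
- move=> v; rewrite (GLME (w^-1 * refl b)%g) (GLME (w^-1)%g) reflE // linearB linearZ /=.
  by rewrite GLK pullE.
- apply: (subgroupM W_sub) => //; apply: (subgroupM W_sub); last exact: refl_weyl.
  exact: (subgroupV W_sub).
Qed.

Lemma root_list : exists2 rs : seq (linform t), uniq rs & forall a, a \in rs <-> Phi a.
Proof.
have [ws wsP] := weight_finite tc.
exists [seq a <- undup ws | `[< Phi a >]]; first by rewrite filter_uniq ?undup_uniq.
move=> a; rewrite mem_filter mem_undup; split; first by move=> /andP[/asboolP].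
by move=> Ra; rewrite asboolT //= wsP //; exact: root_weight.
Qed.

Lemma root_string a b : Phi a -> Phi b -> exists n : nat,
  (b (cor a) = n%:R :> K /\ forall k, (k <= n)%N -> is_weight (b - a *+ k)) \/
  (b (cor a) = - n%:R :> K /\ forall k, (k <= n)%N -> is_weight (b + a *+ k)).
Proof.
move=> /corP[e [f [/root_spaceP we /root_spaceP wf hE ah]]] Rb.
exact: (weight_string tc we wf hE ah (root_weight Rb)).
Qed.

Lemma root_cor_real a b : Phi a -> Phi b -> (b (cor a) : K) \is Num.real.
Proof.
move=> Ra Rb; have [n [[-> _]|[-> _]]] := root_string Ra Rb; first exact: realn.
by rewrite rpredN realn.
Qed.

(** The sum [B] of [c(x) c(y)] over the roots is Weyl-invariant and gives [a(x) B(h, h) = 2 B(h, x)]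
    for the coroot [h] of [a]. Pairings of roots with coroots are real, so [B(h, h) > 0], and the
    two pairings differ by a ratio of such numbers. *)
Lemma root_pairing_sym a b : Phi a -> Phi b -> exists2 k : K, 0 < k &
  b (cor a) = k * a (cor b) :> K.
Proof.
move=> Ra Rb; have [rs us rsP] := root_list.
pose B (x y : T) : K := \sum_(c <- rs) (c x : K) * c y.
have Bs a' (x y : T) : Phi a' -> B (refl a' x) (refl a' y) = B x y.
  move=> Ra'; rewrite /B.
  have pe : perm_eq [seq pull c (refl a') | c <- rs] rs.
    have inj : injective (fun c => pull c (refl a')).
      by move=> c d cd; rewrite -[c]pull1 -[d]pull1 -(reflK Ra') !pullM cd.
    apply: uniq_perm; rewrite ?map_inj_uniq // => c; apply/mapP/idP.
      by move=> [d /rsP Rd ->]; apply/rsP; exact: (weyl_root tc (refl_weyl Ra') Rd).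
    move=> /rsP Rc; exists (pull c (refl a')).
      by apply/rsP; exact: (weyl_root tc (refl_weyl Ra') Rc).
    by rewrite -pullM (reflK Ra') pull1.
  rewrite -[RHS](perm_big _ pe) big_map; apply: eq_bigr => c _ /=.
  by rewrite !pullE.
have BD x y z (k : K) : B x (y + k *: z) = B x y + k * B x z.
  rewrite /B mulr_sumr -big_split; apply: eq_bigr => c _ /=.
  by rewrite [y + _]addrC linformP mulrDr mulrCA addrC.
have BC x y : B x y = B y x.
  by apply: eq_bigr => c _; exact: mulrC.
have rcor a' : Phi a' -> refl a' (cor a') = - cor a'.
  move=> Ra'; rewrite reflE // cor2 // scaler_nat mulr2n opprD addrA.
  by rewrite subrr add0r.
have BE a' x : Phi a' -> (a' x : K) * B (cor a') (cor a') = 2 * B (cor a') x.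
  move=> Ra'; have := Bs a' (cor a') x Ra'; rewrite rcor // reflE // -scaleNr BD.
  have BN y z : B (- y) z = - B y z.
    by rewrite /B -sumrN; apply: eq_bigr => c _; rewrite linearN mulNr.
  rewrite !BN => /eqP; rewrite mulrNN addrC -subr_eq0 => /eqP e.
  apply/eqP; rewrite -subr_eq0 -[X in _ == X]e; apply/eqP; ring.
have Bpos a' : Phi a' -> 0 < B (cor a') (cor a').
  move=> Ra'; rewrite /B (bigD1_seq a') ?rsP //=.
  rewrite ltr_wpDr ?cor2 ?mulr_gt0 // big_seq_cond sumr_ge0 // => c /andP[/rsP Rc _].
  by rewrite -expr2 -realEsqr; exact: root_cor_real.
exists (B (cor a) (cor a) / B (cor b) (cor b)).
  by rewrite divr_gt0 // Bpos.
have b0 : B (cor b) (cor b) != 0 by rewrite gt_eqF ?Bpos.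
apply: (mulIf b0); rewrite (BE b _ Rb) BC -(BE a _ Ra) mulrAC -mulrA.
by rewrite mulrA divfK // mulrC.
Qed.

Section Positive.
Context (pos : linform t -> bool).
Hypothesis posD : forall a b, pos a -> pos b -> pos (a + b).
Hypothesis posN : forall a, pos a -> ~~ pos (- a).
Hypothesis pos_total : forall a, a != 0 -> pos a || pos (- a).

Lemma pos0 : ~~ pos 0.
Proof. by apply/negP => p0; move/negP: (posN p0); rewrite oppr0. Qed.

Lemma posMn a n : pos a -> pos (a *+ n.+1).
Proof. by move=> pa; elim: n => // n IHn; rewrite mulrS; exact: posD. Qed.

Lemma neg_root a : Phi a -> ~~ pos a -> pos (- a).
Proof. by move=> /root_neq0 /pos_total /orP[->|]. Qed.

Definition simple_root a := Phi a /\ pos a /\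
  forall b c, Phi b -> pos b -> Phi c -> pos c -> a != b + c.

(** Well-founded induction for the order in which [c] precedes [b] when [b - c] is positive; the
    number of roots preceding [b] is the measure. *)
Lemma pos_root_ind (P : linform t -> Prop) :
  (forall b, Phi b -> pos b ->
     (forall c, Phi c -> pos c -> pos (b - c) -> P c) -> P b) ->
  forall b, Phi b -> pos b -> P b.
Proof.
move=> IH; have [rs us rsP] := root_list.
pose m b := size [seq c <- rs | pos (b - c)].
suff main n b : (m b < n)%N -> Phi b -> pos b -> P b by move=> b; exact: main.
elim: n b => // n IHn b mb Rb pb; apply: IH => // c Rc pc pbc; apply: IHn => //.
rewrite ltnS in mb; apply: leq_trans mb; rewrite /m.
apply: (@uniq_leq_size _ (c :: [seq d <- rs | pos (c - d)])).
  by rewrite /= filter_uniq // mem_filter subrr (negPf pos0).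
move=> d; rewrite inE => /predU1P[->|]; rewrite !mem_filter.
  by rewrite pbc; apply/rsP.
by move=> /andP[pcd ->]; rewrite andbT -(subrKA c) posD.
Qed.

Lemma pos_root_simple_sum b : Phi b -> pos b -> exists l : seq (linform t),
  (forall a, a \in l -> simple_root a) /\ b = \sum_(a <- l) a.
Proof.
move: b; apply: pos_root_ind => b Rb pb IH.
have [sb|nsb] := pselect (simple_root b).
  by exists [:: b]; split => [a|]; rewrite ?big_seq1 // inE => /eqP ->.
have [c [d [Rc pc [Rd pd bE]]]] : exists c d,
    [/\ Phi c, pos c & [/\ Phi d, pos d & b = c + d]].
  apply: contrapT => nex; apply: nsb; split => //; split => // c d Rc pc Rd pd.
  by apply/eqP => bE; apply: nex; exists c, d.
have [|l1 [s1 cE]] := IH c Rc pc; first by rewrite bE addrC addKr.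
have [|l2 [s2 dE]] := IH d Rd pd; first by rewrite bE addrK.
exists (l1 ++ l2); split; last by rewrite big_cat /= -cE -dE.
by move=> a; rewrite mem_cat => /orP[]; [exact: s1|exact: s2].
Qed.

(** Along the string [b - k a] every term is a root. If the sign changed between consecutive terms,
    [a] would be the sum of the earlier one and the opposite of the later one, both positive,
    against simplicity. *)
Lemma simple_refl_pos a b : simple_root a -> Phi b -> pos b ->
  (forall k : K, b != k *: a) -> pos (pull b (refl a)).
Proof.
move=> [Ra [pa sa]] Rb pb nprop; rewrite pull_refl //.
have [n [[-> nw]|[-> nw]]] := root_string Ra Rb; last first.
  rewrite scaleNr opprK scaler_nat; case: n {nw} => [|n]; first by rewrite mulr0n addr0.
  by apply: posD => //; exact: posMn.
rewrite scaler_nat; elim: n nw => [|n IHn] nw; first by rewrite mulr0n subr0.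
have {}IHn : pos (b - a *+ n) by apply: IHn => k kn; apply: nw; exact: leqW.
have Rk k : (k <= n.+1)%N -> Phi (b - a *+ k).
  move=> kn; apply: (weight_root (nw k kn)); rewrite subr_eq0.
  by rewrite -scaler_nat; exact: nprop.
apply: contraT => /(neg_root (Rk _ (leqnn _))) pn.
have := sa _ _ (Rk n (leqnSn n)) IHn (rootN (Rk _ (leqnn _))) pn.
by rewrite mulrS opprB [_ - b]addrC addrACA subrr add0r addrCA addNr addr0 eqxx.
Qed.

Lemma pos_Mn a n : a != 0 -> pos (a *+ n.+1) = pos a.
Proof.
move=> /pos_total; case: (boolP (pos a)) => [pa _|_ /= pNa]; first exact: posMn.
by apply/negbTE; have := posN (posMn n pNa); rewrite mulNrn opprK.
Qed.

Lemma proportional_pos a b (k : K) w : Phi a -> pos a -> Phi b -> pos b -> b = k *: a ->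
  pos (pull b w) = pos (pull a w).
Proof.
move=> Ra pa Rb pb bE.
have k2 : b *+ 2 = (b (cor a) : K) *: a.
  by rewrite bE scale_linform cor2 // mulr_natr scalerMnl.
have p2 : pos (b *+ 2) by exact: posMn.
have [n bn] : exists n : nat, b *+ 2 = a *+ n.+1.
  have [[|n] [[e _]|[e _]]] := root_string Ra Rb.
  - by move: p2; rewrite k2 e scale0r (negPf pos0).
  - by move: p2; rewrite k2 e oppr0 scale0r (negPf pos0).
  - by exists n; rewrite k2 e scaler_nat.
  - have := posN (posMn n pa); move: p2; rewrite k2 e scaleNr scaler_nat.
    by move=> ->.
have nz c : Phi c -> pull c w != 0 by move=> /root_neq0; rewrite pull_eq0.
by rewrite -(pos_Mn 1 (nz _ Rb)) -pullMn bn pullMn pos_Mn // nz.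
Qed.

Definition word (l : seq (linform t)) : GL T := foldr (fun a w => (refl a * w)%g) 1%g l.

Lemma word_cat l1 l2 : word (l1 ++ l2) = (word l1 * word l2)%g.
Proof. by elim: l1 => [|a l IHl] /=; rewrite ?mul1g // IHl mulgA. Qed.

(** Since [b(cor b) = 2], some simple summand [a] of [b] is positive on [cor b]; by
    [root_pairing_sym], [b] is then positive on [cor a]. *)
Lemma simple_pairing_pos b : Phi b -> pos b -> exists a (n : nat),
  [/\ simple_root a, b (cor a) = n.+1%:R :> K & forall k, (k <= n.+1)%N -> is_weight (b - a *+ k)].
Proof.
move=> Rb pb; have [l [sl bE]] := pos_root_simple_sum Rb pb.
have [a al ab] : exists2 a, a \in l & 0 < a (cor b) :> K.
  apply: contrapT => na; have := cor2 Rb; rewrite {1}bE sum_lfunE => e.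
  suff : \sum_(a <- l) (a (cor b) : K) <= 0.
    by rewrite [X in X <= _]e lern0.
  rewrite big_seq; apply: sumr_le0 => a al; have [Ra _] := sl a al.
  by rewrite real_leNgt ?real0 ?root_cor_real //; apply/negP => pab; apply: na; exists a.
have [Ra _] := sl a al; have [k k0 bk] := root_pairing_sym Ra Rb.
have ba : 0 < b (cor a) :> K by rewrite bk mulr_gt0.
have [[|n] [[e nw]|[e nw]]] := root_string Ra Rb.
- by move: ba; rewrite e ltxx.
- by move: ba; rewrite e oppr0 ltxx.
- by exists a, n; split => //; exact: sl.
- by move: ba; rewrite e oppr_gt0 ltrn0.
Qed.

(** Reflecting [b] in the simple root [a] of [simple_pairing_pos] gives a smaller positive root [c],
    and [refl b] is the conjugate of [refl c] by [refl a]. If [b] is proportional to [a], the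
    reflections coincide. *)
Lemma refl_word b : Phi b -> pos b ->
  exists2 l, (forall a, a \in l -> simple_root a) & refl b = word l.
Proof.
move: b; apply: pos_root_ind => b Rb pb IH.
have [a [n [sa ban bw]]] := simple_pairing_pos Rb pb; have [Ra [pa _]] := sa.
have [[k bk]|nprop] := pselect (exists k : K, b = k *: a).
  exists [:: a]; first by move=> c; rewrite inE => /eqP ->.
  by rewrite /= mulg1 bk; apply: refl_scale => //; rewrite -bk.
have nprop' (k : K) : b != k *: a by apply/eqP => bk; apply: nprop; exists k.
pose c := pull b (refl a).
have Rc : Phi c by exact: (weyl_root tc (refl_weyl Ra) Rb).
have pc : pos c by exact: simple_refl_pos.
have [|l sl cl] := IH c Rc pc.
  by rewrite /c pull_refl // ban scaler_nat opprB addrC subrK; exact: posMn.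
exists (a :: l ++ [:: a]).
  by move=> d; rewrite inE mem_cat inE => /or3P[/eqP ->//|/sl//|/eqP ->].
rewrite /= word_cat -cl /c refl_conj //; last exact: refl_weyl.
by rewrite /= reflV // mulg1 !mulgA reflK // mul1g -mulgA reflK // mulg1.
Qed.

Lemma weyl_word w : weyl t w ->
  exists2 l, (forall a, a \in l -> simple_root a) & w = word l.
Proof.
pose H : set (GL T) := [set w : GL T |
  exists2 l, (forall a, a \in l -> simple_root a) & w = word l].
move=> Ww; apply: (Ww H) => [|u [a Ra [h ah uE]]].
  split; first by exists [::].
    move=> _ _ [l1 s1 ->] [l2 s2 ->]; exists (l1 ++ l2); last by rewrite word_cat.
    by move=> a; rewrite mem_cat => /orP[/s1|/s2].
  move=> _ [l sl ->]; exists (rev l); first by move=> a; rewrite mem_rev; exact: sl.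
  elim: l sl => [|a l IHl] sl; first by rewrite /= invg1.
  have [Ra _] := sl a (mem_head _ _).
  rewrite rev_cons -cats1 word_cat /= mulg1 invgM reflV //; congr (_ * _)%g.
  by apply: IHl => b bl; apply: sl; rewrite inE bl orbT.
have uw : weyl t u by move=> G sG; apply; exists a => //; exists h.
have -> : u = refl a.
  apply/esym; apply: (cor_unique Ra (coroot2 ah) (coroot_derived ah) uE uw).
have [pa|pa] := boolP (pos a); first exact: refl_word.
have [l sl la] := refl_word (rootN Ra) (neg_root Ra pa).
exists l => //; rewrite -la -scaleN1r; apply/esym; apply: refl_scale => //.
by rewrite scaleN1r; exact: rootN.
Qed.

(* Deletion: if a word sends the positive root c to a negative one, multiplying
   it by the reflection in c removes one of its letters. *)
Lemma word_deletion c l : Phi c -> pos c -> (forall a, a \in l -> simple_root a) ->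
  ~~ pos (pull c (word l)) -> exists l', [/\ (forall a, a \in l' -> simple_root a),
    (refl c * word l)%g = word l' & (size l').+1 = size l].
Proof.
elim: l c => [|a l IHl] c Rc pc sl; first by rewrite pull1 pc.
have sa := sl a (mem_head _ _); have [Ra [pa _]] := sa.
have {}sl b : b \in l -> simple_root b by move=> bl; apply: sl; rewrite inE bl orbT.
rewrite pullM => neg; have [[k ck]|nprop] := pselect (exists k : K, c = k *: a).
  exists l; split => //=.
  by rewrite mulgA ck refl_scale -?ck // reflK // mul1g.
have nprop' (k : K) : c != k *: a by apply/eqP => ck; apply: nprop; exists k.
have Rc' : Phi (pull c (refl a)) by exact: (weyl_root tc (refl_weyl Ra) Rc).
have [l' [sl' e sz]] := IHl _ Rc' (simple_refl_pos sa Rc pc nprop') sl neg.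
exists (a :: l'); split => /=; last by rewrite sz.
  by move=> b; rewrite inE => /predU1P[->//|/sl'].
rewrite -e refl_conj //; last exact: refl_weyl.
by rewrite reflV // !mulgA reflK // mul1g.
Qed.

(** Induction on the length of a word: if it begins with [a], positivity of the image of [a] means
    that the rest of the word makes [a] negative, and deletion gives a shorter word for [w]. *)
Lemma weyl_pos_trivial w : weyl t w ->
  (forall b, Phi b -> pos b -> pos (pull b w)) -> w = 1%g.
Proof.
move=> /weyl_word[l]; have [n] := ubnP (size l).
elim: n l w => // n IHn [//|a l] w szl sl -> wpos /=.
have [Ra [pa _]] := sl a (mem_head _ _).
have sl1 b : b \in l -> simple_root b by move=> bl; apply: sl; rewrite inE bl orbT.
have [|l' [sl' e sz]] := word_deletion Ra pa sl1.
  have := wpos a Ra pa; rewrite /= pullM pull_refl_self // pullN => /posN.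
  by rewrite opprK.
have e' : word (a :: l) = word l' by [].
rewrite e; apply: (IHn l') => //; last by move=> b Rb pb; rewrite -e'; exact: wpos.
by move: szl; rewrite /= ltnS -sz => /ltnW.
Qed.

(** Induction on the number of positive roots that [w] makes negative. A simple root [a] among them
    vanishes on [X] by the hypothesis on [pos], so [refl a] fixes [X] and [v], and [refl a * w] has
    fewer inversions. *)
Lemma weyl_fix_pos (X : T -> Prop) w (v : T) :
  (forall a w', pos a -> ~~ pos (pull a w') -> (forall x, X x -> w' x = x) ->
     forall x, X x -> a x = 0) ->
  weyl t w -> (forall x, X x -> w x = x) ->
  (forall a, Phi a -> (forall x, X x -> a x = 0) -> a v = 0) -> w v = v.
Proof.
move=> posX; have [rs us rsP] := root_list.
pose N w := [seq b <- rs | pos b && ~~ pos (pull b w)].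
have [n] := ubnP (size (N w)).
elim: n w => // n IHn w Nw Ww wX av.
have [[a [sa na]]|nn] := pselect (exists a, simple_root a /\ ~~ pos (pull a w)); last first.
  suff -> : w = 1%g by exact: GL1E.
  apply: weyl_pos_trivial => // b Rb pb.
  have [l [sl bE]] := pos_root_simple_sum Rb pb.
  have pl a : a \in l -> pos (pull a w).
    move=> al; apply: contraT => na; case: nn; exists a; split => //; exact: sl.
  case: l bE sl pl => [b0|a l]; first by move: pb; rewrite b0 big_nil (negPf pos0).
  move=> -> _ pl; rewrite pull_sum big_cons.
  have : pos (pull a w) by apply: pl; exact: mem_head.
  have {pl} : forall b, b \in l -> pos (pull b w).
    by move=> b' bl; apply: pl; rewrite inE bl orbT.
  elim: l (pull a w) => [|c l IHl] d pl pd; first by rewrite big_nil addr0.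
  rewrite big_cons addrA; apply: IHl => [b' bl|]; first by apply: pl; rewrite inE bl orbT.
  by apply: posD => //; apply: pl; exact: mem_head.
have [Ra [pa _]] := sa; have aX := posX _ _ pa na wX.
have wE : w = (refl a * (refl a * w))%g by rewrite mulgA reflK // mul1g.
have sX x : X x -> refl a x = x by move=> Xx; rewrite reflE // aX // scale0r subr0.
have Wsw : weyl t (refl a * w)%g by exact: (subgroupM W_sub (refl_weyl Ra) Ww).
have swX x : X x -> (refl a * w)%g x = x by move=> Xx; rewrite GLME wX // sX.
have swv : (refl a * w)%g v = v.
  apply: IHn => //; rewrite ltnS in Nw; apply: leq_trans Nw.
  rewrite -(size_map (fun b => pull b (refl a))).
  (* [refl a] carries the inversions of [refl a * w] injectively into those of [w], missing [a]. *)
  apply: (@uniq_leq_size _ (a :: _)).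
    rewrite /= map_inj_uniq ?filter_uniq //; last first.
      by move=> c d cd; rewrite -[c]pull1 -[d]pull1 -(reflK Ra) !pullM cd.
    rewrite andbT; apply/mapP => -[b]; rewrite mem_filter => /andP[/andP[pb _] _] ab.
    have : b = - a by rewrite -(pull_refl_self Ra) {1}ab -pullM reflK // pull1.
    by move=> bE; move: pb; rewrite bE; apply/negP; exact: posN.
  move=> c; rewrite inE => /predU1P[->|/mapP[b]].
    by rewrite mem_filter pa na /=; apply/rsP.
  rewrite !mem_filter => /andP[/andP[pb nb] /rsP Rb] ->.
  have Rbs : Phi (pull b (refl a)) by exact: (weyl_root tc (refl_weyl Ra) Rb).
  rewrite -pullM nb andbT; apply/andP; split; last exact/rsP.
  apply: simple_refl_pos => // k; apply/eqP => bk; move/negP: nb; apply.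
  rewrite (proportional_pos _ Ra pa Rb pb bk) pullM pull_refl_self // pullN.
  by apply: neg_root => //; exact: (weyl_root tc Ww Ra).
transitivity ((refl a * (refl a * w))%g v); first by rewrite -wE.
by rewrite [LHS](GLME (refl a)) swv reflE // av // scale0r subr0.
Qed.

End Positive.
End SimpleRoots.

(** * A lexicographic positivity on complex linear forms *)

Section LexicographicPositivity.
Context {R : realType} {L : lieAlgebraType R[i]} {t : {vspace L}}.
Local Notation T := (subvs_of t).
Implicit Types (a b : linform t) (us : seq T).
Local Notation Phi := (lie_roots fullv t).

(** Lexicographic order on real and imaginary parts: total and compatible with addition, which is
    all that a positivity asks, so roots may take non-real values on the fixed vectors. *)
Definition cpos (c : R[i]) : bool :=
  (0 < complex.Re c) || ((complex.Re c == 0) && (0 < complex.Im c)).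

Lemma cposD c d : cpos c -> cpos d -> cpos (c + d).
Proof.
rewrite /cpos; case: c d => [x y] [x' y'] /=.
move=> /orP[x0|/andP[/eqP -> y0]] /orP[x0'|/andP[/eqP -> y0']].
- by rewrite addr_gt0.
- by rewrite addr0 x0.
- by rewrite add0r x0'.
- by rewrite addr0 eqxx addr_gt0 // orbT.
Qed.

Lemma cposN c : cpos c -> ~~ cpos (- c).
Proof.
rewrite /cpos; case: c => [x y] /=; rewrite !oppr_gt0 oppr_eq0.
move=> /orP[x0|/andP[/eqP -> y0]].
  by rewrite negb_or -leNgt ltW //= gt_eqF.
by rewrite ltxx eqxx /= -leNgt ltW.
Qed.

Lemma cpos_total c : c != 0 -> cpos c || cpos (- c).
Proof.
rewrite /cpos; case: c => [x y] /=; rewrite !oppr_gt0 oppr_eq0 eq_complex /=.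
by case: (ltgtP x 0) => //=; case: (ltgtP y 0).
Qed.

Fixpoint lexpos us a : bool :=
  if us is u :: us' then cpos (a u) || ((a u == 0) && lexpos us' a) else false.

Lemma cpos_neq0 c : cpos c -> c != 0.
Proof. by move=> pc; apply/eqP => c0; move/negP: (cposN pc); rewrite c0 oppr0 -c0. Qed.

Lemma lexposD us a b : lexpos us a -> lexpos us b -> lexpos us (a + b).
Proof.
elim: us => //= u us IHus; rewrite add_lfunE.
move=> /orP[pa|/andP[/eqP -> la]] /orP[pb|/andP[/eqP -> lb]].
- by rewrite cposD.
- by rewrite addr0 pa.
- by rewrite add0r pb.
- by rewrite addr0 eqxx IHus // orbT.
Qed.

Lemma lexposN us a : lexpos us a -> ~~ lexpos us (- a).
Proof.
elim: us => //= u us IHus; rewrite opp_lfunE oppr_eq0.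
move=> /orP[pa|/andP[/eqP -> la]].
  by rewrite negb_or cposN //= (negPf (cpos_neq0 pa)).
rewrite eqxx /= negb_or IHus // andbT oppr0.
by apply/negP => /cpos_neq0; rewrite eqxx.
Qed.

Lemma lexpos_total us a : (exists2 u, u \in us & a u != 0) -> lexpos us a || lexpos us (- a).
Proof.
elim: us => [[u]//|u us IHus] /= [x]; rewrite inE opp_lfunE oppr_eq0.
have [au|au _ _] := eqVneq (a u) 0.
  move=> /predU1P[->|xus ax]; first by rewrite au eqxx.
  by have /orP[->|->] := IHus (ex_intro2 _ _ x xus ax); rewrite !orbT.
by have /orP[->|->] := cpos_total au; rewrite ?orbT.
Qed.

Lemma lexpos_catl us us' a : lexpos us a -> lexpos (us ++ us') a.
Proof.
elim: us => //= u us IHus /orP[->//|/andP[-> /IHus ->]].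
by rewrite orbT.
Qed.

Lemma lexpos_cat0 us us' a : ~~ lexpos us a -> lexpos (us ++ us') a ->
  forall x, x \in us -> a x = 0.
Proof.
elim: us => //= u us IHus; rewrite negb_or => /andP[/negPf -> /=].
case: eqP => //= au nl l x; rewrite inE => /predU1P[-> //|]; exact: IHus.
Qed.

Lemma eq_lexpos us a b : {in us, a =1 b} -> lexpos us a = lexpos us b.
Proof.
elim: us => //= u us IHus ab; rewrite ab ?mem_head // IHus // => x xu.
by apply: ab; rewrite inE xu orbT.
Qed.

Hypothesis tc : cartan_subalgebra t.
Hypothesis L_red : reductive_lie L.

(* Positivity is tested on us first, so that w, fixing us, changes the sign of no
   root that is nonzero on us; the simple reflections in a reduced word for w are
   then in roots vanishing on us. *)
Lemma weyl_fix us (w : GL T) (v : T) : weyl t w -> {in us, forall x, w x = x} ->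
  (forall a, Phi a -> {in us, forall x, a x = 0} -> a v = 0) -> w v = v.
Proof.
pose pos := lexpos (us ++ vbasis {:T}).
have posD a b : pos a -> pos b -> pos (a + b) by exact: lexposD.
have posN a : pos a -> ~~ pos (- a) by exact: lexposN.
have pos_total a : a != 0 -> pos a || pos (- a).
  move=> a0; apply: lexpos_total; apply: contrapT => na; case/eqP: a0.
  apply/lfunP => x; rewrite zero_lfunE (coord_vbasis (memvf x)) linear_sum big1 // => i _.
  rewrite linearZ /=; have -> : a (vbasis {:T})`_i = 0; last by rewrite scaler0.
  apply/eqP/negPn/negP => ai; apply: na; exists (vbasis {:T})`_i => //.
  by rewrite mem_cat mem_nth ?orbT // size_tuple.
apply: (weyl_fix_pos tc L_red posD posN pos_total (X := fun x => x \in us)).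
move=> a w' pa na w'X x xus; apply: (lexpos_cat0 _ pa) xus.
apply: contra na => la; apply: lexpos_catl.
by rewrite -(eq_lexpos (a := a)) // => y yus; rewrite pullE w'X.
Qed.

End LexicographicPositivity.

(** * Topology of finite-dimensional vector spaces *)

Section VTop.
Context {K : numFieldType}.

Lemma sum_continuous (X : topologicalType) (V : normedModType K) (I : Type) (s : seq I)
    (F : I -> X -> V) : (forall i, continuous (F i)) ->
  continuous (fun x => \sum_(i <- s) F i x).
Proof.
move=> cF x; elim: s => [|i s IHs].
  rewrite (_ : (fun x => _) = cst 0); last by apply/funext => y; rewrite big_nil.
  exact: cvg_cst.
rewrite (_ : (fun x => _) = (fun x => F i x + \sum_(j <- s) F j x)); last first.
  by apply/funext => y; rewrite big_cons.
by apply: cvgD; [exact: cF|exact: IHs].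
Qed.

Lemma linear_rV_continuous n m (g : {linear 'rV[K]_n -> 'rV[K]_m}) : continuous g.
Proof.
rewrite (_ : (g : _ -> _) = fun x => \sum_(j <- index_enum 'I_n) x 0 j *: g (delta_mx 0 j)).
  by apply: sum_continuous => j x; exact: cvgZr_tmp (@coord_continuous K 1 n 0 j x).
apply/funext => x; rewrite {1}[x]row_sum_delta linear_sum; apply: eq_bigr => j _.
by rewrite linearZ.
Qed.

Import VectorInternalTheory.

Lemma v2r_continuous (V : vectType K) : continuous (v2r : vtop V -> 'rV[K]_(dim V)).
Proof. exact: initial_continuous. Qed.

Lemma vtop_continuous (X : topologicalType) (V : vectType K) (F : X -> vtop V) :
  continuous (v2r \o F : X -> 'rV[K]_(dim V)) -> continuous F.
Proof. by move=> cF; apply: continuous_comp_initial. Qed.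

Lemma linear_vtop_continuous (V W : vectType K) (g : {linear V -> W}) :
  continuous (g : vtop V -> vtop W).
Proof.
apply: vtop_continuous => x.
rewrite (_ : v2r \o g = (v2r \o g \o r2v) \o v2r); last first.
  by apply/funext => y /=; rewrite v2rK.
apply: (@continuous_comp (vtop V) 'rV[K]_(dim V) 'rV[K]_(dim W) v2r (v2r \o g \o r2v)).
  exact: v2r_continuous.
exact: (@linear_rV_continuous _ _ (v2r \o g \o r2v)).
Qed.

Lemma linform_vtop_continuous (V : vectType K) (g : {linear V -> K^o}) :
  continuous (g : vtop V -> K).
Proof.
rewrite (_ : (g : _ -> _) = fun x : vtop V =>
    \sum_(j <- index_enum 'I_(dim V)) (v2r x) 0 j * g (r2v (delta_mx 0 j))).
  apply: (@sum_continuous (vtop V) K) => j x.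
  have c1 : continuous_at x (fun y : vtop V => (v2r y) 0 j).
    apply: (@continuous_comp (vtop V) 'rV[K]_(dim V) K v2r (fun M => M 0 j)).
      exact: v2r_continuous.
    exact: coord_continuous.
  exact: cvgM c1 (cvg_cst _).
apply/funext => x; rewrite -{1}[x]v2rK {1}[v2r x]row_sum_delta !linear_sum.
by apply: eq_bigr => j _; rewrite !linearZ.
Qed.

Lemma vtop_hausdorff (V : vectType K) : hausdorff_space (vtop V).
Proof.
move=> x y xy; apply: (can_inj v2rK); apply: (@norm_hausdorff K 'rV[K]_(dim V)).
move=> A B nA nB; have [z [Az Bz]] := xy _ _ (v2r_continuous nA) (v2r_continuous nB).
by exists (v2r z).
Qed.

Lemma vtop_sum_continuous (X : topologicalType) (V : vectType K) (I : Type) (s : seq I)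
    (F : I -> X -> vtop V) : (forall i, continuous (F i)) ->
  continuous (fun x => \sum_(i <- s) F i x : vtop V).
Proof.
move=> cF; apply: vtop_continuous.
rewrite (_ : _ \o _ = fun x => \sum_(i <- s) v2r (F i x)); last first.
  by apply/funext => x /=; rewrite linear_sum.
apply: sum_continuous => i x.
apply: (@continuous_comp X (vtop V) 'rV[K]_(dim V) (F i) v2r); first exact: cF.
exact: v2r_continuous.
Qed.

Lemma vtop_scale_continuous (X : topologicalType) (V : vectType K) (z : X -> K) (u v : V) :
  continuous z -> continuous (fun x => u + z x *: v : vtop V).
Proof.
move=> cz; apply: vtop_continuous.
rewrite (_ : _ \o _ = fun x => v2r u + z x *: v2r v); last first.
  by apply/funext => x /=; rewrite linearD linearZ.
by move=> x; apply: cvgD; [exact: cvg_cst|apply: cvgZr_tmp; exact: cz].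
Qed.

(** [F] is the sum of its components under the linear coordinate injections; thus the coordinates
    chosen on [{ffun I -> V}] never have to be compared with those on [V]. *)
Lemma vtop_ffun_continuous (X : topologicalType) (V : vectType K) (I : finType)
    (F : X -> {ffun I -> V}) : (forall i, continuous (fun x => F x i : vtop V)) ->
  continuous (F : X -> vtop {ffun I -> V}).
Proof.
move=> cF; pose inj (i : I) (v : V) : {ffun I -> V} := [ffun j => if j == i then v else 0].
have inj_lin i : linear (inj i).
  move=> c u v; apply/ffunP => j; rewrite !ffunE; case: eqP => // _.
  by rewrite scaler0 addr0.
pose injL i : {linear V -> {ffun I -> V}} :=
  HB.pack (inj i) (GRing.isLinear.Build _ _ _ _ _ (inj_lin i)).
rewrite (_ : F = fun x => \sum_(i <- index_enum I) injL i (F x i) : vtop {ffun I -> V}).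
  apply: vtop_sum_continuous => i x.
  apply: (@continuous_comp X (vtop V) (vtop {ffun I -> V}) (fun x => F x i) (injL i)).
    exact: cF.
  exact: linear_vtop_continuous.
apply/funext => x; apply/ffunP => j; rewrite sum_ffunE (bigD1 j) //= ffunE eqxx.
by rewrite big1 ?addr0 // => i; rewrite ffunE eq_sym => /negPf ->.
Qed.

Lemma vtop_proj_continuous (V : vectType K) (I : finType) (i : I) :
  continuous (fun F : vtop {ffun I -> V} => (F : {ffun I -> V}) i : vtop V).
Proof.
have lin : linear (fun F : {ffun I -> V} => F i) by move=> c F G; rewrite !ffunE.
pose pL : {linear {ffun I -> V} -> V} :=
  HB.pack (fun F : {ffun I -> V} => F i) (GRing.isLinear.Build _ _ _ _ _ lin).
exact: (@linear_vtop_continuous {ffun I -> V} V pL).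
Qed.

End VTop.

Section SubtypeTopology.

Lemma set_val_continuous (X : topologicalType) (A : set X) :
  continuous (set_val : A -> X).
Proof. exact: initial_continuous. Qed.

Lemma to_set_continuous (X Y : topologicalType) (A : set X) (F : Y -> A) :
  continuous (fun y => val (F y) : X) -> continuous F.
Proof. by move=> cF; apply: continuous_comp_initial. Qed.

Lemma set_hausdorff (X : topologicalType) (A : set X) :
  hausdorff_space X -> hausdorff_space A.
Proof.
move=> hX x y xy; apply/val_inj/hX => U V nU nV.
by have [z [Uz Vz]] := xy _ _ (set_val_continuous nU) (set_val_continuous nV); exists (val z).
Qed.

Lemma set_nbhsP (X : topologicalType) (A : set X) (x : A) (U : set A) : nbhs x U ->
  exists2 V : set X, open V /\ V (val x) & forall y : A, V (val y) -> U y.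
Proof.
by move=> [_ [/= [W oW <-] Wx] WU]; exists W.
Qed.

End SubtypeTopology.

(** * Admissible deformations *)

Section OuterAutomorphism.
Context {K : numFieldType} {L : lieAlgebraType K} {t : {vspace L}}.
Local Notation T := (subvs_of t).
Local Notation Z := (lie_center L).
Local Notation t' := (t :&: lie_derived)%VS.
Local Notation Phi := (lie_roots fullv t).
Local Notation Phi' := (lie_roots (@lie_derived K L) t').
Hypothesis tc : cartan_subalgebra t.
Hypothesis L_red : reductive_lie L.
Implicit Types (b : linform t) (v : T).

Lemma center_cartan z : z \in Z -> z \in t.
Proof. by move=> zZ; apply: (cartan_maximal tc) => y _; exact: center_bracket. Qed.

Lemma cartan_decomp v : exists (z : subvs_of Z) (y : subvs_of t'),
  vsval v = vsval z + vsval y.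
Proof.
have [z [y [zZ yD vE]]] := center_derived_decomp L_red (vsval v).
have yt : y \in t'.
  rewrite memv_cap yD andbT; have -> : y = vsval v - z by rewrite vE addrC addKr.
  by rewrite memvB ?subvsP ?center_cartan.
by exists (Subvs zZ), (Subvs yt).
Qed.

Definition res b : linform t' := linfun (b \o vsproj t \o vsval).

Lemma resE b y : res b y = b (vsproj t (vsval y)).
Proof. by rewrite lfunE. Qed.

Lemma vsproj_decomp v (z : subvs_of Z) (y : subvs_of t') :
  vsval v = vsval z + vsval y -> v = vsproj t (vsval z) + vsproj t (vsval y).
Proof.
move=> vE; apply/val_inj; rewrite [RHS]linearD /= !vsprojK //; last exact: center_cartan (subvsP z).
by have := subvsP y; rewrite memv_cap => /andP[].
Qed.

Lemma cartan'_mem (y : subvs_of t') : vsval y \in t.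
Proof. by have := subvsP y; rewrite memv_cap => /andP[]. Qed.

(** The centre acts by zero on a root vector [e], and [e] is a multiple of some [[h, e]], hence lies
    in the derived algebra. This carries the hypothesis on [phi'], stated for the roots of the
    derived algebra, over to those of [L]. *)
Lemma res_root b : Phi b <->
  Phi' (res b) /\ forall z : subvs_of Z, b (vsproj t (vsval z)) = 0.
Proof.
split.
- move=> /lie_rootsP[b0 [e we e0]].
  have bz (z : subvs_of Z) : b (vsproj t (vsval z)) = 0.
    have := we (vsproj t (vsval z)); rewrite vsprojK ?center_cartan ?subvsP //.
    rewrite (center_bracket _ (subvsP z)) => /esym/eqP.
    by rewrite scaler_eq0 (negPf e0) orbF => /eqP.
  split=> //; split.
    apply: contraNneq b0 => rb0; apply/eqP/lfunP => v.
    have [z [y /vsproj_decomp ->]] := cartan_decomp v.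
    by rewrite linearD /= bz add0r -resE rb0 !zero_lfunE.
  exists e => //; split.
    have [h bh] := linform_neq0 b0.
    rewrite -[e]scale1r -(mulVf bh) -scalerA memvZ // -we; exact: mem_lie_derived.
  by move=> y; rewrite resE -we vsprojK ?cartan'_mem.
- move=> [[rb0 [e [eD we] e0]] bz]; apply/lie_rootsP; split.
    apply: contraNneq rb0 => b0; apply/eqP/lfunP => y.
    by rewrite resE b0 !zero_lfunE.
  exists e => // v; have [z [y vE]] := cartan_decomp v.
  rewrite vE bracketDl (center_bracket _ (subvsP z)) add0r we resE.
  by rewrite (vsproj_decomp vE) linearD /= bz add0r.
Qed.

Context (f : GL (subvs_of Z)) (phi' : GL (subvs_of t')) (phi : GL T).
Hypothesis phi'_aut : root_aut Phi' phi'.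
Hypothesis phiE : is_dsum f phi' phi.

Lemma dsum_center (z : subvs_of Z) : phi (vsproj t (vsval z)) = vsproj t (vsval (f z)).
Proof.
apply/val_inj; rewrite [RHS]vsprojK ?center_cartan ?subvsP //.
have : vsval (phi (vsproj t (vsval z))) = vsval (f z) + vsval (phi' 0).
  apply: phiE; rewrite [vsval 0]linear0 addr0.
  by rewrite vsprojK ?center_cartan ?subvsP.
by rewrite !linear0 addr0.
Qed.

Lemma dsum_derived (y : subvs_of t') : phi (vsproj t (vsval y)) = vsproj t (vsval (phi' y)).
Proof.
apply/val_inj; rewrite [RHS]vsprojK ?cartan'_mem //.
have : vsval (phi (vsproj t (vsval y))) = vsval (f 0) + vsval (phi' y).
  apply: phiE; rewrite [X in _ = X + _](linear0 _) add0r.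
  by rewrite vsprojK ?cartan'_mem.
by rewrite !linear0 add0r.
Qed.

Lemma outer_root b : Phi (pull b phi) <-> Phi b.
Proof.
have rE : res (pull b phi) = (res b \o phi')%VF.
  by apply/lfunP => y; rewrite resE comp_lfunE resE pullE dsum_derived.
have zE : (forall z : subvs_of Z, pull b phi (vsproj t (vsval z)) = 0) <->
    (forall z : subvs_of Z, b (vsproj t (vsval z)) = 0).
  split=> bz z; last by rewrite pullE dsum_center.
  by rewrite -[z](GLKV f) -dsum_center -pullE.
have /= rA := phi'_aut (res b).
split=> /res_root[r1 r2]; apply/res_root; split.
- by apply/rA; rewrite -rE.
- exact/zE.
- by rewrite rE; apply/rA.
- exact/zE.
Qed.

Lemma outer_derived v : (vsval (phi v) \in @lie_derived K L) = (vsval v \in @lie_derived K L).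
Proof.
have [z [y vE]] := cartan_decomp v.
have yD : vsval y \in @lie_derived K L by have := subvsP y; rewrite memv_cap => /andP[].
have yD' : vsval (phi' y) \in @lie_derived K L.
  by have := subvsP (phi' y); rewrite memv_cap => /andP[].
rewrite (phiE vE) vE !rpredDr //.
apply/idP/idP => zD.
  have : f z = 0 by apply/val_inj; exact: (center_derived L_red (subvsP (f z)) zD).
  by move=> fz; rewrite -[z](GLK f) fz linear0 mem0v.
have : z = 0 by apply/val_inj; exact: (center_derived L_red (subvsP z) zD).
by move=> ->; rewrite linear0 mem0v.
Qed.

Lemma outer_weyl_conjV w : weyl t w -> weyl t (phi^-1 * w * phi)%g.
Proof.
move=> Ww; rewrite -{2}[phi]invgK; apply: (weyl_conj tc L_red) Ww => [b|v vD].
  by have := outer_root (pull b (phi^-1)%g); rewrite -pullM mulVg pull1; exact: iff_sym.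
by rewrite -outer_derived GLKV.
Qed.

End OuterAutomorphism.

(** * Coefficientwise description of the deformations, and the group preserving them *)

Section AdmissibleAlgebra.
Context {R : realType} {L : lieAlgebraType R[i]} {t : {vspace L}}.
Local Notation T := (subvs_of t).
Local Notation Phi := (lie_roots fullv t).
Hypothesis tc : cartan_subalgebra t.
Hypothesis L_red : reductive_lie L.
Context (phi : GL T) (r s : nat).
Hypothesis phi_root : forall b : linform t, Phi (pull b phi) <-> Phi b.
Hypothesis phi_weyl : forall w, weyl t w -> weyl t (phi^-1 * w * phi)%g.
Context (Q : irrtype t s) (g' : GL T) (g'Q : galois_generates phi r g' Q).
Local Notation G := (phi * g')%g.
Local Notation adm := (adm_equiv phi r Q).
Implicit Types (a b : linform t) (w : GL T) (i : 'I_s) (k : nat) (x : T) (q : irrtype t s).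

Let W_sub : is_subgroup (weyl t). Proof. exact: gen_subgroup_sub. Qed.
Let W1 := subgroup1 W_sub.
Let WM := subgroupM W_sub.
Let WV := subgroupV W_sub.

Lemma pole_leP a q k : (pole_order a q <= k)%N <-> forall i, (k <= i)%N -> a (q i) = 0.
Proof.
split=> [/bigmax_leqP le i ki|az].
  by apply/eqP/negPn/negP => /le; rewrite ltnNge ki.
by apply/bigmax_leqP => i ai; rewrite ltnNge; apply/negP => /az e; rewrite e eqxx in ai.
Qed.

Lemma levi_pole q k a : levi q k a <-> Phi a /\ (pole_order a q <= k)%N.
Proof. by split=> -[Ra h]; split => //; exact/pole_leP. Qed.

Lemma levi_mono q k k' a : (k <= k')%N -> levi q k a -> levi q k' a.
Proof. by move=> kk [Ra az]; split => // i ki; apply: az; exact: leq_trans ki. Qed.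

Lemma root_kernel_anti q k k' x : (k <= k')%N ->
  root_kernel (levi q k') x -> root_kernel (levi q k) x.
Proof. by move=> kk xk a /(levi_mono kk); exact: xk. Qed.

Lemma root_kernel_self q k i : (k <= i)%N -> root_kernel (levi q k) (q i).
Proof. by move=> ki a [_]; exact. Qed.

(** The coefficients defining [levi q k] lie in its kernel, so the kernel determines it. This is how
    [setwise_levi] passes from a subspace to roots. *)
Lemma levi_kernel q k a : levi q k a <->
  Phi a /\ forall x, root_kernel (levi q k) x -> a x = 0.
Proof.
split=> [la|[Ra az]]; first by split => [|x]; [case: la|exact].
by split => // i ki; apply: az; exact: root_kernel_self.
Qed.

Lemma weyl_fix_kernel q w x : weyl t w -> (forall i, w (q i) = q i) ->
  root_kernel (levi q 0) x -> w x = x.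
Proof.
move=> Ww wq xk; apply: (weyl_fix tc L_red (us := [seq q i | i <- enum 'I_s])) => //.
  by move=> _ /mapP[i _ ->].
move=> a Ra az; apply: xk; split => // i _; apply: az.
by apply: map_f; rewrite mem_enum.
Qed.

Lemma adm_pole q a : adm q -> Phi a -> pole_order a Q = pole_order a q.
Proof. by case=> _; exact. Qed.

Lemma adm_levi q k : adm q -> levi q k = levi Q k.
Proof.
move=> aq; apply/seteqP; split => a /levi_pole[Ra ak]; apply/levi_pole.
  by rewrite (adm_pole aq).
by rewrite -(adm_pole aq).
Qed.

(** Both generators lie in W and, once [phi] is cancelled, agree on the coefficients; Steinberg's
    theorem applies to [g'^-1 * g]. *)
Lemma galois_same g x : galois_generates phi r g Q -> root_kernel (levi Q 0) x -> g x = g' x.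
Proof.
move=> [Wg gQ] xk; have [Wg' g'Qi] := g'Q.
suff e : (g'^-1 * g)%g x = x by rewrite -[LHS](GLKV g') -(GLME (g'^-1)%g g) e.
apply: (@weyl_fix_kernel Q) => // [|i]; first exact: (WM (WV Wg') Wg).
rewrite (GLME (g'^-1)%g g); have e : phi (g (Q i)) = phi (g' (Q i)).
  by rewrite -!GLME gQ g'Qi.
have -> : g (Q i) = g' (Q i) by rewrite -[LHS](GLK phi) e; exact: GLK.
exact: GLK.
Qed.

Lemma adm_kernel q k i : adm q -> (k <= i)%N -> root_kernel (levi Q k) (q i).
Proof. by move=> aq ki; rewrite -(adm_levi k aq); exact: root_kernel_self. Qed.

Lemma adm_galois q : adm q -> galois_generates phi r g' q.
Proof.
move=> aq; have [[g gQ [_ gq]] _] := aq; split; first by have [] := g'Q.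
move=> i; rewrite -gq (GLME phi g') (GLME phi g); congr (phi _).
by apply/esym/galois_same => //; exact: adm_kernel.
Qed.

(** Once [g'] is fixed, no condition links different coefficients. Conversely, the kernels prevent
    pole orders from growing, while a root of pole order [m.+1] in [Q] belongs to [levi Q m.+1] and
    not to [levi Q m], so the hyperplanes removed at index [m] keep its leading coefficient
    nonzero. *)
Lemma admP q : adm q <-> forall i, adm_space_at r Q G i (q i : vtop T).
Proof.
split=> [aq i|aq].
  split; first by split; [exact: adm_kernel|have [_] := adm_galois aq; exact].
  move=> [a [[Ra az] na] [/= aqi _]]; apply: na; split => // j.
  have : levi q i.+1 a by rewrite (adm_levi _ aq); split.
  move=> [_ aqz]; have : levi q i a.
    split => // j'; rewrite leq_eqVlt => /predU1P[e|]; last exact: aqz.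
    by have -> : j' = i by exact/val_inj.
  by rewrite (adm_levi _ aq) => -[_]; exact.
have g'q : galois_generates phi r g' q.
  by split; [have [] := g'Q|move=> i; have [[_]] := aq i].
split; first by exists g'.
move=> a Ra; apply/eqP; rewrite eqn_leq; apply/andP; split; last first.
  apply/pole_leP => i ki; have [[qk _] _] := aq i; apply: qk.
  by apply: (@levi_mono _ (pole_order a Q)) => //; apply/levi_pole.
apply/bigmax_leqP => i ai; rewrite ltnNge; apply/negP => /pole_leP aq0.
have [m em] : exists m : 'I_s, pole_order a Q = m.+1.
  have : (0 < s)%N by case: (s) i {ai aq0} => [[]|].
  case: (posnP (pole_order a Q)) => [p0 _|p0 _].
    by move/eqP: ai; have /pole_leP -> // : (pole_order a Q <= 0)%N by rewrite p0.
  case: (@eq_bigmax_cond _ [pred m : 'I_s | a (Q m) != 0] (fun m : 'I_s => m.+1)).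
    by apply/card_gt0P; exists i.
  by move=> m _ e; exists m; rewrite -[RHS]e; apply: eq_bigl.
have lm : levi Q m.+1 a by apply/levi_pole; rewrite em.
have nlm : ~ levi Q m a by move=> /levi_pole[_]; rewrite em ltnn.
have [em' nb] := aq m; apply: nb; exists a => //; split => //=.
apply: aq0; have : (i.+1 <= pole_order a Q)%N by rewrite /pole_order (bigD1 i) //= leq_maxl.
by rewrite em ltnS.
Qed.

Lemma G_conjV w : weyl t w -> weyl t (G^-1 * w * G)%g.
Proof.
move=> Ww; have [Wg' _] := g'Q.
have -> : (G^-1 * w * G = g'^-1 * (phi^-1 * w * phi) * g')%g by rewrite invgM !mulgA.
by apply: (WM _ Wg'); apply: (WM (WV Wg')); exact: phi_weyl.
Qed.

Lemma G_root a : Phi a -> Phi (pull a G).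
Proof.
move=> Ra; rewrite pullM; have [Wg' _] := g'Q.
by apply: (weyl_root tc Wg'); apply/phi_root.
Qed.

Lemma G_kernel k x : root_kernel (levi Q k) x -> root_kernel (levi Q k) (G x).
Proof.
move=> xk a [Ra az]; rewrite -pullE; apply: xk; split; first exact: G_root.
move=> i ki; rewrite pullE; have [_ ->] := g'Q.
by rewrite linearZ /= az // scaler0.
Qed.

Local Notation N := [set w : GL T | forall i, pre_centralizer (levi Q i) G w].

Lemma setwise_levi w k a : setwise_stab (levi Q k) w -> levi Q k (pull a w) -> levi Q k a.
Proof.
move=> sw /levi_kernel[Rw az]; have [Ww wE] := sw; apply/levi_kernel; split.
  by rewrite -[a]pull1 -(mulgV w) pullM; exact: (weyl_root tc (WV Ww) Rw).
move=> x; rewrite -wE => -[y yk <-]; rewrite -pullE; exact: az.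
Qed.

Lemma N_setwise w i : N w -> setwise_stab (levi Q i) w.
Proof. by move=> /(_ i)[]. Qed.

(** The definition provides commutation for some representative [w * h] of the coset; [h] is the
    identity on the kernel, and [G] preserves the kernel. *)
Lemma N_comm w i x : N w -> root_kernel (levi Q i) x -> w (G x) = G (w x).
Proof.
move=> /(_ i)[sw [_ [_ [h [Wh hx] <-] wC]]] xk.
have := wC x xk; rewrite !(GLME w h) hx; last exact: G_kernel.
by rewrite hx.
Qed.

Lemma N_adm w q : N w -> adm q -> adm (weyl_act w q).
Proof.
move=> Nw aq; apply/admP => i; rewrite ffunE; have [_ gq] := adm_galois aq.
have [[qk _] nb] := iffLR (admP q) aq i.
split; first split.
- exact: (setwise_stabP (N_setwise i Nw) qk).
- by rewrite -(N_comm Nw qk) gq linearZ.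
move=> [a [[Ra az] na] [/= aw _]]; apply: nb; exists (pull a w); last first.
  by split; rewrite /= ?pullE //; split => //; exact: gq.
have Ww : weyl t w by have [] := N_setwise i Nw.
split; last by move=> /(setwise_levi (N_setwise i Nw)).
split; first exact: (weyl_root tc Ww Ra).
(* The stabiliser of level [j] is used rather than that of [i.+1], which may equal [s], where [N]
   prescribes nothing. *)
move=> j ij; rewrite pullE.
have jk : root_kernel (levi Q j) (w (Q j)).
  exact: (setwise_stabP (N_setwise j Nw) (@root_kernel_self Q j j (leqnn j))).
by apply: jk; apply: (levi_mono ij); split.
Qed.

Lemma adm_act_levi w q k a : adm q -> adm (weyl_act w q) -> weyl t w ->
  levi Q k a <-> levi Q k (pull a w).
Proof.
move=> aq awq Ww; rewrite -{1}(adm_levi k awq) -(adm_levi k aq).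
split=> -[Ra az]; split.
- exact: (weyl_root tc Ww Ra).
- by move=> i ki; have := az i ki; rewrite ffunE pullE.
- by rewrite -[a]pull1 -(mulgV w) pullM; exact: (weyl_root tc (WV Ww) Ra).
- by move=> i ki; have := az i ki; rewrite ffunE pullE.
Qed.

(** Equal pole orders make [w] preserve every [levi Q k], hence its kernel. For commutation with
    [G], Steinberg's theorem is applied to a commutator. *)
Lemma adm_N w q : weyl t w -> adm q -> adm (weyl_act w q) -> N w.
Proof.
move=> Ww aq awq i; have lw k a := @adm_act_levi w q k a aq awq Ww.
have wk x k : root_kernel (levi Q k) x <-> root_kernel (levi Q k) (w x).
  split=> xk a la; first by rewrite -pullE; apply: xk; exact: (iffLR (lw k a) la).
  have la' : levi Q k (pull a (w^-1)%g).
    by apply: (iffRL (lw k _)); rewrite -pullM mulVg pull1.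
  by have := xk _ la'; rewrite pullE GLK.
have sw : setwise_stab (levi Q i) w.
  split => //; apply/seteqP; split => [_ [x xk <-]|x xk].
    exact: (iffLR (wk x i) xk).
  by exists ((w^-1)%g x); rewrite ?GLKV //; apply: (iffRL (wk _ i)); rewrite GLKV.
have comm x : root_kernel (levi Q 0) x -> w (G x) = G (w x).
  move=> xk; have [_ gq] := adm_galois aq; have [_ gwq] := adm_galois awq.
  (* An element of W, since [G] normalises W; it fixes the coefficients of [q] because those of [q]
     and of its translate have the same eigenvalues for [G]. *)
  pose u := (w^-1 * (G^-1 * w * G))%g.
  have Wu : weyl t u by apply: (WM (WV Ww)); exact: G_conjV.
  suff ux : u x = x.
    have -> : w (G x) = G (w (u x)); last by rewrite ux.
    by rewrite /u -!GLME !mulgA mulgK mulgV mul1g.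
  apply: (@weyl_fix_kernel q) => //; last by rewrite (adm_levi _ aq).
  move=> j; have := gwq j; rewrite ffunE => e.
  have e1 : w (G (q j)) = G (w (q j)) by rewrite gq linearZ.
  have -> : u (q j) = (w^-1)%g ((G^-1)%g (w (G (q j)))).
    by rewrite /u -!GLME !mulgA.
  by rewrite e1 GLK; exact: GLK.
split => //; split; first by exists w.
exists w.
  exists 1%g; last exact: mulg1.
  exact: (subgroup1 (pointwise_stab_sub _)).
by move=> x xk; apply: comm; exact: root_kernel_anti xk.
Qed.

Lemma adm_stab w q : weyl t w -> adm q -> weyl_act w q = q ->
  pointwise_stab (levi Q 0) w.
Proof.
move=> Ww aq wq; split => // x xk; apply: (@weyl_fix_kernel q) => //.
  by move=> i; rewrite -{2}wq ffunE.
by rewrite (adm_levi _ aq).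
Qed.

Lemma stab_adm w q : pointwise_stab (levi Q 0) w -> adm q -> weyl_act w q = q.
Proof.
move=> [_ wx] aq; apply/ffunP => i; rewrite ffunE wx //; exact: adm_kernel.
Qed.

Lemma pole_act a w q : pole_order a (weyl_act w q) = pole_order (pull a w) q.
Proof. by apply: eq_bigl => i; rewrite ffunE pullE. Qed.

Lemma weyl_actK w q : weyl_act (w^-1)%g (weyl_act w q) = q.
Proof. by apply/ffunP => i; rewrite !ffunE GLK. Qed.

Lemma weyl_actKV w q : weyl_act w (weyl_act (w^-1)%g q) = q.
Proof. by apply/ffunP => i; rewrite !ffunE GLKV. Qed.

Lemma adm_orbit w q : weyl t w -> adm_equiv phi r (weyl_act w Q) q ->
  adm (weyl_act (w^-1)%g q).
Proof.
move=> Ww [[g [Wg gwQ] [_ gq]] pq].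
(* Chosen so that [phi * g1] is [w^-1 * (phi * g) * w]; it lies in W because [phi] normalises W. *)
pose g1 := ((phi^-1 * w^-1 * phi) * g * w)%g.
have Wg1 : weyl t g1 by apply: (WM _ Ww); apply: (WM _ Wg); apply: phi_weyl; exact: WV.
have g1E x : (phi * g1)%g x = (w^-1)%g ((phi * g)%g (w x)).
  by rewrite /g1 -!GLME !mulgA mulgV mul1g.
split.
  exists g1; split => // i; rewrite g1E.
    by have := gwQ i; rewrite ffunE => ->; rewrite linearZ /= GLK.
  by rewrite ffunE GLKV gq linearZ.
move=> a Ra; rewrite pole_act -pq; last exact: (weyl_root tc (WV Ww) Ra).
by rewrite pole_act -pullM mulVg pull1.
Qed.

Lemma pull_perm (rs : seq (linform t)) w : uniq rs -> (forall a, a \in rs <-> Phi a) ->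
  weyl t w -> perm_eq [seq pull a w | a <- rs] rs.
Proof.
move=> us rsP Ww; apply: uniq_perm => //.
  rewrite map_inj_uniq // => c d cd.
  by rewrite -[c]pull1 -[d]pull1 -(mulgV w) !pullM cd.
move=> c; apply/mapP/idP => [[d /rsP Rd ->]|/rsP Rc].
  by apply/rsP; exact: (weyl_root tc Ww Rd).
exists (pull c (w^-1)%g); last by rewrite -pullM mulVg pull1.
by apply/rsP; exact: (weyl_root tc (WV Ww) Rc).
Qed.

(* A point u of the W-orbit of the admissible space which is close to the
   admissible point p is admissible: its pole orders can only grow, and their
   sum is an invariant of the orbit. *)
Lemma adm_near p q u w : adm p -> adm q -> weyl t w -> u = weyl_act w q ->
  (forall a, Phi a -> (pole_order a p <= pole_order a u)%N) ->
  (forall w', weyl t w' ->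
     weyl_act w' u = [ffun i : 'I_s => zeta r ^+ i.+1 *: (G^-1)%g (u i)] ->
     weyl_act w' p = p) ->
  adm u.
Proof.
move=> ab aq Ww uE ple close; have [rs us rsP] := root_list tc.
have sumE : \sum_(a <- rs) pole_order a p = \sum_(a <- rs) pole_order a u.
  rewrite -(perm_big _ (pull_perm us rsP Ww)) big_map /= big_seq [RHS]big_seq.
  apply: eq_bigr => a /rsP Ra; have Raw := weyl_root tc Ww Ra.
  by rewrite uE pole_act -(adm_pole ab Raw) -(adm_pole aq Raw).
have poleE a : Phi a -> pole_order a p = pole_order a u.
  move=> /rsP ars; apply/eqP; rewrite eqn_leq ple ?rsP //=; last exact/rsP.
  rewrite leqNgt; apply/negP => lt; move/eqP: sumE; apply/negP.
  rewrite neq_ltn; apply/orP; left.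
  rewrite !(bigD1_seq a) //= -addSn leq_add // big_seq_cond [X in (_ <= X)%N]big_seq_cond.
  by apply: leq_sum => c /andP[/rsP Rc _]; exact: ple.
have leviE k : levi u k = levi Q k.
  rewrite -(adm_levi k ab); apply/seteqP.
  by split => c /levi_pole[Rc ck]; apply/levi_pole; [rewrite poleE|rewrite -poleE].
(* [w'] sends each [u i] to [zeta r ^+ i.+1 *: (G^-1)%g (u i)], so [u] satisfies the Galois
   condition exactly when [w'] fixes it. The hypothesis [close] makes [w'] fix [p], hence all of
   t_phi_1, where [u] lies because its pole orders agree with those of [p]. *)
pose w' := ((G^-1 * w * G) * w^-1)%g.
have Ww' : weyl t w' by apply: (WM _ (WV Ww)); exact: G_conjV.
have [_ gq] := adm_galois aq.
have w'u : weyl_act w' u = [ffun i : 'I_s => zeta r ^+ i.+1 *: (G^-1)%g (u i)].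
  apply/ffunP => i; rewrite !ffunE uE ffunE /w' -!mulgA (GLME (G^-1)%g).
  rewrite -linearZ; congr ((G^-1)%g _); rewrite !GLME GLK -(GLME phi g') gq.
  by rewrite linearZ.
have [_ stab] := adm_stab Ww' ab (close w' Ww' w'u).
split; last by move=> a Ra; rewrite (adm_pole ab Ra) poleE.
exists g' => //; split; first by have [] := g'Q.
move=> i; have := congr1 (fun q : irrtype t s => q i) w'u; rewrite !ffunE.
rewrite stab; last by rewrite -(leviE 0%N); exact: root_kernel_self.
by move=> e; rewrite [in LHS]e linearZ; congr (_ *: _); exact: GLKV.
Qed.

End AdmissibleAlgebra.

(** * Fundamental group of a product *)

Section ProductFundamentalGroup.
Context {R : realType} {I : Type} {E : topologicalType} {B : I -> topologicalType}.
Local Notation Ival := (`[0%R, 1%R]%classic : set R).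
Context (pr : forall i, E -> B i) (pr_cont : forall i, continuous (pr i)).
Arguments pr_cont : clear implicits.
Hypothesis pr_inj : forall e e', (forall i, pr i e = pr i e') -> e = e'.
Hypothesis pr_univ : forall (Y : topologicalType) (F : forall i, Y -> B i),
  (forall i, continuous (F i)) ->
  exists2 H : Y -> E, continuous H & forall i y, pr i (H y) = F i y.
Context (e0 : E) (b0 : forall i, B i) (pr_base : forall i, pr i e0 = b0 i).
Arguments pr_base : clear implicits.

Lemma pi1_class_eq (X : topologicalType) (x : X) (f g : loop (R := R) x) :
  (forall t, Ival t -> f t = g t) -> pi1_class f = pi1_class g.
Proof.
move=> fg; apply/pi1_classE; apply: (@homotopic_reparam _ _ _ g id id) => //.
- exact: loop_cont.
- by move=> z; exact: cvg_id.
- by move=> z; exact: cvg_id.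
Qed.

(** The product is known only by its universal property, applied to [0, 1] and its square as
    [subspace] types, on which continuity is continuity within the set. Homotopies chosen separately
    for each [i] are assembled in this way. *)
Lemma pi1_prod_iso : group_iso
  ((fun x i => pi1_map (pr_cont i) (pr_base i) x) :
     pi1 R e0 -> dprodg (fun i => pi1 R (b0 i))).
Proof.
have I0 : Ival 0 by rewrite /= in_itv /= lexx ler01.
have I1 : Ival 1 by rewrite /= in_itv /= lexx ler01.
split.
  by move=> a b; apply: functional_extensionality_dep => i; exact: pi1_mapM.
suff [inj surj] : injective ((fun x i => pi1_map (pr_cont i) (pr_base i) x) :
     pi1 R e0 -> dprodg (fun i => pi1 R (b0 i))) /\
    forall c : dprodg (fun i => pi1 R (b0 i)),
    exists x : pi1 R e0, (fun i => pi1_map (pr_cont i) (pr_base i) x) = c.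
  exists (fun c => sval (cid (surj c))) => [x|c].
    by apply: inj; case: cid.
  by case: cid.
split.
- elim/(@pi1_ind R E e0) => f; elim/(@pi1_ind R E e0) => g => fg.
  apply/pi1_classE.
  have {fg} hi i : homotopic (loop_map (pr_cont i) (pr_base i) f)
      (loop_map (pr_cont i) (pr_base i) g).
    by apply/pi1_classE; rewrite -!pi1_mapE; exact: (congr1 (fun c => c i) fg).
  pose H i := sval (cid (hi i)).
  have HP i : [/\ {within Ival `*` Ival, continuous (H i)},
      forall t, Ival t -> H i (t, 0) = pr i (f t),
      forall t, Ival t -> H i (t, 1) = pr i (g t) &
      forall u, Ival u -> H i (0, u) = b0 i /\ H i (1, u) = b0 i].
    by rewrite /H; case: cid.
  have [|K cK KH] := @pr_univ (subspace (Ival `*` Ival)) H.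
    by move=> i; have [] := HP i.
  exists K; split => //.
  + by move=> t It; apply: pr_inj => i; rewrite KH; have [_ -> //] := HP i.
  + by move=> t It; apply: pr_inj => i; rewrite KH; have [_ _ -> //] := HP i.
  + move=> u Iu; split; apply: pr_inj => i; rewrite KH pr_base; have [_ _ _ Hu] := HP i.
      by have [] := Hu u Iu.
    by have [] := Hu u Iu.
- move=> c; pose f i := repr (c i).
  have [|K cK Kf] := @pr_univ (subspace Ival) (fun i => f i).
    by move=> i; exact: loop_cont.
  have K0 : K 0 = e0 by apply: pr_inj => i; rewrite Kf pr_base; exact: loop0.
  have K1 : K 1 = e0 by apply: pr_inj => i; rewrite Kf pr_base; exact: loop1.
  exists (pi1_class (@Loop R E e0 K cK K0 K1)).
  apply: functional_extensionality_dep => i; rewrite pi1_mapE -[RHS]reprK.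
  by apply: pi1_class_eq => t It /=; rewrite Kf.
Qed.

End ProductFundamentalGroup.

(** * Arcs in the complex plane avoiding finitely many points *)

Section ComplexPaths.
Context {R : realType}.
Let C : numFieldType := R[i].

Lemma real_complex_continuous : continuous (fun x : R => (x%:C)%C : C).
Proof.
move=> x; apply/cvgrPdist_lt => e; case: e => [e ie]; rewrite ltcE /= => /andP[/eqP -> e0].
have := @cvg_id _ (nbhs x); move/cvgrPdist_lt => /(_ e e0); apply: filterS => y /= xy.
rewrite -rmorphB normc_def /= expr0n addr0 sqrtr_sqr ltcR.
exact: xy.
Qed.

Lemma complex_continuous (x y : R -> R) : continuous x -> continuous y ->
  continuous (fun t => (x t +i* y t)%C : C).
Proof.
move=> cx cy.
have -> : (fun t => (x t +i* y t)%C : C) = (fun t => ((x t)%:C%C : C) + ('i%C : C) * ((y t)%:C%C : C)).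
  apply/funext => t; apply/eqP; rewrite eq_complex /=.
  by rewrite !mul0r !mul1r !(subr0, addr0, add0r, mulr0) !eqxx.
have cC (u : R -> R) : continuous u -> continuous (fun t => (u t)%:C%C : C).
  move=> cu t; apply: (@continuous_comp R R C u (fun x : R => (x%:C)%C : C)).
    exact: cu.
  exact: real_complex_continuous.
move=> t; apply: cvgD; first exact: cC.
by apply: cvgM; [exact: cvg_cst|exact: cC].
Qed.

(** Arcs from 0 to 1 indexed by a height [c]; the parameter is the real part, so a point of real
    part other than 0 and 1 lies on exactly one of these curves. *)
Definition parabola (c t : R) : R[i] := (t +i* (c * t * (1 - t)))%C.

Lemma parabola_continuous c : continuous (parabola c : R -> C).
Proof.
apply: complex_continuous => t; first exact: cvg_id.
apply: cvgM; first by apply: cvgM; [exact: cvg_cst|exact: cvg_id].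
by apply: cvgB; [exact: cvg_cst|exact: cvg_id].
Qed.

Lemma parabola0 c : parabola c 0 = 0.
Proof. by apply/eqP; rewrite eq_complex /= mulr0 mul0r !eqxx. Qed.

Lemma parabola1 c : parabola c 1 = 1.
Proof. by apply/eqP; rewrite eq_complex /= subrr mulr0 !eqxx. Qed.

(* For each p at most one height c is excluded: the path must miss the single
   zero p.1 / (p.1 - p.2). *)
Lemma parabola_avoid (s : seq (R[i] * R[i])) :
  (forall p, p \in s -> p.1 != 0 /\ p.2 != 0) ->
  exists c, forall t p, p \in s -> p.1 + parabola c t * (p.2 - p.1) != 0.
Proof.
move=> s0; pose w (p : R[i] * R[i]) := p.1 / (p.1 - p.2).
pose bad p := complex.Im (w p) / (complex.Re (w p) * (1 - complex.Re (w p))).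
pose c := 1 + \sum_(p <- s) `|bad p|; exists c => t [u v] ps.
have [/= u0 v0] := s0 _ ps; apply/eqP => e.
have uv : u - v != 0.
  by apply: contraNneq u0 => uv; move: e; rewrite -opprB uv oppr0 mulr0 addr0 => ->.
have wE : parabola c t = w (u, v).
  by apply: (mulIf uv); rewrite /w /= divfK // -[u - v]opprB mulrN; apply/eqP;
    rewrite eq_sym -addr_eq0 e.
have t0 : t != 0.
  by apply: contraNneq u0 => t0; move: e; rewrite t0 parabola0 mul0r addr0 => ->.
have t1 : 1 - t != 0.
  rewrite subr_eq0 eq_sym; apply: contraNneq v0 => t1; move: e.
  by rewrite t1 parabola1 mul1r addrC subrK => ->.
have bE : bad (u, v) = c.
  rewrite /bad -wE /parabola /=.
  rewrite -mulrA mulfK // mulf_neq0 //.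
have : bad (u, v) < c.
  rewrite /c (big_rem (u, v)) //=; have := ler_norm (bad (u, v)).
  have : 0 <= \sum_(y <- rem (u, v) s) `|bad y| by rewrite sumr_ge0.
  lra.
by rewrite bE ltxx.
Qed.

End ComplexPaths.

Lemma nbhs_seq (Y : topologicalType) (I : eqType) (l : seq I) (P : I -> set Y) (y : Y) :
  (forall i, i \in l -> nbhs y (P i)) -> nbhs y [set z | forall i, i \in l -> P i z].
Proof.
elim: l => [|i l IHl] nP; first exact: (filterS _ filterT).
have n1 := nP i (mem_head _ _).
have n2 : nbhs y [set z | forall i, i \in l -> P i z].
  by apply: IHl => j jl; apply: nP; rewrite inE jl orbT.
apply: filterS2 n1 n2 => z Pz Pl j; rewrite inE => /predU1P[->//|]; exact: Pl.
Qed.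

(** * The product decomposition, the covering and its deck group *)

Section Assembly.
Context {R : realType} {L : lieAlgebraType R[i]} {t : {vspace L}}.
Local Notation T := (subvs_of t).
Local Notation Phi := (lie_roots fullv t).
Hypothesis tc : cartan_subalgebra t.
Hypothesis L_red : reductive_lie L.
Context (phi : GL T) (r s : nat).
Hypothesis phi_root : forall b : linform t, Phi (pull b phi) <-> Phi b.
Hypothesis phi_weyl : forall w, weyl t w -> weyl t (phi^-1 * w * phi)%g.
Context (Q : irrtype t s) (g' : GL T) (g'Q : galois_generates phi r g' Q).
Local Notation G := (phi * g')%g.
Local Notation adm := (adm_equiv phi r Q).
Local Notation E := (adm_space phi r Q).
Implicit Types (w : GL T) (i : 'I_s) (q : irrtype t s).

Let W_sub : is_subgroup (weyl t). Proof. exact: gen_subgroup_sub. Qed.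

Local Notation admP := (admP tc L_red g'Q).

Definition adm_proj i (q : E) : adm_space_at r Q G i :=
  exist _ ((val q : irrtype t s) i : vtop T) (mem_set (iffLR (admP _) (set_mem (valP q)) i)).

Lemma adm_proj_continuous i : continuous (adm_proj i).
Proof.
apply: to_set_continuous => q /=.
apply: (@continuous_comp E (vtop (irrtype t s)) (vtop T) set_val
  (fun F : vtop {ffun 'I_s -> T} => (F : {ffun 'I_s -> T}) i : vtop T)).
  exact: set_val_continuous.
exact: vtop_proj_continuous.
Qed.

Lemma adm_proj_base i : adm_proj i (adm_space_base g'Q) = adm_space_at_base g'Q i.
Proof. exact: val_inj. Qed.

Lemma adm_proj_iso : group_iso
  ((fun x i => pi1_map (@adm_proj_continuous i) (adm_proj_base i) x) :
    pi1 R (adm_space_base g'Q) -> dprodg (fun i => pi1 R (adm_space_at_base g'Q i))).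
Proof.
apply: pi1_prod_iso => [e e' ee|Y F cF].
  apply/val_inj/ffunP => i; exact: (congr1 val (ee i)).
pose H y : irrtype t s := [ffun i => val (F i y)].
have aH y : E (H y) by apply/admP => i; rewrite ffunE; exact: (set_mem (valP (F i y))).
exists (fun y => exist _ (H y : vtop (irrtype t s)) (mem_set (aH y))).
  apply: to_set_continuous => /=.
  apply: (@vtop_ffun_continuous _ Y T 'I_s H) => i.
  rewrite (_ : (fun y => H y i) = set_val \o F i); last first.
    by apply/funext => y; rewrite /H ffunE.
  by move=> y; apply: continuous_comp; [exact: cF|exact: set_val_continuous].
by move=> i y; apply: val_inj; rewrite /= ffunE.
Qed.

Lemma irrclassE q q' : irrclass_of q = irrclass_of q' <->
  exists2 w, weyl t w & q' = weyl_act w q.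
Proof.
split; first by move/eqquotP/asboolP.
by move=> h; apply/eqquotP/asboolP.
Qed.

Local Notation X := (adm_class_space phi r (irrclass_of Q)).
Local Notation cov := (@adm_class_map R L t phi r s Q).

(** A class of the space is admissible for some representative of the class of [Q], possibly not [Q]
    itself; [adm_orbit] moves the deformation back. *)
Lemma cov_surj (x : X) : exists e : E, cov e = x.
Proof.
have [Q1 [Q2 [/esym/irrclassE[w Ww Q1E] Q2E aQ]]] := set_mem (valP x).
rewrite Q1E in aQ; have aw := adm_orbit tc phi_weyl Ww aQ.
exists (exist _ (weyl_act (w^-1)%g Q2 : vtop (irrtype t s)) (mem_set aw)).
apply: val_inj => /=; rewrite -Q2E; apply/esym/irrclassE.
by exists (w^-1)%g => //; exact: (subgroupV W_sub).
Qed.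

Lemma weyl_act_linear w : linear (weyl_act w : irrtype t s -> irrtype t s).
Proof. by move=> c u v; apply/ffunP => i; rewrite !ffunE linearP. Qed.

Lemma weyl_act_continuous w :
  continuous (weyl_act w : vtop (irrtype t s) -> vtop (irrtype t s)).
Proof.
pose F : {linear irrtype t s -> irrtype t s} :=
  HB.pack (weyl_act w : irrtype t s -> irrtype t s)
    (GRing.isLinear.Build _ _ _ _ _ (weyl_act_linear w)).
exact: (@linear_vtop_continuous _ _ _ F).
Qed.

Lemma irrclass_open (V : set (vtop (irrtype t s))) : open V ->
  open ((fun q => irrclass_of q : @irrclass R L t s) @` V).
Proof.
move=> oV; suff : open ((fun q : vtop (irrtype t s) => irrclass_of q) @^-1`
    ((fun q => irrclass_of q : @irrclass R L t s) @` V)) by [].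
rewrite openE => _ [/= v Vv /irrclassE[w Ww ->]].
have : nbhs (weyl_act w v : vtop (irrtype t s)) ((weyl_act (w^-1)%g) @^-1` V).
  apply: (@weyl_act_continuous (w^-1)%g (weyl_act w v)).
  by rewrite weyl_actK; exact: open_nbhs_nbhs.
rewrite /interior; apply: filterS => u Vu; exists (weyl_act (w^-1)%g u) => //.
by apply/irrclassE; exists w => //; rewrite weyl_actKV.
Qed.

(** W is finite and the space Hausdorff, so each [w] moving [p] carries some neighbourhood of [p]
    off itself; these are intersected. The default [setT] is reached only when [w] fixes [p]. *)
Lemma orbit_separate (p : vtop (irrtype t s)) : exists2 U, nbhs p U &
  forall w u, weyl t w -> U u -> U (weyl_act w u) -> weyl_act w p = p.
Proof.
have [l lE] := iffLR (finite_seqP (weyl t)) (weyl_finite tc L_red).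
pose U w : set (vtop (irrtype t s)) :=
  if pselect (exists U, nbhs p U /\ forall u, U u -> ~ U (weyl_act w u)) is left h
  then sval (cid h) else setT.
exists [set z | forall w, w \in l -> U w z].
  apply: nbhs_seq => w _; rewrite /U; case: pselect => [h|_]; last exact: filterT.
  by case: cid => /= V [].
move=> w u Ww Uu Uw; apply/eqP/negPn/negP => wp.
have wl : w \in l by suff : [set` l] w by []; rewrite -lE.
have := Uu w wl; have := Uw w wl; rewrite /U; case: pselect => [h|nh _ _].
  by case: cid => /= V [_ VV] Vw /VV.
apply: nh; have := @vtop_hausdorff _ (irrtype t s); rewrite open_hausdorff.
move=> /(_ _ _ wp)[[A B] /= [/set_mem Aw /set_mem Bp] [oA oB AB]].
exists (B `&` (weyl_act w @^-1` A)); split.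
  apply: filterI; first exact: open_nbhs_nbhs.
  by apply: (@weyl_act_continuous w p); exact: open_nbhs_nbhs.
move=> v [Bv Av] [Bwv _]; suff : (A `&` B) (weyl_act w v) by rewrite (eqP AB).
by split.
Qed.

Let C : numFieldType := R[i].

Lemma root_neq0_nbhs (a : linform t) i (p : vtop (irrtype t s)) :
  a (p i) != 0 -> nbhs p [set u : vtop (irrtype t s) | a (u i) != 0].
Proof.
move=> ai; have cai : continuous (fun u : vtop (irrtype t s) => a ((u : irrtype t s) i) : C).
  move=> u; apply: (@continuous_comp (vtop (irrtype t s)) (vtop T) C
    (fun u : vtop {ffun 'I_s -> T} => (u : {ffun 'I_s -> T}) i : vtop T) a).
    exact: vtop_proj_continuous.
  exact: (@linform_vtop_continuous C _ a).
exact: (@cvgr_neq0 C C _ (nbhs p) _ (fun u : vtop (irrtype t s) => a (u i) : C) (a (p i)) (cai p) ai).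
Qed.

Lemma twist_continuous : continuous ((fun u : irrtype t s => [ffun i : 'I_s => zeta r ^+ i.+1 *: (G^-1)%g (u i)])
  : vtop (irrtype t s) -> vtop (irrtype t s)).
Proof.
pose F (u : irrtype t s) : irrtype t s := [ffun i : 'I_s => zeta r ^+ i.+1 *: (G^-1)%g (u i)].
have F_linear : linear F.
  move=> c u v; apply/ffunP => i.
  by rewrite !ffunE linearP scalerDr !scalerA mulrC.
pose FL : {linear irrtype t s -> irrtype t s} :=
  HB.pack F (GRing.isLinear.Build _ _ _ _ _ F_linear).
exact: (@linear_vtop_continuous _ _ _ FL).
Qed.

Lemma adm_near_nbhs (p : vtop (irrtype t s)) : E p -> nbhs p
  [set u | forall w q, weyl t w -> adm q -> u = weyl_act w q -> adm u].
Proof.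
move=> ap; have [U nU Uw] := orbit_separate p; have [rs us rsP] := root_list tc.
have [_ gp] := adm_galois tc L_red g'Q ap.
pose V : set (vtop (irrtype t s)) := [set u | forall a, a \in rs ->
  forall i, i \in enum 'I_s -> (a : linform t) (p i) != 0 -> a (u i) != 0].
have nV : nbhs p V.
  apply: nbhs_seq => a _; apply: nbhs_seq => i _.
  have [ai|ai] := eqVneq (a (p i)) 0.
    by apply: filterS filterT => u _.
  by apply: filterS (root_neq0_nbhs ai).
(* [p] is a fixed point of the twist, so a [u] near [p] has its twist in [U] as well; if [w'] maps
   [u] to it, then [w'] fixes [p]. *)
have pE : [ffun i : 'I_s => zeta r ^+ i.+1 *: (G^-1)%g (p i)] = p :> irrtype t s.
  by apply/ffunP => i; rewrite ffunE -linearZ -gp; exact: GLK.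
have nF : nbhs p [set u : vtop (irrtype t s) |
    U ([ffun i : 'I_s => zeta r ^+ i.+1 *: (G^-1)%g (u i)] : irrtype t s)].
  by apply: (@twist_continuous p); rewrite pE.
apply: filterS (filterI nV (filterI nU nF)) => u [Vu [Uu Fu]] w q Ww aq uE.
apply: (adm_near tc L_red phi_weyl g'Q ap aq Ww uE) => [a /rsP ars|w' Ww' w'u].
  apply/bigmax_leqP => i ai; rewrite /pole_order (bigD1 i) ?leq_maxl //.
  by apply: (Vu a ars i _ ai); rewrite mem_enum.
by apply: (Uw w' u Ww' Uu); rewrite w'u.
Qed.

(** The class space carries the topology induced from the quotient of t^s by W, so a class near
    [cov e] comes with a point [u] near [e] and with an admissible point [e'] of the same orbit, and
    these may differ. [adm_near_nbhs] shows [u] itself to be admissible. *)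
Lemma cov_open (e : E) (U : set E) : nbhs e U -> nbhs (cov e) (cov @` U).
Proof.
move=> /set_nbhsP[V [oV Ve] VU].
pose A := [set u : vtop (irrtype t s) | forall w q, weyl t w -> adm q -> u = weyl_act w q -> adm u].
have nA : nbhs (val e : vtop (irrtype t s)) (V `&` A).
  apply: filterI; first exact: open_nbhs_nbhs.
  exact: adm_near_nbhs (set_mem (valP e)).
pose O := (fun q => irrclass_of q : @irrclass R L t s) @` (interior (V `&` A)).
have oO : open O by apply: irrclass_open; exact: open_interior.
have nO : nbhs (val (cov e) : irrclass) O.
  by apply: open_nbhs_nbhs; split => //; exists (val e).
have := @set_val_continuous _ _ (cov e) _ nO; apply: (@filterS _ _ (@nbhs_filter _ (cov e))) => x [u /interior_subset[Vu Au] ux].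
have [e' xE] := cov_surj x.
have /esym/irrclassE[w Ww uE] : irrclass_of u = irrclass_of (val e').
  by rewrite ux -xE.
have au : adm u by exact: Au Ww (set_mem (valP e')) uE.
exists (exist _ u (mem_set au)); first exact: VU.
by apply: val_inj; rewrite /= ux.
Qed.

(** Two points of [U] in one orbit are related by some [w] fixing [e]; such a [w] acts trivially on
    the whole space of deformations. *)
Lemma cov_locally_inj (e : E) : exists2 U : set E, nbhs e U & {in U &, injective cov}.
Proof.
have [U nU Uw] := orbit_separate (val e).
exists (set_val @^-1` U); first exact: set_val_continuous.
move=> x y /set_mem Ux /set_mem Uy /(congr1 val) /irrclassE[w Ww yE].
have aE (z : E) : adm (val z) by exact: (set_mem (valP z)).
have we : weyl_act w (val e) = val e by apply: (Uw w (val x) Ww Ux); rewrite -yE.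
have sw := adm_stab tc L_red Ww (aE e) we.
by apply: val_inj; rewrite [RHS]yE (stab_adm sw (aE x)).
Qed.

Section DeckGroup.
Hypothesis s_gt0 : (0 < s)%N.
Local Notation Z := (multi_centralizer s_gt0 Q G).

Let adm_val (e : E) : adm (val e). Proof. exact: (set_mem (valP e)). Qed.

Lemma deck_rep (A : Z) : exists x, exists Nx : sq_num Z x, A = sq_coset Nx.
Proof. exact: sq_cosetP. Qed.

Let rep (A : Z) : GL T := sval (cid (deck_rep A)).

Let repP (A : Z) : exists Nx : sq_num Z (rep A), A = sq_coset Nx.
Proof. exact: (svalP (cid (deck_rep A))). Qed.

Let repN (A : Z) : sq_num Z (rep A). Proof. by have [] := repP A. Qed.

Let weylN x : sq_num Z x -> weyl t x.
Proof. by move=> Nx; have [] := N_setwise (Ordinal s_gt0) Nx. Qed.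

(** A coset acts through a chosen representative; [deck_actE] shows that any other gives the same
    result. *)
Definition deck_act (A : Z) (e : E) : E :=
  exist _ (weyl_act (rep A) (val e) : vtop (irrtype t s))
    (mem_set (N_adm tc L_red phi_root g'Q (repN A) (adm_val e))).

Lemma weyl_actM w w' q : weyl_act (w * w')%g q = weyl_act w (weyl_act w' q).
Proof. by apply/ffunP => i; rewrite !ffunE GLME. Qed.

Lemma sq_coset_eqP x y (Nx : sq_num Z x) (Ny : sq_num Z y) :
  sq_coset Nx = sq_coset Ny <-> exists2 h, pointwise_stab (levi Q 0) h & y = (x * h)%g.
Proof.
have sH := pointwise_stab_sub (levi Q 0).
split=> [/(congr1 val) /= e|[h Hh yE]].
  have : left_coset y (sq_den Z) y by exists 1%g; [exact: subgroup1|rewrite mulg1].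
  by rewrite -e => -[h Hh <-]; exists h.
apply: val_inj; apply/seteqP; split=> [_ [k Hk <-]|_ [k Hk <-]].
  exists (h^-1 * k)%g; first by apply: (subgroupM sH) => //; exact: (subgroupV sH).
  by rewrite yE !mulgA mulgK.
by exists (h * k)%g; [exact: (subgroupM sH)|rewrite yE mulgA].
Qed.

Lemma deck_actE x (Nx : sq_num Z x) (e : E) : val (deck_act (sq_coset Nx) e) = weyl_act x (val e).
Proof.
have [Nr] := repP (sq_coset Nx) => /sq_coset_eqP[h Hh rE] /=.
by rewrite rE weyl_actM (stab_adm Hh (adm_val e)).
Qed.

Lemma deck_actM (A B : Z) e : deck_act (A * B)%g e = deck_act A (deck_act B e).
Proof.
have [x [Nx ->]] := sq_cosetP A; have [y [Ny ->]] := sq_cosetP B.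
rewrite -[(_ * _)%g]/(sq_mul _ _) sq_mulE.
by apply: val_inj; rewrite !deck_actE weyl_actM.
Qed.

Lemma deck_act_free (A B : Z) e : deck_act A e = deck_act B e -> A = B.
Proof.
have [x [Nx ->]] := sq_cosetP A; have [y [Ny ->]] := sq_cosetP B.
move=> /(congr1 val); rewrite !deck_actE => xy; apply/sq_coset_eqP.
exists (x^-1 * y)%g; last by rewrite mulgA mulgV mul1g.
apply: (adm_stab tc L_red _ (adm_val e)).
  by apply: (subgroupM W_sub); [apply: (subgroupV W_sub)|]; exact: weylN.
by rewrite weyl_actM -xy weyl_actK.
Qed.

Lemma deck_act_trans e e' : cov e = cov e' -> exists A, deck_act A e = e'.
Proof.
move=> /(congr1 val) /irrclassE[w Ww wE].
have Nw : sq_num Z w.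
  by apply: (adm_N tc L_red phi_weyl g'Q Ww (adm_val e)); rewrite -wE; exact: adm_val.
by exists (sq_coset Nw); apply: val_inj; rewrite deck_actE.
Qed.

Lemma cov_deck_act A e : cov (deck_act A e) = cov e.
Proof.
apply: val_inj; apply/esym/irrclassE; exists (rep A) => //; exact: weylN.
Qed.

Lemma deck_act_continuous A : continuous (deck_act A).
Proof.
apply: to_set_continuous => q /=.
apply: (@continuous_comp E (vtop (irrtype t s)) (vtop (irrtype t s)) set_val (weyl_act (rep A))).
  exact: set_val_continuous.
exact: weyl_act_continuous.
Qed.

End DeckGroup.

(** The linear conditions hold on the whole complex line through [Q] and [val e]. A root to be kept
    nonzero at index [i] is affine in the parameter with both end values nonzero, so
    [parabola_avoid] provides an arc. *)
Lemma adm_path (e : E) : exists f : R -> E,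
  [/\ {within `[0, 1], continuous f}, f 0 = adm_space_base g'Q & f 1 = e].
Proof.
have ae : adm (val e) := set_mem (valP e); pose b : irrtype t s := val e.
have aQ : adm Q := set_mem (valP (adm_space_base g'Q)).
have [rs us rsP] := root_list tc.
have az i := iffLR (admP Q) aQ i; have bz i := iffLR (admP b) ae i.
pose l := [seq p <- [seq (a (Q i), a (b i)) | a : linform t <- rs, i : 'I_s <- enum 'I_s] |
  (p.1 != 0) && (p.2 != 0)].
have [|c cl] := @parabola_avoid R l.
  by move=> p; rewrite mem_filter => /andP[/andP[]].
pose F (x : R) : irrtype t s := Q + parabola c x *: (b - Q).
have Fi x i : F x i = Q i + parabola c x *: (b i - Q i) by rewrite !ffunE.
have aF x : adm (F x).
  apply/admP => i; have [[Qk gQ] Qn] := az i; have [[bk gb] bn] := bz i.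
  rewrite Fi; split; first split.
  - by move=> a la; rewrite linearD linearZ linearB /= Qk // bk // subrr scaler0 addr0.
  - by rewrite linearD linearZ linearB /= gQ gb -scalerBr [RHS]scalerDr !scalerA [parabola _ _ * _]mulrC.
  move=> [a la [/= aF _]]; have [[Ra _] _] := la.
  have Qa : a (Q i) != 0 by apply/eqP => Qa; apply: Qn; exists a.
  have ba : a (b i) != 0 by apply/eqP => ba; apply: bn; exists a.
  have : (a (Q i), a (b i)) \in l.
    rewrite mem_filter /= Qa ba /=; apply: allpairs_f; last by rewrite mem_enum.
    exact/rsP.
  move=> /(cl x) /=; move: aF; rewrite linearD linearZ linearB /= => aF.
  by rewrite [X in X != 0]aF eqxx.
exists (fun x => exist _ (F x : vtop (irrtype t s)) (mem_set (aF x))); split.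
- apply: continuous_subspaceT; apply: to_set_continuous => /=.
  exact: (@vtop_scale_continuous C R (irrtype t s) _ Q (b - Q) (@parabola_continuous R c)).
- by apply: val_inj; rewrite /= /F parabola0 scale0r addr0.
- by apply: val_inj; rewrite /= /F parabola1 scale1r addrC subrK.
Qed.

End Assembly.

Theorem theorem17p16p2 (R : realType) (L : lieAlgebraType R[i])
    (t : {vspace L})
    (L_red : reductive_lie L) (t_cartan : cartan_subalgebra t)
    (D : seq (linform (t :&: lie_derived)%VS))
    (D_base : root_base (lie_roots lie_derived (t :&: lie_derived)%VS) D)
    (f : GL (subvs_of (lie_center L)))
    (f_fin : exists2 m : nat, (0 < m)%N & (f ^+ m)%g = 1%g)
    (phi' : GL (subvs_of (t :&: lie_derived)%VS))
    (phi'_aut : root_aut (lie_roots lie_derived (t :&: lie_derived)%VS) phi')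
    (phi'_base : base_aut D phi')
    (phi : GL (subvs_of t)) (phiE : is_dsum f phi' phi)
    (r s : nat) (r_gt0 : (0 < r)%N) (s_gt0 : (0 < s)%N)
    (Q : irrtype t s) (g' : GL (subvs_of t))
    (g'Q : galois_generates phi r g' Q) :
  (exists (pr : forall i : 'I_s,
             adm_space phi r Q -> adm_space_at r Q (phi * g')%g i)
          (pr_cont : forall i, continuous (pr i))
          (pr_base : forall i,
             pr i (adm_space_base g'Q) = adm_space_at_base g'Q i),
     (forall i q, val (pr i q) = (val q : irrtype t s) i) /\
     group_iso
       ((fun x i => pi1_map (pr_cont i) (pr_base i) x) :
          pi1 R (adm_space_base g'Q) ->
          dprodg (fun i : 'I_s => pi1 R (adm_space_at_base g'Q i)))) /\
  (exists p : pi1 R (adm_class_space_base g'Q) ->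
              multi_centralizer s_gt0 Q (phi * g')%g,
     short_exact
       (pi1_map (@adm_class_map_continuous _ _ _ phi r s Q)
          (erefl (adm_class_space_base g'Q)) :
          pi1 R (adm_space_base g'Q) -> pi1 R (adm_class_space_base g'Q))
       p).
Proof.
have phi_root b := outer_root t_cartan L_red phi'_aut phiE b.
have phi_weyl w := outer_weyl_conjV t_cartan L_red phi'_aut phiE (w := w).
split.
  exists (adm_proj t_cartan L_red g'Q).
  exists (@adm_proj_continuous _ _ _ t_cartan L_red _ _ _ _ _ g'Q).
  exists (adm_proj_base t_cartan L_red g'Q); split=> [//|].
  exact: adm_proj_iso.
(* The map [p] is the monodromy of the covering [adm_class_map], with [multi_centralizer] acting
   through [deck_act]. *)
eexists.
exact: (monodromy_exact (cov_surj t_cartan phi_weyl (r := r) (Q := Q))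
  (@adm_class_map_continuous _ _ _ phi r s Q)
  (cov_open t_cartan L_red phi_weyl g'Q)
  (cov_locally_inj t_cartan L_red (Q := Q))
  (set_hausdorff (@vtop_hausdorff _ _))
  (@deck_act_continuous _ _ _ t_cartan L_red _ _ _ phi_root _ _ g'Q s_gt0)
  (deck_actM t_cartan L_red phi_root g'Q (s_gt0 := s_gt0))
  (cov_deck_act t_cartan L_red phi_root g'Q (s_gt0 := s_gt0))
  (deck_act_trans t_cartan L_red phi_root phi_weyl g'Q s_gt0)
  (fun A B => @deck_act_free _ _ _ t_cartan L_red _ _ _ phi_root _ _ g'Q s_gt0 A B
    (adm_space_base g'Q))
  (adm_path t_cartan L_red g'Q)).
Qed.
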